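(* Let $J\in\mathcal{T}(V,g)$, put $S=J+\phi$ and $T=J-\phi$, and consider the skew algebroid $(\mathfrak{gl}(\mathbb{V}),[\cdot,\cdot]^{\sigma},\sigma)$ on $\mathcal{T}(V,g)$ with anchor $\sigma(A)=[SAT-TA^{*}S,\phi]$ (bracket given in the context). Let $K\in\mathcal{T}(V,g)$ and $2m_{\pm1}=\dim\mathrm{Ker}(J\pm K)$. Then $$\mathcal{T}^{(m_{1},m_{-1})}(J)=\{L\in\mathcal{T}(V,g) : \dim\mathrm{Ker}(J+L)=2m_{1},\ \dim\mathrm{Ker}(J-L)=2m_{-1}\}$$ is the associated leaf (of the foliation determined by the integrable distribution $\mathrm{Im}\,\sigma$) that passes through $K$. Moreover, it is a complex submanifold of $\mathcal{T}(V,g)$, with respect to the complex structure $I_{\mathcal{T}}$.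
   Context: $(V,g)$ is a $2n$-dimensional real vector space with a positive definite metric. $\mathcal{T}=\mathcal{T}(V,g)=\{K\in \mathrm{End}V : K^{2}=-1,\ g(K\cdot,K\cdot)=g(\cdot,\cdot)\}$, a submanifold of $\mathrm{End}V$, with $T_K\mathcal{T}=\{A\in\mathfrak{o}(V,g): AK+KA=0\}$. It carries the integrable complex structure $I_{\mathcal{T}}$ given by $I_{\mathcal{T}}A=KA$ for $A\in T_K\mathcal{T}$. $\mathbb{V}=V\times\mathcal{T}$ and $\mathfrak{gl}(\mathbb{V})=\mathrm{End}V\times\mathcal{T}$; $\phi$ is the section with $\phi|_K=K$; $J$ is regarded as a constant section. $A^{*}$ is the $g$-adjoint; $[A,B]=AB-BA$, $\{A,B\}=AB+BA$; $dB_X$ is the derivative of the map $B:\mathcal{T}\to\mathrm{End}V$ in direction $X$. The bracket on $\Gamma(\mathfrak{gl}(\mathbb{V}))$ is $$[A,B]^{\sigma}= dB_{\sigma(A)}+ \tfrac{1}{2}AS\phi S\{B,J\} -\tfrac{1}{2}\{A,J\}T\phi TB -(A \leftrightarrow B),$$ where $-(A\leftrightarrow B)$ means subtracting all preceding terms with $A$ and $B$ interchanged. A skew algebroid $(E,[\cdot,\cdot],\psi)$ on $\mathcal{T}$ is a vector bundle with a skew bracket on $\Gamma(E)$ and a bundle map $\psi:E\to T\mathcal{T}$ with $\psi([A,B])=[\psi(A),\psi(B)]_{Lie}$ and $[A,fB]=f[A,B]+\psi(A)[f]B$ for all $A,B\in\Gamma(E)$, $f\in C^\infty(\mathcal{T})$.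 Its image $\mathrm{Im}\,\psi$ is an integrable (generalized, possibly of varying rank) distribution; the associated leaves are the maximal connected integral submanifolds, i.e. those whose tangent space at each point is $\mathrm{Im}\,\psi$ at that point. *)

(* Defs.v *)
From HB Require Import structures.
From mathcomp Require Import all_boot all_order all_algebra.
From mathcomp Require Import all_classical all_reals all_analysis.

Set Implicit Arguments.
Unset Strict Implicit.
Unset Printing Implicit Defensive.

Import Order.TTheory GRing.Theory Num.Theory.
Import VectorInternalTheory numFieldNormedType.Exports.

Local Open Scope classical_set_scope.
Local Open Scope ring_scope.

(* Calculus on finite-dimensional real vector spaces.  A [vectType] carries no
   topology in the library, so open sets, smoothness and derivatives are read
   in the linear coordinates [v2r], [r2v]; the choice of the linear coordinate
   system is immaterial. *)
Section Calculus.
Context {R : realType}.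

(* C^r on an open set U, through iterated directional derivatives. *)
Fixpoint is_Ck (m k r : nat) (U : set 'rV[R]_m)
    (f : 'rV[R]_m -> 'rV[R]_k) : Prop :=
  (forall x, U x -> {for x, continuous f}) /\
  match r with
  | 0%N => True
  | r'.+1 => forall v : 'rV[R]_m,
      (forall x, U x -> derivable f x v) /\ is_Ck r' U (fun x => 'D_v f x)
  end.

Definition vopen (W : vectType R) (U : set W) : Prop :=
  open ((r2v : _ -> W) @^-1` U).

Definition vsmooth (W F : vectType R) (U : set W) (f : W -> F) : Prop :=
  forall r, is_Ck r ((r2v : _ -> W) @^-1` U) (v2r \o f \o r2v).

Definition vderive (W F : vectType R) (f : W -> F) (x v : W) : F :=
  r2v ('D_(v2r v) (v2r \o f \o r2v) (v2r x)).

(* Maps f defined on a subset X of a vector space only: f is smooth when it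
   has smooth local extensions, and its derivative along a vector tangent to X
   is that of any such extension. *)
Definition local_extension (W F : vectType R) (X : set W) (f : X -> F) (p : X)
    (G : W -> F) : Prop :=
  exists U : set W, [/\ vopen U, U (\val p), vsmooth U G &
    forall q : X, U (\val q) -> G (\val q) = f q].

Definition smooth_map (W F : vectType R) (X : set W) (f : X -> F) : Prop :=
  forall p, exists G, local_extension f p G.

Definition dmap (W F : vectType R) (X : set W) (f : X -> F) (p : X) (v : W)
    : F :=
  xget 0 [set y | exists2 G, local_extension f p G & y = vderive G (\val p) v].

Definition lie_bracket (W : vectType R) (X : set W) (Y Z : X -> W) : X -> W :=
  fun p => dmap Z p (Y p) - dmap Y p (Z p).

End Calculus.

(* Skew algebroids on a submanifold X of W, with tangent spaces TX, whose
   underlying vector bundle is the trivial bundle with fibre F. *)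
Record skew_algebroid (R : realType) (W F : vectType R) (X : set W)
    (TX : W -> set W) (br : (X -> F) -> (X -> F) -> X -> F)
    (psi : X -> F -> W) : Prop := {
  anchor_tangent : forall p a, TX (\val p) (psi p a);
  anchor_linear : forall p, linear (psi p);
  anchor_smooth : forall A : X -> F, smooth_map A ->
    smooth_map (fun p => psi p (A p));
  bracket_smooth : forall A B : X -> F, smooth_map A -> smooth_map B ->
    smooth_map (br A B);
  bracket_linear : forall (c : R) (A B C : X -> F),
    smooth_map A -> smooth_map B -> smooth_map C ->
    forall p, br (fun q => c *: A q + B q) C p = c *: br A C p + br B C p;
  bracket_skew : forall A B : X -> F, smooth_map A -> smooth_map B ->
    forall p, br A B p = - br B A p;
  anchor_bracket : forall A B : X -> F, smooth_map A -> smooth_map B ->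
    forall p, psi p (br A B p) =
      lie_bracket (fun q => psi q (A q)) (fun q => psi q (B q)) p;
  bracket_leibniz : forall (A B : X -> F) (f : X -> R^o),
    smooth_map A -> smooth_map B -> smooth_map f ->
    forall p, br A (fun q => (f q : R) *: B q) p =
      (f p : R) *: br A B p + (dmap f p (psi p (A p)) : R) *: B p
}.

(* Immersed submanifolds N of a vector space W, modelled on M.  The smooth
   structure of N is given by local parametrizations (inverses of charts).
   The manifold topology may be finer than the subspace topology; it is
   automatically Hausdorff, and second countable when N is connected. *)
Section Submanifolds.
Context {R : realType} {W : vectType R}.

Record parametrization (M : vectType R) := Parametrization {
  dom : set M;
  pmap :> M -> W
}.

Section Atlas.
Context {M : vectType R}.
Implicit Types (N O : set W) (Phi : set (parametrization M)).

Definition patch N (c : parametrization M) : Prop :=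
  [/\ vopen (dom c), vsmooth (dom c) c, set_inj (dom c) c,
      forall x v, dom c x -> vderive c x v = 0 -> v = 0 &
      c @` dom c `<=` N].

Definition compatible (c c' : parametrization M) : Prop :=
  let O := dom c `&` c @^-1` (c' @` dom c') in
  vopen O /\ exists2 tau : M -> M, vsmooth O tau &
    forall x, O x -> dom c' (tau x) /\ c' (tau x) = c x.

Definition is_atlas N Phi : Prop :=
  [/\ forall c, Phi c -> patch N c,
      forall p, N p -> exists2 c, Phi c & (c @` dom c) p &
      forall c c', Phi c -> Phi c' -> compatible c c'].

Definition manifold_open Phi O : Prop :=
  forall c, Phi c -> vopen (dom c `&` c @^-1` O).

Definition manifold_connected N Phi : Prop :=
  N !=set0 /\
  forall O, O `<=` N -> manifold_open Phi O -> manifold_open Phi (N `\` O) ->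
    O = set0 \/ O = N.

(* D is a generalized distribution on X. *)
Definition connected_integral_submanifold (X : set W) (D : W -> set W)
    N Phi : Prop :=
  [/\ N `<=` X, is_atlas N Phi, manifold_connected N Phi &
      forall c x, Phi c -> dom c x -> range (vderive c x) = D (c x)].

End Atlas.

Definition is_leaf (X : set W) (D : W -> set W) (M : vectType R) (N : set W)
    (Phi : set (parametrization M)) : Prop :=
  connected_integral_submanifold X D N Phi /\
  forall (M' : vectType R) (N' : set W) (Phi' : set (parametrization M')),
    connected_integral_submanifold X D N' Phi' -> N `<=` N' -> N' = N.

Definition is_the_leaf_through (X : set W) (D : W -> set W) (p : W)
    (M : vectType R) (N : set W) (Phi : set (parametrization M)) : Prop :=
  [/\ is_leaf X D N Phi, N p &
      forall (M' : vectType R) (N' : set W) (Phi' : set (parametrization M')),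
        is_leaf X D N' Phi' -> N' p -> N' = N].

(* C^d is modelled as R^d x R^d, (x, y) standing for x + i y. *)
Definition cspace (d : nat) : vectType R := ('rV[R]_d * 'rV[R]_d)%type.

Definition imul (d : nat) (v : cspace d) : cspace d := (- v.2, v.1).

(* I p is the complex structure of the ambient manifold X at p.  The manifold
   topology of N is required to be the subspace topology, and the local
   parametrizations to be holomorphic. *)
Definition complex_submanifold (X : set W) (I : W -> W -> W) (d : nat)
    (N : set W) (Phi : set (parametrization (cspace d))) : Prop :=
  [/\ N `<=` X, is_atlas N Phi,
      forall O, O `<=` N -> manifold_open Phi O ->
        exists2 G : set W, vopen G & O = N `&` G &
      forall c x v, Phi c -> dom c x ->
        vderive c x (imul v) = I (c x) (vderive c x v)].

End Submanifolds.

Section Twistor.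
Context {R : realType} {V : vectType R} (g : {dot V for @idfun R}).
Local Notation End := 'End(V).
Local Notation "A ** B" := (@comp_lfun R V V V A B)
  (at level 40, left associativity).

Definition adjoint (A : End) : End :=
  xget 0 [set B : End | forall x y, g (A x) y = g x (B y)].

Definition twistor : set End :=
  [set K | K ** K = - \1%VF /\ forall x y, g (K x) (K y) = g x y].

Definition orthogonal_lie_algebra : set End :=
  [set A | forall x y, g (A x) y = - g x (A y)].

Definition twistor_tangent (K : End) : set End :=
  [set A | orthogonal_lie_algebra A /\ A ** K + K ** A = 0].

Definition twistor_complex_structure (K A : End) : End := K ** A.

Definition commutator (A B : End) : End := A ** B - B ** A.
Definition anticommutator (A B : End) : End := A ** B + B ** A.

Definition sigma (J K A : End) : End :=
  let S := J + K in let T := J - K in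
  commutator (S ** A ** T - T ** adjoint A ** S) K.

(* The terms of [A, B]^sigma preceding - (A <-> B). *)
Definition sigma_half_bracket (J : End) (A B : twistor -> End) (p : twistor)
    : End :=
  let K := \val p in let S := J + K in let T := J - K in
  dmap B p (sigma J K (A p))
  + 2^-1 *: (A p ** S ** K ** S ** anticommutator (B p) J)
  - 2^-1 *: (anticommutator (A p) J ** T ** K ** T ** B p).

Definition sigma_bracket (J : End) (A B : twistor -> End) (p : twistor) : End :=
  sigma_half_bracket J A B p - sigma_half_bracket J B A p.

Definition im_sigma (J K : End) : set End := range (sigma J K).

Definition twistor_stratum (J : End) (m1 m1' : nat) : set End :=
  [set L | twistor L /\
     \dim (lker (J + L)) = m1.*2 /\ \dim (lker (J - L)) = m1'.*2].

End Twistor.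

(* Main.v *)
Require Import Defs.
From HB Require Import structures.
From mathcomp Require Import all_boot all_order all_algebra.
From mathcomp Require Import all_classical all_reals all_analysis.
From mathcomp Require Import ring lra zify.

Set Implicit Arguments.
Unset Strict Implicit.
Unset Printing Implicit Defensive.

Import Order.TTheory GRing.Theory Num.Theory.
Import VectorInternalTheory numFieldNormedType.Exports.

Local Open Scope classical_set_scope.
Local Open Scope ring_scope.

(** Write S = J + L and T = J - L for a point L of the twistor space, so that
    ST = - TS, and adj for the g-adjoint. With P = AJ + JA the anchor becomes
    sigma(A) = T adj(P) S - S P T, where P runs over all endomorphisms commuting
    with J: this is the vector field generated by an action of the complex linear
    group of (V, J). An invertible a commuting with J acts by a fractional linear
    map ([act]) that carries S and T to aSW and bTW, up to the factor 2, for a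
    common invertible W, with b the inverse of adj a. The algebroid axioms are
    pointwise computations; the one with content, [bracket_anchor], expresses
    that the fundamental fields bracket like the linear group ([sigma_algebroid]).

    The action preserves the dimensions of Ker S and Ker T, and it is transitive
    on the points with given dimensions ([act_transitive]): off the two kernels L
    is encoded by a nondegenerate skew J-antilinear form, and any two such forms
    are equivalent, by a complex Darboux argument. The complex linear group being
    path connected ([gpath_ex]), the stratum is path connected ([stratum_path]).

    To see that the stratum is a complex submanifold near one of its points K,
    write L = K (1 - A) (1 + A)^-1 with A skew and anticommuting with K. The
    dimension of Ker (J + L) is that of Ker (J + K) exactly when a Schur
    complement on Ker (J + K) vanishes ([schur_dim]), and similarly for J - L.
    These conditions determine the diagonal blocks of A on the two kernels as
    rational functions of the other blocks, so the stratum is a graph over a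
    vector space which is stable under K ([base_slice]), and the chart is
    holomorphic ([base_holomorphic]). Its tangent space at K is that vector space,
    and this is Im sigma at K ([m0_im_sigma]). Each chart comes with a smooth
    retraction of an open set onto it, so charts are compatible and the manifold
    topology is the subspace topology ([sliced_atlas], [sliced_topology]).

    For maximality, let c be a chart of an integral manifold of Im sigma, and rho
    the retraction onto the stratum near c(x0). The difference
    delta = c - rho(c) has derivative Psi(c) applied to a bounded linear map,
    where Psi(L) = sigma_L - (d rho)_L sigma_L vanishes on the stratum since
    sigma_L is tangent to it. As Psi is Lipschitz, |d delta| is at most a constant
    times |delta|, so delta vanishes near x0 ([gronwall], [integral_local]).
    Hence an integral manifold meets every stratum in an open set, and a connected
    one lies in a single stratum. *)

(** * Noncommutative rewriting *)

(** Most identities below hold in a noncommutative ring modulo relations such as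
    J^2 = -1. The tactic [nc] reflects both sides as formal combinations of words
    and rewrites subwords by the given equations, read from left to right, before
    comparing; [abel] decides identities in abelian groups. *)
Inductive ncexp := NCvar of nat | NCzero | NCone | NCadd of ncexp & ncexp
  | NCopp of ncexp | NCmul of ncexp & ncexp | NCmuln of ncexp & nat.

Definition ncpoly := seq (int * seq nat).

Section NCRing.
Variable A : pzRingType.
Implicit Types (env : seq A) (p q : ncpoly).

Fixpoint nceval env (e : ncexp) : A := match e with
  | NCvar i => nth 0 env i | NCzero => 0 | NCone => 1
  | NCadd a b => nceval env a + nceval env b
  | NCopp a => - nceval env a
  | NCmul a b => nceval env a * nceval env b
  | NCmuln a n => nceval env a *+ n
  end.

Definition weval env (w : seq nat) : A := \prod_(i <- w) nth 0 env i.
Definition peval env p : A := \sum_(m <- p) weval env m.2 *~ m.1.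

Definition pscale (c : int) p : ncpoly := [seq (c * m.1, m.2) | m <- p].
Definition pmul p q : ncpoly :=
  flatten [seq [seq (m.1 * m'.1, m.2 ++ m'.2) | m' <- q] | m <- p].

Fixpoint padd1 (m : int * seq nat) p : ncpoly := match p with
  | [::] => [:: m]
  | m' :: p' => if m.2 == m'.2 then
      (if m.1 + m'.1 == 0 then p' else (m.1 + m'.1, m.2) :: p')
    else m' :: padd1 m p'
  end.
Definition padd p q := foldr padd1 q p.

Fixpoint ncnorm (e : ncexp) : ncpoly := match e with
  | NCvar i => [:: (1, [:: i])] | NCzero => [::] | NCone => [:: (1, [::])]
  | NCadd a b => padd (ncnorm a) (ncnorm b)
  | NCopp a => pscale (-1) (ncnorm a)
  | NCmul a b => padd (pmul (ncnorm a) (ncnorm b)) [::]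
  | NCmuln a n => pscale n%:Z (ncnorm a)
  end.

Fixpoint wsplit (w pre u : seq nat) : option (seq nat * seq nat) :=
  if prefix w u then Some (pre, drop (size w) u)
  else if u is x :: u' then wsplit w (rcons pre x) u' else None.

Fixpoint wreduce1 (rules : seq (seq nat * ncpoly)) (u : seq nat)
    : option ncpoly := match rules with
  | [::] => None
  | (w, q) :: rules' => match wsplit w [::] u with
     | Some (x, y) => Some (pmul [:: (1, x)] (pmul q [:: (1, y)]))
     | None => wreduce1 rules' u end
  end.

Fixpoint preduce1 rules p : ncpoly := match p with
  | [::] => [::]
  | m :: p' => match wreduce1 rules m.2 with
     | Some q => padd (pscale m.1 q) (preduce1 rules p')
     | None => padd1 m (preduce1 rules p') end
  end.

Lemma weval_cat env u v : weval env (u ++ v) = weval env u * weval env v.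
Proof. by rewrite /weval big_cat. Qed.

Lemma peval_cons env m p : peval env (m :: p) = weval env m.2 *~ m.1 + peval env p.
Proof. by rewrite /peval big_cons. Qed.

Lemma peval_cat env p q : peval env (p ++ q) = peval env p + peval env q.
Proof. by rewrite /peval big_cat. Qed.

Lemma peval_nil env : peval env [::] = 0. Proof. by rewrite /peval big_nil. Qed.

Lemma peval_scale env c p : peval env (pscale c p) = peval env p *~ c.
Proof.
elim: p => [|m p IH]; first by rewrite !peval_nil mul0rz.
by rewrite /= !peval_cons IH /= mulrzDl [c * _]mulrC mulrzA.
Qed.

Lemma peval_mul env p q : peval env (pmul p q) = peval env p * peval env q.
Proof.
elim: p => [|m p IH]; first by rewrite !peval_nil mul0r.
rewrite /pmul /= peval_cat peval_cons mulrDl; congr (_ + _); last exact: IH.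
elim: q {p IH} => [|m' q IH] /=; first by rewrite !peval_nil mulr0.
rewrite !peval_cons mulrDr IH /=; congr (_ + _).
by rewrite weval_cat mulrzAl mulrzAr -mulrzA (mulrC m.1).
Qed.

Lemma peval_add1 env m p : peval env (padd1 m p) = weval env m.2 *~ m.1 + peval env p.
Proof.
elim: p => [|m' p IH] /=; first by rewrite peval_cons.
case: eqP => [e|_]; last by rewrite !peval_cons IH addrCA.
rewrite !peval_cons -e addrA -mulrzDr; case: eqP => [->|_].
  by rewrite mulr0z add0r.
by rewrite peval_cons.
Qed.

Lemma peval_add env p q : peval env (padd p q) = peval env p + peval env q.
Proof.
elim: p => [|m p IH] /=; first by rewrite peval_nil add0r.
by rewrite peval_add1 IH peval_cons addrA.
Qed.

Lemma ncnormP env e : nceval env e = peval env (ncnorm e).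
Proof.
elim: e => [i| | |a Ha b Hb|a Ha|a Ha b Hb|a Ha n] /=.
- by rewrite peval_cons peval_nil /= addr0 /weval big_seq1.
- by rewrite peval_nil.
- by rewrite peval_cons peval_nil /weval big_nil addr0.
- by rewrite peval_add Ha Hb.
- by rewrite peval_scale Ha mulrN1z.
- by rewrite peval_add peval_nil addr0 peval_mul Ha Hb.
- by rewrite peval_scale Ha.
Qed.

Definition rules_hold env (rules : seq (seq nat * ncpoly)) :=
  foldr (fun r P => weval env r.1 = peval env r.2 /\ P) True rules.

Lemma wsplitP w pre u x y : wsplit w pre u = Some (x, y) -> pre ++ u = x ++ w ++ y.
Proof.
elim: u pre => [|a u IH] pre /=.
  by case: w => //= [] [<- <-].
case: ifP => [h|_]; last by move/IH; rewrite cat_rcons.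
by have [z ->] := elimT (@prefixP _ w (a :: u)) h; case=> <- <-; rewrite drop_size_cat.
Qed.

Lemma wreduce1P env rules u q : rules_hold env rules ->
  wreduce1 rules u = Some q -> weval env u = peval env q.
Proof.
elim: rules => [|[w r] rules IH] //= [h hr]; case e: wsplit => [[x y]|]; last exact: IH.
case=> <-; move/wsplitP: e => /= ->; rewrite !weval_cat h !peval_mul.
by rewrite !peval_cons !peval_nil /= !addr0.
Qed.

Lemma preduce1P env rules p : rules_hold env rules ->
  peval env (preduce1 rules p) = peval env p.
Proof.
move=> hr; elim: p => [|m p IH] //=; case e: wreduce1 => [q|]; last first.
  by rewrite peval_add1 IH peval_cons.
by rewrite peval_add peval_scale IH -(wreduce1P hr e) peval_cons.
Qed.

Definition ncrule (r : ncexp * ncexp) : seq (seq nat * ncpoly) :=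
  if ncnorm r.1 is [:: (Posz 1, w)] then [:: (w, ncnorm r.2)] else [::].

Definition nchold env (rs : seq (ncexp * ncexp)) :=
  foldr (fun r P => nceval env r.1 = nceval env r.2 /\ P) True rs.

Lemma ncruleP env rs : nchold env rs -> rules_hold env (flatten (map ncrule rs)).
Proof.
elim: rs => [|[a b] rs IH] //= [hab /IH h]; rewrite /ncrule /=.
case e: (ncnorm a) => [|[[[|[|c]]|c] w] [|? ?]] //=; split => //.
by rewrite -ncnormP -hab ncnormP e peval_cons peval_nil addr0.
Qed.

Definition nccheck fuel rs (a b : ncexp) : bool :=
  nilp (iter fuel (preduce1 (flatten (map ncrule rs)))
   (ncnorm (NCadd a (NCopp b)))).

Lemma nccheckP env fuel rs a b : nchold env rs -> nccheck fuel rs a b ->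
  nceval env a = nceval env b.
Proof.
move=> /ncruleP hr /nilP h; apply/eqP; rewrite -subr_eq0; apply/eqP.
rewrite -[LHS]/(nceval env (NCadd a (NCopp b))) ncnormP.
transitivity (peval env (iter fuel (preduce1 (flatten (map ncrule rs)))
   (ncnorm (NCadd a (NCopp b))))); last by rewrite h peval_nil.
by elim: fuel {h} => // n IH; rewrite iterS preduce1P.
Qed.
End NCRing.

Ltac nc_mem x l := match l with
  | nil => false | x :: _ => true | _ :: ?l' => nc_mem x l' end.
Ltac nc_add x l := match nc_mem x l with true => l | false => constr:(x :: l) end.
Ltac nc_idx x l := match l with
  | x :: _ => constr:(0%N) | _ :: ?l' => let n := nc_idx x l' in constr:(n.+1) end.
Ltac nc_atoms t l := lazymatch t with
  | (?a + ?b)%R => let l := nc_atoms a l in nc_atoms b l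
  | (- ?a)%R => nc_atoms a l
  | (?a * ?b)%R => let l := nc_atoms a l in nc_atoms b l
  | (?a *+ ?n)%R => nc_atoms a l
  | 0%R => l | 1%R => l
  | _ => nc_add t l end.
Ltac nc_reify t l := lazymatch t with
  | (?a + ?b)%R => let a := nc_reify a l in let b := nc_reify b l in constr:(NCadd a b)
  | (- ?a)%R => let a := nc_reify a l in constr:(NCopp a)
  | (?a * ?b)%R => let a := nc_reify a l in let b := nc_reify b l in constr:(NCmul a b)
  | (?a *+ ?n)%R => let a := nc_reify a l in constr:(NCmuln a n)
  | 0%R => constr:(NCzero) | 1%R => constr:(NCone)
  | _ => let i := nc_idx t l in constr:(NCvar i) end.
Ltac nc_ratom h l := lazymatch type of h with ?a = ?b =>
  let l := nc_atoms a l in nc_atoms b l end.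
Ltac nc_ratoms r l := lazymatch r with
  | tt => l
  | (?r', ?h) => let l := nc_ratoms r' l in nc_ratom h l
  | ?h => nc_ratom h l end.
Ltac nc_rule h l q := lazymatch type of h with ?a = ?b =>
  let a := nc_reify a l in let b := nc_reify b l in constr:((a, b) :: q) end.
Ltac nc_rules r l := lazymatch r with
  | tt => constr:(@nil (ncexp * ncexp))
  | (?r', ?h) => let q := nc_rules r' l in nc_rule h l q
  | ?h => nc_rule h l (@nil (ncexp * ncexp)) end.
Ltac nc_prf r := lazymatch r with
  | tt => exact I
  | (?r', ?h) => split; [exact h | nc_prf r']
  | ?h => split; [exact h | exact I] end.

Ltac nc_main r n := lazymatch goal with |- @eq ?T ?a ?b =>
  let l := nc_atoms a (@nil T) in let l := nc_atoms b l in
  let l := nc_ratoms r l in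
  let ea := nc_reify a l in let eb := nc_reify b l in
  let rs := nc_rules r l in
  refine (@nccheckP _ l n rs ea eb _ _);
  [ nc_prf r | vm_compute; reflexivity ] end.
(* Sixty passes bound the number of rewriting rounds; normal forms are stable
   under further passes. *)
Tactic Notation "nc" := nc_main tt 0%N.
Tactic Notation "nc" constr(r) := nc_main r 60%N.

Section AbelianGroup.
Variable A : zmodType.
Implicit Types (env : seq A).

Fixpoint abeval env (e : ncexp) : A := match e with
  | NCvar i => nth 0 env i
  | NCadd a b => abeval env a + abeval env b
  | NCopp a => - abeval env a
  | NCmuln a n => abeval env a *+ n
  | _ => 0
  end.

Fixpoint abcoef (e : ncexp) (i : nat) : int := match e with
  | NCvar j => (j == i)%:Z
  | NCadd a b => abcoef a i + abcoef b i
  | NCopp a => - abcoef a i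
  | NCmuln a n => abcoef a i * n%:Z
  | _ => 0
  end.

Fixpoint abbound (e : ncexp) (n : nat) : bool := match e with
  | NCvar j => (j < n)%N
  | NCadd a b => abbound a n && abbound b n
  | NCopp a => abbound a n
  | NCmuln a _ => abbound a n
  | _ => true
  end.

Lemma abevalE env e : abbound e (size env) ->
  abeval env e = \sum_(i < size env) nth 0 env i *~ abcoef e i.
Proof.
elim: e => [j| | |a Ha b Hb|a Ha|a Ha b Hb|a Ha n] //=.
- move=> jn; rewrite (bigD1 (Ordinal jn)) //= eqxx big1 ?addr0 // => i.
  by rewrite -val_eqE /= eq_sym => /negPf->.
- by rewrite big1.
- by rewrite big1.
- by move=> /andP[/Ha-> /Hb->]; rewrite -big_split; apply: eq_bigr => i _; rewrite mulrzDr.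
- by move=> /Ha->; rewrite -sumrN; apply: eq_bigr => i _; rewrite mulrNz.
- by rewrite big1.
- by move=> /Ha->; rewrite -sumrMnl; apply: eq_bigr => i _; rewrite mulrzA.
Qed.

Definition abcheck n (a b : ncexp) :=
  [&& abbound a n, abbound b n & all (fun i => abcoef a i == abcoef b i) (iota 0 n)].

Lemma abcheckP env a b : abcheck (size env) a b -> abeval env a = abeval env b.
Proof.
move=> /and3P[ha hb /allP h]; rewrite !abevalE //; apply: eq_bigr => i _.
by rewrite (eqP (h (i : nat) _)) // mem_iota /= add0n.
Qed.
End AbelianGroup.

(* Atoms are compared up to conversion, since the same scaling may be reached
   through several instances. *)
Ltac ab_mem x l := lazymatch l with
  | nil => constr:(false)
  | ?y :: ?l' => match constr:(tt) with
     | _ => let u := constr:(@Logic.eq_refl _ x : x = y) in constr:(true)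
     | _ => ab_mem x l' end end.
Ltac ab_idx x l := lazymatch l with
  | ?y :: ?l' => match constr:(tt) with
     | _ => let u := constr:(@Logic.eq_refl _ x : x = y) in constr:(0%N)
     | _ => let n := ab_idx x l' in constr:(n.+1) end end.
Ltac ab_add x l := match ab_mem x l with true => l | false => constr:(x :: l) end.
Ltac ab_atoms t l := lazymatch t with
  | (?a + ?b)%R => let l := ab_atoms a l in ab_atoms b l
  | (- ?a)%R => ab_atoms a l
  | (?a *+ ?n)%R => ab_atoms a l
  | 0%R => l
  | _ => ab_add t l end.
Ltac ab_reify t l := lazymatch t with
  | (?a + ?b)%R => let a := ab_reify a l in let b := ab_reify b l in constr:(NCadd a b)
  | (- ?a)%R => let a := ab_reify a l in constr:(NCopp a)
  | (?a *+ ?n)%R => let a := ab_reify a l in constr:(NCmuln a n)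
  | 0%R => constr:(NCzero)
  | _ => let i := ab_idx t l in constr:(NCvar i) end.
Ltac abel := lazymatch goal with |- @eq ?T ?a ?b =>
  let l := ab_atoms a (@nil T) in let l := ab_atoms b l in
  let ea := ab_reify a l in let eb := ab_reify b l in
  refine (@abcheckP _ l ea eb _); vm_compute; reflexivity end.

(** * Differential calculus on finite-dimensional vector spaces *)

Section RowNorm.
Context {R : realType}.

Lemma rowP_le m (x : 'rV[R]_m) (c : R) : 0 <= c ->
  (`|x| <= c) <-> (forall j, `|x 0 j| <= c).
Proof.
move=> c0; rewrite [`|x|]/Num.Def.normr/= mx_normrE; split=> [h j|h].
  apply: le_trans h; exact: (le_bigmax _ (fun ij : 'I_1 * 'I_m => `|x ij.1 ij.2|) (0, j)).
by apply: (bigmax_le _ c0) => -[i j] _ /=; rewrite (ord1 i).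
Qed.

Lemma row_le_norm m (x : 'rV[R]_m) j : `|x 0 j| <= `|x|.
Proof. by have /rowP_le := lexx `|x|; apply. Qed.

Lemma nbhs_rowP m (x : 'rV[R]_m) (P : set 'rV[R]_m) :
  nbhs x P <-> exists2 e : R, 0 < e & forall y, `|y - x| < e -> P y.
Proof.
split=> [/(nbhs_normP x P).1[e /= e0 h]|[e e0 h]].
  by exists e => // y yx; apply: h; rewrite /ball_ /= distrC.
by apply: (nbhs_normP x P).2; exists e => // y; rewrite /ball_ /= distrC; apply: h.
Qed.
End RowNorm.

Section VNorm.
Context {R : realType}.
Implicit Types W F G H : vectType R.

Definition vnorm W (w : W) : R := `|v2r w|.

Lemma vnorm_ge0 W (w : W) : 0 <= vnorm w. Proof. exact: normr_ge0. Qed.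
Lemma vnorm0 W : vnorm (0 : W) = 0. Proof. by rewrite /vnorm linear0 normr0. Qed.
Lemma vnormD W (u w : W) : vnorm (u + w) <= vnorm u + vnorm w.
Proof. by rewrite /vnorm linearD ler_normD. Qed.
Lemma vnormN W (w : W) : vnorm (- w) = vnorm w.
Proof. by rewrite /vnorm linearN normrN. Qed.
Lemma vnormZ W a (w : W) : vnorm (a *: w) = `|a| * vnorm w.
Proof. by rewrite /vnorm linearZ normrZ. Qed.
Lemma vnorm_eq0 W (w : W) : (vnorm w == 0) = (w == 0).
Proof. by rewrite /vnorm normr_eq0 -(inj_eq (@v2r_inj _ W)) linear0. Qed.
Lemma vnorm_le0 W (w : W) : vnorm w <= 0 -> w = 0.
Proof. by move=> h; apply/eqP; rewrite -vnorm_eq0 eq_le h vnorm_ge0. Qed.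
Lemma vnorm_sum W I (r : seq I) (f : I -> W) :
  vnorm (\sum_(i <- r) f i) <= \sum_(i <- r) vnorm (f i).
Proof.
elim: r => [|i r IH]; first by rewrite !big_nil vnorm0.
by rewrite !big_cons (le_trans (vnormD _ _)) ?lerD.
Qed.

Definition vb W (i : 'I_(dim W)) : W := r2v (delta_mx 0 i).
Definition vc W (w : W) (i : 'I_(dim W)) : R := v2r w 0 i.

Lemma vc_sum W (w : W) : w = \sum_i vc w i *: vb i.
Proof.
rewrite -{1}[w]v2rK {1}[v2r w]row_sum_delta linear_sum.
by apply: eq_bigr => i _; rewrite linearZ.
Qed.

Lemma vc_le W (w : W) i : `|vc w i| <= vnorm w. Proof. exact: row_le_norm. Qed.

Lemma lin_fun_sum W F (f : W -> F) (hf : linear f) (w : W) :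
  f w = \sum_i vc w i *: f (vb i).
Proof.
pose L : {linear W -> F} := HB.pack f (GRing.isLinear.Build _ _ _ _ f hf).
change (L w = \sum_i vc w i *: L (vb i)); rewrite {1}[w]vc_sum linear_sum.
by apply: eq_bigr => i _; rewrite linearZ.
Qed.

Lemma lfnE W F (f : W -> F) (hf : linear f) w : linfun f w = f w.
Proof.
pose L : {linear W -> F} := HB.pack f (GRing.isLinear.Build _ _ _ _ f hf).
exact: (lfunE L).
Qed.

Lemma lin_lin W F (f : {linear W -> F}) : linear f.
Proof. by move=> a u v; rewrite linearP. Qed.

Lemma lin_bound W F (f : W -> F) : linear f ->
  exists2 C, 0 <= C & forall w, vnorm (f w) <= C * vnorm w.
Proof.
move=> hf; exists (\sum_i vnorm (f (vb i))); first by rewrite sumr_ge0 // => i _; exact: vnorm_ge0.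
move=> w; rewrite (lin_fun_sum hf) (le_trans (vnorm_sum _ _)) // mulr_suml.
by apply: ler_sum => i _; rewrite vnormZ mulrC ler_wpM2l ?vnorm_ge0 ?vc_le.
Qed.

Definition bilin W F G (b : W -> F -> G) :=
  (forall u, linear (b u)) /\ (forall w, linear (fun u => b u w)).

Lemma app_bilin W F : bilin (fun (A : 'Hom(W, F)) w => A w).
Proof. by split=> [A|w] k u v; rewrite ?linearP // add_lfunE scale_lfunE. Qed.

Lemma bilin_bound W F G (b : W -> F -> G) : bilin b ->
  exists2 C, 0 <= C & forall u w, vnorm (b u w) <= C * vnorm u * vnorm w.
Proof.
move=> [hl hr].
have /choice[C hC] : forall i, exists C, 0 <= C /\ forall w, vnorm (b (vb i) w) <= C * vnorm w.
  by move=> i; have [C C0 h] := lin_bound (hl (vb i)); exists C.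
exists (\sum_i C i); first by rewrite sumr_ge0 // => i _; case: (hC i).
move=> u w; rewrite (lin_fun_sum (hr w)) (le_trans (vnorm_sum _ _)) // -mulrA mulr_suml.
apply: ler_sum => i _; rewrite vnormZ mulrCA ler_pM ?vc_le ?vnorm_ge0 //.
by case: (hC i).
Qed.

(** ** Neighbourhoods *)
Definition vnb W (x : W) : set_system W :=
  fun P => exists2 e : R, 0 < e & forall y, vnorm (y - x) < e -> P y.

Global Instance vnb_filter W (x : W) : ProperFilter (vnb x).
Proof.
split; first by case=> e e0 /(_ x); rewrite subrr vnorm0; apply.
split; first by exists 1.
  move=> P Q [e e0 hP] [e' e'0 hQ]; exists (Num.min e e'); first by rewrite lt_min e0.
  by move=> y; rewrite lt_min => /andP[/hP ? /hQ ?].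
by move=> P Q PQ [e e0 h]; exists e => // y /h /PQ.
Qed.

Lemma vnb_self W (x : W) P : vnb x P -> P x.
Proof. by case=> e e0; apply; rewrite subrr vnorm0. Qed.

Lemma vnb_ball W (x : W) (e : R) : 0 < e -> \forall y \near vnb x, vnorm (y - x) < e.
Proof. by move=> e0; exists e. Qed.

Lemma vnb_rowP W (x : W) (P : set W) : vnb x P <-> nbhs (v2r x) (r2v @^-1` P).
Proof.
rewrite nbhs_rowP; split=> -[e e0 h]; exists e => // y yx.
  by apply: h; rewrite /vnorm linearB /= r2vK.
by rewrite -[y]v2rK; apply: h; rewrite -linearB.
Qed.

Lemma vopenP W (U : set W) : vopen U <-> forall x, U x -> vnb x U.
Proof.
rewrite /vopen openE; split=> h x.
  by move=> Ux; apply/vnb_rowP; apply: h; rewrite /= v2rK.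
by move=> /= /h/vnb_rowP; rewrite r2vK.
Qed.

Lemma vopenI W (U U' : set W) : vopen U -> vopen U' -> vopen (U `&` U').
Proof. by move=> /vopenP h /vopenP h'; apply/vopenP => x [/h ? /h' ?]; apply: filterI. Qed.

Lemma vopenT W : vopen [set: W].
Proof. by apply/vopenP => x _; exists 1. Qed.

Definition vcont W F (f : W -> F) (x : W) :=
  forall P, vnb (f x) P -> \forall y \near vnb x, P (f y).

Lemma vcontP W F (f : W -> F) (x : W) :
  vcont f x <-> forall e, 0 < e -> \forall y \near vnb x, vnorm (f y - f x) < e.
Proof.
split=> [h e e0|h P [e e0 hP]]; first by apply: (h (fun z => vnorm (z - f x) < e)); exact: vnb_ball.
by have := h e e0; apply: filterS => y /hP.
Qed.

Lemma vopen_preim W F (f : W -> F) (U : set W) (U' : set F) : vopen U -> vopen U' ->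
  (forall x, U x -> vcont f x) -> vopen (U `&` f @^-1` U').
Proof.
move=> /vopenP h /vopenP h' hf; apply/vopenP => x [Ux fx]; apply: filterI; first exact: h.
exact: (hf _ Ux _ (h' _ fx)).
Qed.

Lemma vcont_continuous W F (f : W -> F) (x : W) :
  vcont f x <-> {for v2r x, continuous (v2r \o f \o r2v)}.
Proof.
split=> h P.
  move=> hP; have /h/vnb_rowP : vnb (f x) (v2r @^-1` P).
    apply/vnb_rowP; rewrite -[X in nbhs _ X]/((v2r \o r2v) @^-1` P).
    by move: hP; rewrite /= v2rK; apply: filterS => y; rewrite /= r2vK.
  by [].
move/vnb_rowP => hP; apply/vnb_rowP.
have H : nbhs ((v2r \o f \o r2v) (v2r x)) (r2v @^-1` P) by rewrite /= v2rK.
have : nbhs (v2r x) ((v2r \o f \o r2v) @^-1` (r2v @^-1` P)) := h _ H.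
by apply: filterS => y /=; rewrite v2rK.
Qed.

(** ** Derivatives *)
(** Frechet differentiability, with the derivative as a linear map: unlike
    directional derivatives, this is stable under composition. *)
Definition hasd W F (f : W -> F) (x : W) (D : 'Hom(W, F)) :=
  forall e : R, 0 < e ->
    \forall y \near vnb x, vnorm (f y - f x - D (y - x)) <= e * vnorm (y - x).

Lemma lfun_bound W F (D : 'Hom(W, F)) :
  exists2 C, 0 < C & forall w, vnorm (D w) <= C * vnorm w.
Proof.
have [C C0 h] := lin_bound (lin_lin D); exists (C + 1); first by rewrite ltr_wpDl.
by move=> w; rewrite (le_trans (h w)) // ler_wpM2r ?vnorm_ge0 // lerDl.
Qed.

Lemma hasd_lip W F (f : W -> F) x D : hasd f x D ->
  exists2 C, 0 < C & \forall y \near vnb x, vnorm (f y - f x) <= C * vnorm (y - x).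
Proof.
move=> h; have [C C0 hC] := lfun_bound D; exists (1 + C); first by rewrite addr_gt0.
have := h 1 ltr01; apply: filterS => y hy; rewrite -(subrK (D (y - x)) (f y - f x)).
by rewrite (le_trans (vnormD _ _)) // mulrDl lerD.
Qed.

Lemma hasd_cont W F (f : W -> F) x D : hasd f x D -> vcont f x.
Proof.
move=> /hasd_lip[C C0 h]; apply/vcontP => e e0.
near=> y; have hy : vnorm (y - x) < e / C by near: y; apply: vnb_ball; rewrite divr_gt0.
have : vnorm (f y - f x) <= C * vnorm (y - x) by near: y.
by move/le_lt_trans; apply; rewrite mulrC -ltr_pdivlMr.
Unshelve. all: by end_near. Qed.

Lemma hasd_ext W F (f g : W -> F) x D : (\forall y \near vnb x, f y = g y) ->
  hasd f x D -> hasd g x D.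
Proof.
move=> fg h e /h he; near=> y; rewrite -(vnb_self fg).
have <- : f y = g y by near: y.
by near: y.
Unshelve. all: by end_near. Qed.

Lemma hasd_cst W F (c : F) (x : W) : hasd (fun=> c) x 0.
Proof.
move=> e e0; near=> y; rewrite subrr sub0r vnormN zero_lfunE vnorm0.
by rewrite mulr_ge0 ?vnorm_ge0 // ltW.
Unshelve. all: by end_near. Qed.

Lemma hasd_lin W F (L : 'Hom(W, F)) (x : W) : hasd L x L.
Proof.
move=> e e0; near=> y; rewrite linearB subrr vnorm0.
by rewrite mulr_ge0 ?vnorm_ge0 // ltW.
Unshelve. all: by end_near. Qed.

Lemma hasdD W F (f g : W -> F) x D D' : hasd f x D -> hasd g x D' ->
  hasd (fun y => f y + g y) x (D + D').
Proof.
move=> hf hg e e0; have e2 : 0 < e / 2 by rewrite divr_gt0.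
near=> y; have h1 : vnorm (f y - f x - D (y - x)) <= e / 2 * vnorm (y - x).
  by near: y; exact: hf.
have h2 : vnorm (g y - g x - D' (y - x)) <= e / 2 * vnorm (y - x).
  by near: y; exact: hg.
rewrite add_lfunE [X in vnorm X](_ : _ = (f y - f x - D (y - x)) + (g y - g x - D' (y - x))); last first.
  by rewrite [RHS]addrACA -opprD; congr (_ - _); rewrite [RHS]addrACA -opprD.
by rewrite (le_trans (vnormD _ _)) // [in leRHS](splitr e) mulrDl lerD.
Unshelve. all: by end_near. Qed.

Lemma hasd_comp W F G (f : W -> F) (g : F -> G) x D D' :
  hasd f x D -> hasd g (f x) D' -> hasd (g \o f) x (D' \o D)%VF.
Proof.
move=> hf hg e e0; have [C C0 hC] := lfun_bound D'; have [L L0 hL] := hasd_lip hf.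
have e1 : 0 < e / 2 / C by rewrite !divr_gt0.
have e2 : 0 < e / 2 / L by rewrite !divr_gt0.
near=> y; have h1 : vnorm (f y - f x - D (y - x)) <= e / 2 / C * vnorm (y - x).
  by near: y; exact: hf.
have h2 : vnorm (g (f y) - g (f x) - D' (f y - f x)) <= e / 2 / L * vnorm (f y - f x).
  by near: y; exact: (hasd_cont hf (hg _ e2)).
have h3 : vnorm (f y - f x) <= L * vnorm (y - x) by near: y.
rewrite /= comp_lfunE -(subrKA (D' (f y - f x))) -linearB.
rewrite (le_trans (vnormD _ _)) // [in leRHS](splitr e) mulrDl lerD //.
  rewrite (le_trans h2) // (_ : e / 2 * vnorm (y - x) = e / 2 / L * (L * vnorm (y - x))).
    by rewrite ler_wpM2l // ltW.
  by rewrite mulrA divfK // gt_eqF.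
rewrite (le_trans (hC _)) // (_ : e / 2 * vnorm (y - x) = C * (e / 2 / C * vnorm (y - x))).
  by rewrite ler_wpM2l // ltW.
by rewrite mulrA mulrCA divff ?gt_eqF // mulr1.
Unshelve. all: by end_near. Qed.

End VNorm.

(** * The ring of endomorphisms and smooth maps *)
HB.instance Definition _ (R : realType) (V : vectType R) :=
  GRing.Zmodule_isPzRing.Build 'End(V) (@comp_lfunA _ _ _ _ _)
   (@comp_lfun1l _ _ _) (@comp_lfun1r _ _ _) (@comp_lfunDl _ _ _ _) (@comp_lfunDr _ _ _ _).

Section EndRing.
Context {R : realType}.
Variable V : vectType R.
Implicit Types A B : 'End(V).

Lemma mulEE A B u : (A * B) u = A (B u). Proof. exact: comp_lfunE. Qed.
Lemma oneEE u : (1 : 'End(V)) u = u. Proof. exact: id_lfunE. Qed.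
Lemma scaleEl a A B : a *: (A * B) = (a *: A) * B. Proof. exact: comp_lfunZl. Qed.
Lemma scaleEr a A B : a *: (A * B) = A * (a *: B). Proof. exact: comp_lfunZr. Qed.

Lemma mul_bilin : bilin (fun A B : 'End(V) => A * B).
Proof.
by split=> [A|B] a u v /=; rewrite ?mulrDr ?mulrDl -?scaleEr -?scaleEl.
Qed.

Lemma lker0_mulV A : lker A == 0%VS -> A * A^-1%VF = 1.
Proof. exact: lker0_compfV. Qed.
Lemma lker0_Vmul A : lker A == 0%VS -> A^-1%VF * A = 1.
Proof. exact: lker0_compVf. Qed.
Lemma lker0_mul A B : A * B = 1 -> lker B == 0%VS.
Proof. by move=> AB; apply/lker0P; apply: (can_inj (g := A)) => u; rewrite -mulEE AB oneEE. Qed.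
Lemma mul1_inv A B : A * B = 1 -> A = B^-1%VF.
Proof.
by move=> AB; rewrite -[LHS]mulr1 -(lker0_mulV (lker0_mul AB)) mulrA AB mul1r.
Qed.
End EndRing.

Section Smoothness.
Context {R : realType}.
Implicit Types W F G H : vectType R.

Definition precomp W F G (b : F -> G) (E : 'Hom(W, F)) : 'Hom(W, G) :=
  linfun (fun v => b (E v)).

Lemma precompE W F G (b : F -> G) (E : 'Hom(W, F)) v : linear b ->
  precomp b E v = b (E v).
Proof. by move=> hb; rewrite /precomp lfnE // => a u w; rewrite linearP hb. Qed.

Lemma bilin_l W F G H (b : F -> H -> G) : bilin b ->
  bilin (fun (E : 'Hom(W, F)) w => precomp (b^~ w) E).
Proof.
move=> [hl hr]; split=> [E|w] a u v; apply/lfunP => z.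
  by rewrite add_lfunE scale_lfunE !precompE // hl.
by rewrite add_lfunE scale_lfunE !precompE // add_lfunE scale_lfunE hr.
Qed.

Lemma bilin_r W F G H (b : F -> H -> G) : bilin b ->
  bilin (fun u (E : 'Hom(W, H)) => precomp (b u) E).
Proof.
move=> [hl hr]; split=> [E|w] a u v; apply/lfunP => z.
  by rewrite add_lfunE scale_lfunE !precompE // add_lfunE scale_lfunE hl.
by rewrite add_lfunE scale_lfunE !precompE // hr.
Qed.

Lemma hasd_bilin W F G H (b : F -> H -> G) (f : W -> F) (h : W -> H) x D D' :
  bilin b -> hasd f x D -> hasd h x D' ->
  hasd (fun y => b (f y) (h y)) x (precomp (b^~ (h x)) D + precomp (b (f x)) D').
Proof.
move=> hb hf hh e e0; have [C C0 hC] := bilin_bound hb.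
have [hl hr] := hb.
have bB1 u u' w : b (u - u') w = b u w - b u' w.
  by rewrite -[u - u']addrC -scaleN1r hr scaleN1r addrC.
have bB2 u w w' : b u (w - w') = b u w - b u w'.
  by rewrite -[w - w']addrC -scaleN1r hl scaleN1r addrC.
have [L L0 hL] := hasd_lip hf; have [L' L'0 hL'] := hasd_lip hh.
pose M := C * (vnorm (h x) + vnorm (f x) + L * L') + 1.
have M0 : 0 < M by rewrite ltr_wpDl // mulr_ge0 // !addr_ge0 ?vnorm_ge0 ?mulr_ge0 // ltW.
have e1 : 0 < e / M by rewrite divr_gt0.
near=> y; have h1 : vnorm (f y - f x - D (y - x)) <= e / M * vnorm (y - x).
  by near: y; exact: hf.
have h2 : vnorm (h y - h x - D' (y - x)) <= e / M * vnorm (y - x).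
  by near: y; exact: hh.
have h3 : vnorm (f y - f x) <= L * vnorm (y - x) by near: y.
have h4 : vnorm (h y - h x) <= L' * vnorm (y - x) by near: y.
have h5 : vnorm (y - x) < e / M by near: y; exact: vnb_ball.
rewrite add_lfunE !precompE //.
have -> : b (f y) (h y) - b (f x) (h x) - (b (D (y - x)) (h x) + b (f x) (D' (y - x)))
  = b (f y - f x - D (y - x)) (h x) + b (f x) (h y - h x - D' (y - x))
    + b (f y - f x) (h y - h x).
  by rewrite !(bB1, bB2); abel.
rewrite (le_trans (vnormD _ _)) // (le_trans (lerD (vnormD _ _) (lexx _))) //.
set N := vnorm (y - x) in h1 h2 h3 h4 h5 *.
have N0 : 0 <= N by exact: vnorm_ge0.
apply: (@le_trans _ _ (C * (e / M * N) * vnorm (h x) + C * vnorm (f x) * (e / M * N)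
   + C * (L * N) * (L' * (e / M)))).
  apply: lerD; first apply: lerD.
  - by rewrite (le_trans (hC _ _)) // ler_wpM2r ?vnorm_ge0 // ler_wpM2l.
  - by rewrite (le_trans (hC _ _)) // ler_wpM2l // mulr_ge0 ?vnorm_ge0.
  - rewrite (le_trans (hC _ _)) // ler_pM ?mulr_ge0 ?vnorm_ge0 ?ler_wpM2l //.
    by rewrite (le_trans h4) // ler_wpM2l // ltW.
have -> : C * (e / M * N) * vnorm (h x) + C * vnorm (f x) * (e / M * N)
   + C * (L * N) * (L' * (e / M)) = (M - 1) * (e / M * N) by rewrite /M; ring.
rewrite mulrBl mul1r (_ : M * _ = e * N); last first.
  by rewrite mulrA [M * _]mulrC divfK ?gt_eqF.
by rewrite gerBl mulr_ge0 // ltW.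
Unshelve. all: by end_near. Qed.

(** The resolvent identity shows that A^-1 is differentiable in A. *)
Lemma hasd_inv (V : vectType R) (A : 'End(V)) : lker A == 0%VS ->
  vnb A (fun B => lker B == 0%VS) /\
  hasd (fun B : 'End(V) => B^-1%VF) A
    (linfun (fun H : 'End(V) => - (A^-1%VF * H * A^-1%VF))).
Proof.
move=> A0; pose I : 'End(V) := A^-1%VF.
have AI : A * I = 1 by exact: lker0_mulV.
have IA : I * A = 1 by exact: lker0_Vmul.
have [c c0 hc] := bilin_bound (mul_bilin V).
have [k k0 hk] := bilin_bound (app_bilin V V).
have near_inv : vnb A (fun B => lker B == 0%VS).
  exists (k * (c * vnorm I) + 1)^-1.
    by rewrite invr_gt0 ltr_wpDl // !mulr_ge0 ?vnorm_ge0.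
  move=> B hB.
  apply/lker0P => u w uw; apply/eqP; rewrite -subr_eq0; apply/eqP.
  have Bz : B (u - w) = 0 by rewrite linearB /= uw subrr.
  move: (u - w) Bz => z Bz; apply/vnorm_le0; rewrite leNgt; apply/negP => z0.
  have zE : z = - ((I * (B - A)) z).
    by rewrite mulrBr IA add_lfunE opp_lfunE mulEE Bz linear0 sub0r oneEE opprK.
  have := hk (I * (B - A)) z; rewrite -[leLHS]vnormN -zE => h.
  have := le_trans h (ler_wpM2r (vnorm_ge0 _) (ler_wpM2l k0 (hc _ _))).
  rewrite -[leLHS]mul1r ler_pM2r // leNgt => /negP; apply.
  set a := k * (c * vnorm I) in hB *.
  have a0 : 0 <= a by rewrite /a !mulr_ge0 ?vnorm_ge0.
  rewrite (_ : k * _ = a * vnorm (B - A)); last by rewrite /a !mulrA.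
  rewrite (le_lt_trans (ler_wpM2l a0 (ltW hB))) // ltr_pdivrMr ?mul1r ?ltrDl //.
  by rewrite ltr_wpDl.
split=> // e e0; rewrite -/I.
have lin : linear (fun H : 'End(V) => - (I * H * I)).
  by move=> a u v; rewrite mulrDr mulrDl opprD -scaleEr -scaleEl scalerN.
pose a := vnorm I; have a0 : 0 <= a by exact: vnorm_ge0.
pose M := c * (c * a * (c * a)) * (c * (2 * a)) + c * c * a * 2 + 1.
have M0 : 0 < M by rewrite ltr_wpDl ?addr_ge0 ?mulr_ge0.
have nM : vnb A (fun B => vnorm (B - A) < M^-1) by exists M^-1; rewrite ?invr_gt0.
have nMe : vnb A (fun B => vnorm (B - A) < e / M) by exists (e / M); rewrite ?divr_gt0.
have [d d0 hd] := filterI (filterI nM nMe) near_inv; exists d => // B /hd [[hB hBe] B0].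
pose Bi : 'End(V) := B^-1%VF; rewrite lfnE // -/Bi.
have BBi : B * Bi = 1 by exact: lker0_mulV.
have BiB : Bi * B = 1 by exact: lker0_Vmul.
have hBi : vnorm Bi <= 2 * a.
  have -> : Bi = I - Bi * (B - A) * I by nc (BBi, BiB, AI, IA).
  have h1 : vnorm (Bi * (B - A) * I) <= c * (c * vnorm Bi * vnorm (B - A)) * a.
    by rewrite (le_trans (hc _ _)) // ler_wpM2r // ler_wpM2l.
  have h2 : c * (c * vnorm Bi * vnorm (B - A)) * a <= vnorm Bi / 2.
    rewrite (_ : _ * a = (c * c * a * 2 * vnorm (B - A)) * (vnorm Bi / 2)); last by field.
    rewrite -[leRHS]mul1r ler_wpM2r ?divr_ge0 ?vnorm_ge0 //.
    rewrite (le_trans (ler_wpM2l _ (ltW hB))) ?mulr_ge0 // ler_pdivrMr // mul1r.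
    by rewrite /M -addrA [leRHS]addrCA lerDl addr_ge0 ?mulr_ge0.
  have h3 : vnorm Bi <= a + vnorm Bi / 2.
    rewrite {1}(_ : Bi = I - Bi * (B - A) * I); last by nc (BBi, BiB, AI, IA).
    by rewrite (le_trans (vnormD _ _)) // vnormN lerD // (le_trans h1).
  rewrite -(_ : Bi = I - Bi * (B - A) * I); last by nc (BBi, BiB, AI, IA).
  by lra.
have -> : Bi - I - - (I * (B - A) * I) = I * (B - A) * I * (B - A) * Bi.
  by nc (BBi, BiB, AI, IA).
set N := vnorm (B - A) in hB hBe *; have N0 : 0 <= N by exact: vnorm_ge0.
have h1 : vnorm (I * (B - A)) <= c * a * N by exact: hc.
have h2 : vnorm (I * (B - A) * I * (B - A)) <= c * (c * a * N) * (c * a * N).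
  rewrite -[_ * I * _]mulrA (le_trans (hc _ _)) // ler_pM ?mulr_ge0 ?vnorm_ge0 //.
  by rewrite ler_wpM2l.
rewrite (le_trans (hc _ _)) //.
apply: (@le_trans _ _ (c * (c * (c * a * N) * (c * a * N)) * (2 * a))).
  by rewrite ler_pM ?mulr_ge0 ?vnorm_ge0 // ler_wpM2l.
rewrite (_ : _ * (2 * a) = (c * (c * a * (c * a)) * (c * (2 * a))) * N * N); last by ring.
rewrite ler_wpM2r // (@le_trans _ _ (M * N)) //; last by rewrite mulrC -ler_pdivlMr // ltW.
by rewrite ler_wpM2r // /M -addrA lerDl addr_ge0 ?mulr_ge0.
Qed.

(** The class C^r with derivatives valued in spaces of linear maps. On open sets
    it agrees with smoothness through iterated directional derivatives
    ([vsmoothP]), and it is closed under composition. *)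
Fixpoint Sm (r : nat) W F (U : set W) (f : W -> F) : Prop :=
  if r is r'.+1 then
    exists Df : W -> 'Hom(W, F), (forall x, U x -> hasd f x (Df x)) /\ Sm r' U Df
  else forall x, U x -> vcont f x.

Lemma Sm_cont r W F (U : set W) (f : W -> F) x : Sm r U f -> U x -> vcont f x.
Proof. by case: r => [|r] /=; [apply | move=> [D [h _]] /h/hasd_cont]. Qed.

Lemma vcst_cont W F (c : F) (x : W) : vcont (fun=> c) x.
Proof. exact: hasd_cont (hasd_cst c x). Qed.

Lemma SmS r W F (U : set W) (f : W -> F) : Sm r.+1 U f -> Sm r U f.
Proof.
elim: r F f => [|r IH] F f; first by case=> D [h _] x /h/hasd_cont.
by move=> [D [h hD]]; exists D; split=> //; apply: IH.
Qed.

Lemma Sm_sub r W F (U U' : set W) (f : W -> F) : U' `<=` U -> Sm r U f -> Sm r U' f.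
Proof.
move=> UU'; elim: r F f => [|r IH] F f; first by move=> h x /UU'; apply: h.
by move=> [D [h hD]]; exists D; split=> [x /UU'|]; [apply: h | apply: IH].
Qed.

Lemma Sm_ext r W F (U : set W) (f g : W -> F) : vopen U -> (forall x, U x -> f x = g x) ->
  Sm r U f -> Sm r U g.
Proof.
move=> /vopenP Uo fg.
have ng x : U x -> \forall y \near vnb x, f y = g y.
  by move=> /Uo; apply: filterS => y /fg.
case: r => [h x Ux|r [D [h hD]]].
  move=> P; rewrite -(fg _ Ux) => /(h x Ux); have := ng x Ux.
  by apply: filterS2 => y ->.
by exists D; split=> // x Ux; apply: hasd_ext (h _ Ux); exact: ng.
Qed.

Lemma Sm_cst r W F (U : set W) (c : F) : Sm r U (fun=> c).
Proof.
elim: r F c => [|r IH] F c; first by move=> x _; apply: vcst_cont.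
by exists (fun=> 0); split=> [x _|]; [apply: hasd_cst | apply: IH].
Qed.

Lemma Sm_lin r W F (U : set W) (L : 'Hom(W, F)) : Sm r U L.
Proof.
case: r => [|r]; first by move=> x _; apply: hasd_cont (hasd_lin L x).
by exists (fun=> L); split=> [x _|]; [apply: hasd_lin | apply: Sm_cst].
Qed.

Lemma SmD r W F (U : set W) (f g : W -> F) : Sm r U f -> Sm r U g ->
  Sm r U (fun x => f x + g x).
Proof.
elim: r F f g => [|r IH] F f g.
  move=> hf hg x Ux; apply/vcontP => e e0.
  have e2 : 0 < e / 2 by rewrite divr_gt0.
  have := (vcontP _ _).1 (hg _ Ux) _ e2; have := (vcontP _ _).1 (hf _ Ux) _ e2.
  apply: filterS2 => y h1 h2; rewrite [X in vnorm X](_ : _ = (f y - f x) + (g y - g x)); last by abel.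
  by rewrite (le_lt_trans (vnormD _ _)) // [ltRHS](splitr e) ltrD.
move=> [D [h hD]] [D' [h' hD']]; exists (fun x => D x + D' x).
by split=> [x Ux|]; [apply: hasdD; [apply: h|apply: h'] | apply: IH].
Qed.

Lemma Sm_bilin r W F G H (U : set W) (b : F -> H -> G) (f : W -> F) (h : W -> H) :
  bilin b -> Sm r U f -> Sm r U h -> Sm r U (fun x => b (f x) (h x)).
Proof.
elim: r F G H b f h => [|r IH] F G H b f h hb.
  move=> hf hh x Ux; have [C C0 hC] := bilin_bound hb.
  have [hl hr] := hb.
  have bB1 u u' w : b (u - u') w = b u w - b u' w.
    by rewrite -[u - u']addrC -scaleN1r hr scaleN1r addrC.
  have bB2 u w w' : b u (w - w') = b u w - b u w'.
    by rewrite -[w - w']addrC -scaleN1r hl scaleN1r addrC.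
  apply/vcontP => e e0; pose M := C * (vnorm (h x) + vnorm (f x) + 1) + 1.
  have M0 : 0 < M by rewrite ltr_wpDl // mulr_ge0 // !addr_ge0 ?vnorm_ge0.
  have e1 : 0 < Num.min 1 (e / M) by rewrite lt_min ltr01 divr_gt0.
  have := (vcontP _ _).1 (hf _ Ux) _ e1; have := (vcontP _ _).1 (hh _ Ux) _ e1.
  apply: filterS2 => y; rewrite !lt_min => /andP[h1 h2] /andP[h3 h4].
  rewrite [X in vnorm X](_ : _ = b (f y - f x) (h x) + b (f x) (h y - h x)
    + b (f y - f x) (h y - h x)); last by rewrite !(bB1, bB2); abel.
  apply: (@le_lt_trans _ _ (C * (e / M) * vnorm (h x) + C * vnorm (f x) * (e / M) + C * (e / M) * 1)).
    rewrite (le_trans (vnormD _ _)) // lerD ?(le_trans (vnormD _ _)) ?lerD //.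
    - by rewrite (le_trans (hC _ _)) // ler_wpM2r ?vnorm_ge0 // ler_wpM2l // ltW.
    - by rewrite (le_trans (hC _ _)) // ler_wpM2l ?mulr_ge0 ?vnorm_ge0 // ltW.
    - by rewrite (le_trans (hC _ _)) // ler_pM ?mulr_ge0 ?vnorm_ge0 ?ler_wpM2l // ltW.
  rewrite (_ : _ + _ = (M - 1) / M * e); last by rewrite /M; ring.
  by rewrite gtr_pMl // ltr_pdivrMr // mul1r gtrDl oppr_lt0.
move=> Sf Sh; have := SmS Sf; have := SmS Sh; move: Sf Sh.
move=> [D [hf hD]] [D' [hh hD']] Sh Sf.
exists (fun x => precomp (b^~ (h x)) (D x) + precomp (b (f x)) (D' x)).
split=> [x Ux|]; first by apply: hasd_bilin; [|apply: hf|apply: hh].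
apply: SmD; first by apply: (IH _ _ _ _ D h (bilin_l W hb)).
exact: (IH _ _ _ _ f D' (bilin_r W hb)).
Qed.

Lemma Sm_linl r W F G (U : set W) (f : W -> F) (L : 'Hom(F, G)) : Sm r U f ->
  Sm r U (fun x => L (f x)).
Proof.
by move=> h; apply: (Sm_bilin (app_bilin F G) _ h); apply: Sm_cst.
Qed.

Lemma SmN r W F (U : set W) (f : W -> F) : Sm r U f -> Sm r U (fun x => - f x).
Proof.
move=> h; have := Sm_linl (- \1%VF : 'Hom(F, F)) h.
by congr Sm; apply/funext => x; rewrite opp_lfunE id_lfunE.
Qed.

Lemma SmB r W F (U : set W) (f g : W -> F) : Sm r U f -> Sm r U g ->
  Sm r U (fun x => f x - g x).
Proof. by move=> hf hg; apply: SmD => //; apply: SmN. Qed.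

Lemma comp_bilin W F G : bilin (fun (X : 'Hom(F, G)) (Y : 'Hom(W, F)) => (X \o Y)%VF).
Proof.
by split=> [X|Y] a u v; apply/lfunP => z; rewrite !lfun_simp ?linearP //.
Qed.

Lemma Sm_comp r W F G (U : set W) (U' : set F) (f : W -> F) (g : F -> G) :
  (forall x, U x -> U' (f x)) -> Sm r U f -> Sm r U' g -> Sm r U (g \o f).
Proof.
move=> UU'; elim: r G g => [|r IH] G g.
  by move=> hf hg x Ux P /(hg _ (UU' _ Ux)) /(hf _ Ux).
move=> Sf; have := SmS Sf; move: Sf => [D [hf hD]] Sf [D' [hg hD']].
exists (fun x => (D' (f x) \o D x)%VF); split.
  by move=> x Ux; apply: hasd_comp; [apply: hf | apply/hg/UU'].
by apply: (Sm_bilin (comp_bilin W F G)) => //; apply: IH.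
Qed.

Lemma Sm_mul r W (V : vectType R) (U : set W) (f g : W -> 'End(V)) :
  Sm r U f -> Sm r U g -> Sm r U (fun x => f x * g x).
Proof. exact: (Sm_bilin (mul_bilin V)). Qed.

Lemma Sm_inv r W (V : vectType R) (U : set W) (f : W -> 'End(V)) :
  (forall x, U x -> lker (f x) == 0%VS) -> Sm r U f -> Sm r U (fun x => (f x)^-1%VF).
Proof.
move=> f0; elim: r => [|r IH].
  move=> hf x Ux; have [_ /hasd_cont h] := hasd_inv (f0 _ Ux).
  by move=> P /h /(hf _ Ux).
move=> Sf; have := IH (SmS Sf); move: Sf => [D [hf hD]] Si.
pose b1 (X : 'End(V)) (E : 'Hom(W, 'End(V))) := precomp (fun Y : 'End(V) => X * Y) E.
pose b2 (X : 'End(V)) (E : 'Hom(W, 'End(V))) := precomp (fun Y : 'End(V) => Y * X) E.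
have hb1 : bilin b1 by exact: (bilin_r W (mul_bilin V)).
have hb2 : bilin b2.
  have [hl hr] := bilin_l W (mul_bilin V); by split=> [u|w] a y z; [apply: hr|apply: hl].
exists (fun x => - b2 (f x)^-1%VF (b1 (f x)^-1%VF (D x))); split.
  move=> x Ux; have [_ h] := hasd_inv (f0 _ Ux).
  have := hasd_comp (hf _ Ux) h; congr hasd; apply/lfunP => v.
  have [hl hr] := mul_bilin V.
  rewrite comp_lfunE opp_lfunE /b1 /b2 !precompE // lfnE //.
  by move=> a u w; rewrite mulrDr mulrDl opprD -scaleEr -scaleEl scalerN.
apply: SmN; apply: (Sm_bilin hb2) => //.
by apply: (Sm_bilin hb1).
Qed.

Lemma Sm_sum W F r (U : set W) (I : Type) (s : seq I) (h : I -> W -> F) :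
  (forall i, Sm r U (h i)) -> Sm r U (fun x => \sum_(i <- s) h i x).
Proof.
move=> hh; elim: s => [|i s IH].
  by rewrite (_ : (fun x => _) = fun=> 0); [exact: Sm_cst | apply/funext => x; rewrite big_nil].
rewrite (_ : (fun x => _) = fun x => h i x + \sum_(i <- s) h i x); first exact: SmD.
by apply/funext => x; rewrite big_cons.
Qed.

(** A linear map depends linearly on its values at a basis. *)
Lemma Sm_hom W F G r (U : set W) (B : W -> 'Hom(F, G)) :
  (forall v, Sm r U (fun x => B x v)) -> Sm r U B.
Proof.
move=> h; pose t i (y : G) : 'Hom(F, G) := linfun (fun w => vc w i *: y).
have tl i y : linear (fun w : F => vc w i *: y).
  by move=> k u v; rewrite /vc linearP !mxE scalerDl scalerA.
have tE i y w : t i y w = vc w i *: y by rewrite /t lfnE.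
pose T i : 'Hom(G, 'Hom(F, G)) := linfun (t i).
have TE i y : T i y = t i y.
  rewrite /T lfnE // => k u v; apply/lfunP => w.
  by rewrite add_lfunE scale_lfunE !tE scalerDr !scalerA mulrC.
rewrite (_ : B = fun x => \sum_i T i (B x (vb i))).
  by apply: Sm_sum => i; exact: Sm_linl.
apply/funext => x; apply/lfunP => w; rewrite {1}[w]vc_sum linear_sum sum_lfunE.
by apply: eq_bigr => i _; rewrite TE tE linearZ.
Qed.

End Smoothness.

Section Bridge.
Context {R : realType}.
Implicit Types W F G H : vectType R.

Definition hat W F (f : W -> F) := v2r \o f \o r2v.

Lemma rv_ext m k (f g : 'rV[R]_m -> 'rV[R]_k) (x v : 'rV[R]_m) :
  (\forall y \near nbhs x, f y = g y) ->
  (derivable f x v -> derivable g x v) /\ 'D_v f x = 'D_v g x.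
Proof.
move=> fg; by split; [exact: near_eq_derivable | exact: near_eq_derive].
Qed.

Lemma is_Ck_ext m k r (U : set 'rV[R]_m) (f g : 'rV[R]_m -> 'rV[R]_k) : open U ->
  (forall x, U x -> f x = g x) -> is_Ck r U f -> is_Ck r U g.
Proof.
move=> Uo; elim: r f g => [|r IH] f g fg.
  move=> [hf _]; split=> // x Ux.
  have nfg : \forall y \near nbhs x, f y = g y.
    by apply: filterS (open_nbhs_nbhs (conj Uo Ux)) => y /fg.
  move=> P; rewrite /= -(fg _ Ux) => /(hf _ Ux) h; have : nbhs x (f @^-1` P) := h.
  have := nfg; rewrite -nbhs_nearE; by apply: filterS2 => y /= ->.
move=> [hf hD].
have nfg x : U x -> \forall y \near nbhs x, f y = g y.
  by move=> Ux; apply: filterS (open_nbhs_nbhs (conj Uo Ux)) => y /fg.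
split=> [x Ux|v].
  move=> P; rewrite /= -(fg _ Ux) => /(hf _ Ux) h; have : nbhs x (f @^-1` P) := h.
  have := nfg _ Ux; rewrite -nbhs_nearE; by apply: filterS2 => y /= ->.
have [hd hC] := hD v; split=> [x Ux|].
  by have [+ _] := rv_ext v (nfg _ Ux); apply; apply: hd.
by apply: IH hC => x Ux; have [] := rv_ext v (nfg _ Ux).
Qed.

Lemma hasd_derive W F (f : W -> F) x D (v : W) : hasd f x D ->
  derivable (hat f) (v2r x) (v2r v) /\ vderive f x v = D v.
Proof.
move=> h.
have hc : ((fun t => t^-1 *: ((hat f \o shift (v2r x)) (t *: v2r v) - hat f (v2r x))) @ 0^')
    --> v2r (D v).
  apply/cvgrPdist_le => /= e e0.
  have M0 : 0 < vnorm v + 1 by rewrite ltr_wpDl ?vnorm_ge0.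
  have [d d0 hd] := h (e / (vnorm v + 1)) (divr_gt0 e0 M0).
  near=> t.
  have t0 : t != 0 by near: t; exact: nbhs_dnbhs_neq.
  have td : `|t| < d / (vnorm v + 1) by near: t; apply: dnbhs0_lt; rewrite divr_gt0.
  rewrite /hat /= -linearZ -linearD !v2rK -linearB -linearZ -linearB -/(vnorm _).
  have -> : D v - t^-1 *: (f (t *: v + x) - f x)
    = - (t^-1 *: (f (t *: v + x) - f x - D (t *: v + x - x))).
    by rewrite addrK [D (t *: v)]linearZ /= [in RHS]scalerBr scalerA mulVf // scale1r opprB.
  rewrite vnormN vnormZ normfV ler_pdivrMl ?normr_gt0 //.
  apply: le_trans (hd _ _) _; rewrite addrK vnormZ.
    rewrite (le_lt_trans (_ : _ <= `|t| * (vnorm v + 1))) //.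
      by rewrite ler_wpM2l // lerDl.
    by rewrite -ltr_pdivlMr.
  rewrite mulrCA ler_wpM2l // mulrAC ler_pdivrMr // ler_wpM2l ?lerDl //; exact: ltW.
split; first by apply/cvg_ex; exists (v2r (D v)).
by rewrite /vderive (_ : 'D_(v2r v) _ _ = v2r (D v)) ?v2rK //; apply: cvg_lim.
Unshelve. all: by end_near. Qed.

Lemma hasd_unique W F (f : W -> F) x D D' : hasd f x D -> hasd f x D' -> D = D'.
Proof.
move=> h h'; apply/lfunP => v.
by have [_ <-] := hasd_derive v h; have [_ <-] := hasd_derive v h'.
Qed.

Lemma cont_hat W F (f : W -> F) (x : 'rV[R]_(dim W)) :
  vcont f (r2v x) -> {for x, continuous (hat f)}.
Proof.
have [h _] := vcont_continuous f (r2v x) => /h {h}.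
have -> : v2r (r2v x : W) = x by exact: r2vK.
by [].
Qed.

Lemma Sm_is_Ck W F r (U : set W) (f : W -> F) : vopen U -> Sm r U f ->
  is_Ck r (r2v @^-1` U) (hat f).
Proof.
move=> Uo; elim: r f => [|r IH] f Sf.
  by split; [move=> x Ux; apply: cont_hat; exact: Sf | exact: I].
split=> [x Ux|v].
  by apply: cont_hat; exact: Sm_cont Sf Ux.
move: Sf => [D [h hD]]; split=> [x /= Ux|].
  have [+ _] := hasd_derive (r2v v) (h _ Ux).
  by rewrite [v2r (r2v v)]r2vK [v2r (r2v x)]r2vK.
have := IH (fun x => D x (r2v v)); have ev : linear (fun (X : 'Hom(W, F)) => X (r2v v)).
  by move=> a u w; rewrite add_lfunE scale_lfunE.
have := Sm_linl (linfun (fun X : 'Hom(W, F) => X (r2v v))) hD.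
under eq_fun do rewrite lfnE //; move=> S /(_ S).
apply: is_Ck_ext => // x /= Ux; have [_] := hasd_derive (r2v v) (h _ Ux).
by rewrite /vderive !r2vK /hat /= => <-; rewrite r2vK.
Qed.

(** Vector-valued mean value inequality, one coordinate at a time. *)
Lemma mvt_dir m k (psi : 'rV[R]_m -> 'rV[R]_k) (y v : 'rV[R]_m) (c : 'rV[R]_k)
    (a M : R) : 0 <= M ->
  (forall t, `|t| <= `|a| -> derivable psi (t *: v + y) v /\
     `|'D_v psi (t *: v + y) - c| <= M) ->
  `|psi (a *: v + y) - psi y - a *: c| <= `|a| * M.
Proof.
move=> M0 h; apply/rowP_le; first by rewrite mulr_ge0.
move=> j.
pose f (t : R) : R := psi (t *: v + y) 0 j.
pose df t : R := 'D_v psi (t *: v + y) 0 j.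
have fd (t : R) : `|t| <= `|a| -> is_derive t (1 : R) f (df t).
  move=> /h[hd _].
  have := (derivable_mxP psi (t *: v + y) v).1 hd 0 j.
  have dE : df t = 'D_v (fun z => psi z 0 j) (t *: v + y) by rewrite /df derive_mx // mxE.
  have gE : (fun s : R => s^-1 *: (((fun z => psi z 0 j) \o shift (t *: v + y)) (s *: v)
      - psi (t *: v + y) 0 j)) = (fun s : R => s^-1 *: ((f \o shift t) (s *: 1) - f t)).
    by apply/funext => s; rewrite /f /= addrA -scalerDl -[s *: 1]/(s * 1) mulr1.
  rewrite /derivable gE => hc; split; first exact: hc.
  by rewrite dE /derive gE.
have gd (t : R) : t \in `[0, 1]%R -> is_derive t (1 : R) (fun t : R => f (a * t)) (a * df (a * t)).
  rewrite in_itv /= => /andP[t0 t1].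
  have ht : `|a * t| <= `|a| by rewrite normrM (ger0_norm t0) ler_piMr.
  have := fd _ ht => hf.
  have hs : is_derive t (1 : R) ( *%R a) a.
    by apply: is_derive_eq; rewrite [LHS]mulr1.
  have := @is_derive1_comp R f ( *%R a) t _ _ hf hs.
  by rewrite mulrC.
have hc : {within `[0 : R, 1], continuous (fun t : R => f (a * t))}.
  by apply: derivable_within_continuous => t /gd[].
have ho (t : R) : t \in `]0, 1[%R -> is_derive t (1 : R) (fun t : R => f (a * t)) (a * df (a * t)).
  by rewrite in_itv /= => /andP[t0 t1]; apply: gd; rewrite in_itv /= !ltW.
have [z] := MVT_segment (@ler01 R) ho hc.
rewrite in_itv /= => /andP[z0 z1]; rewrite subr0 mulr1 mulr0 mulr1 /f scale0r add0r => E.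
have ht : `|a * z| <= `|a| by rewrite normrM (ger0_norm z0) ler_piMr.
have [_ hz] := h _ ht; rewrite !mxE E -mulrBr normrM ler_wpM2l //.
by have := le_trans (row_le_norm _ j) hz; rewrite !mxE.
Qed.

(** Continuous directional derivatives give a Frechet derivative: y is reached
    from x by changing one coordinate at a time. *)
Lemma C1_row m k (O : set 'rV[R]_m) (phi : 'rV[R]_m -> 'rV[R]_k) (x : 'rV[R]_m) :
  open O -> is_Ck 1 O phi -> O x -> forall e : R, 0 < e ->
  exists2 d : R, 0 < d & forall y, `|y - x| < d ->
    `|phi y - phi x - \sum_i (y - x) 0 i *: 'D_('e_i) phi x| <= e * `|y - x|.
Proof.
move=> Oo [_ hC] Ox e e0; pose e' : R := e / m.+1%:R.
have e'0 : 0 < e' by rewrite divr_gt0.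
have hi : forall i : 'I_m, \forall y \near nbhs x, `|'D_('e_i) phi y - 'D_('e_i) phi x| <= e'.
  move=> i; have [_ [hc _]] := hC 'e_i.
  have /cvgrPdist_le/(_ _ e'0) := hc _ Ox; apply: filterS => y; by rewrite distrC.
have hO := open_nbhs_nbhs (conj Oo Ox).
have hF : \forall y \near nbhs x, forall i : 'I_m, `|'D_('e_i) phi y - 'D_('e_i) phi x| <= e'.
  exact: filter_forall.
have [d d0 hd] := (nbhs_rowP x (O `&` [set y | forall i : 'I_m,
   `|'D_('e_i) phi y - 'D_('e_i) phi x| <= e'])).1 (filterI hO hF).
exists d => // y yx.
pose p (n : nat) : 'rV[R]_m := \row_j (if (j < n)%N then y 0 j else x 0 j).
have p0 : p 0%N = x by apply/rowP => j; rewrite mxE.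
have pm : p m = y by apply/rowP => j; rewrite mxE ltn_ord.
rewrite -{1}pm -{1}p0 -(telescope_sumr (fun i => phi (p i)) (leq0n m)) big_mkord -sumrB.
apply: le_trans (ler_norm_sum _ _ _) _.
have -> : e * `|y - x| = \sum_(i < m.+1) (`|y - x| * e').
  by rewrite sumr_const card_ord -mulr_natr /e' mulrA divfK ?pnatr_eq0 // mulrC.
rewrite big_ord_recr /= -[leLHS]addr0 lerD ?mulr_ge0 ?(ltW e'0) //.
apply: ler_sum => i _.
have -> : phi (p i.+1) = phi ((y - x) 0 i *: 'e_i + p i).
  congr phi; apply/rowP => j; rewrite !mxE /= ltnS leq_eqVlt.
  case: (eqVneq j i) => [->|ji]; first by rewrite ltnn eqxx /= mulr1 subrK.
  by rewrite (negPf (ji : j != i :> nat)) /= mulr0 add0r.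
have yxi : `|(y - x) 0 i| <= `|y - x| by exact: row_le_norm.
apply: le_trans (ler_wpM2r (ltW e'0) yxi).
apply: mvt_dir => [|t ht]; first exact: ltW.
have near_x : `|t *: 'e_i + p i - x| < d.
  apply: le_lt_trans yx; apply/rowP_le => // j; rewrite !mxE.
  case: (eqVneq j i) => [->|ji].
    by rewrite ltnn eqxx mulr1 addrK (le_trans ht).
  rewrite mulr0 add0r; case: ifP => _; last by rewrite subrr normr0.
  by have := row_le_norm (y - x) j; rewrite !mxE.
have [Oy /(_ i) hy] := hd _ near_x; split=> //.
by have [hder _] := hC 'e_i; apply: hder.
exact: ltW.
Qed.

Lemma C1_hasd W F (U : set W) (f : W -> F) x : vopen U ->
  is_Ck 1 (r2v @^-1` U) (hat f) -> U x ->
  hasd f x (linfun (fun w => \sum_i vc w i *: vderive f x (vb i))).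
Proof.
move=> Uo hC Ux e e0; have Ux' : (r2v @^-1` U) (v2r x) by rewrite /= v2rK.
have [d d0 hd] := C1_row Uo hC Ux' e0; exists d => // y yx.
have hl : linear (fun w : W => \sum_i vc w i *: vderive f x (vb i)).
  move=> a u v; rewrite scaler_sumr -big_split /=; apply: eq_bigr => i _.
  by rewrite /vc linearP !mxE scalerDl scalerA.
have yx' : `|v2r y - v2r x| < d by rewrite -linearB.
rewrite lfnE //; have := hd (v2r y) yx'; rewrite -[X in e * `|X|]linearB.
congr (_ <= _); rewrite /vnorm; congr (`|_|).
rewrite /hat /= !v2rK [in RHS]linearB /= [X in _ = X - _]linearB [in RHS]linear_sum /=; congr (_ - _).
apply: eq_bigr => i _; rewrite linearZ /= /vderive /vc [in RHS]linearB !mxE /vb.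
by rewrite [v2r (r2v _)]r2vK [v2r (r2v _)]r2vK.
Qed.

Lemma is_CkS m k r (O : set 'rV[R]_m) (phi : 'rV[R]_m -> 'rV[R]_k) :
  is_Ck r.+1 O phi -> is_Ck r O phi.
Proof.
elim: r phi => [|r IH] phi; first by case.
by move=> [hc hD]; split=> // v; have [hd hC] := hD v; split=> //; apply: IH.
Qed.

Lemma is_Ck1 m k r (O : set 'rV[R]_m) (phi : 'rV[R]_m -> 'rV[R]_k) :
  is_Ck r.+1 O phi -> is_Ck 1 O phi.
Proof. by elim: r => // r IH /is_CkS. Qed.

(** One order of differentiability is spent on passing from continuous partial
    derivatives to a Frechet derivative. *)
Lemma is_Ck_Sm W F r (U : set W) (f : W -> F) : vopen U ->
  is_Ck r.+1 (r2v @^-1` U) (hat f) -> Sm r U f.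
Proof.
move=> Uo; elim: r f => [|r IH] f hC.
  by move=> x Ux; apply: hasd_cont (C1_hasd Uo hC Ux).
exists (fun x => linfun (fun w => \sum_i vc w i *: vderive f x (vb i))); split.
  by move=> x Ux; apply: C1_hasd (is_Ck1 hC) Ux.
have hS (i : 'I_(dim W)) : Sm r U (fun x => vderive f x (vb i)).
  apply: IH.
  have hh : is_Ck r.+1 (r2v @^-1` U) (fun y => 'D_(v2r (vb i)) (hat f) y) := (hC.2 (v2r (vb i))).2.
  apply: is_Ck_ext hh => // y Uy; rewrite /hat /= /vderive.
  by rewrite [v2r (r2v y)]r2vK !r2vK.
have hl x : linear (fun w : W => \sum_i vc w i *: vderive f x (vb i)).
  move=> a u v; rewrite scaler_sumr -big_split /=; apply: eq_bigr => i _.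
  by rewrite /vc linearP !mxE scalerDl scalerA.
apply: Sm_hom => v; under eq_fun do rewrite lfnE //.
apply: Sm_sum => i; have := Sm_linl (vc v i *: \1 : 'End(F))%VF (hS i).
by under eq_fun do rewrite scale_lfunE id_lfunE.
Qed.

Lemma vsmoothP W F (U : set W) (f : W -> F) : vopen U ->
  vsmooth U f <-> forall r, Sm r U f.
Proof.
by move=> Uo; split=> h r; [apply: is_Ck_Sm | apply: Sm_is_Ck].
Qed.

Definition dif W F (f : W -> F) (x : W) : 'Hom(W, F) := linfun (vderive f x).

Lemma hasd_dif W F (f : W -> F) x D : hasd f x D -> dif f x = D.
Proof.
move=> h; rewrite /dif (_ : vderive f x = D) ?fun_of_lfunK //.
by apply/funext => v; have [] := hasd_derive v h.
Qed.

Lemma hasd_vderive W F (f : W -> F) x D : hasd f x D -> vderive f x = D.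
Proof. by move=> h; apply/funext => v; have [] := hasd_derive v h. Qed.

Lemma Sm_hasd W F r (U : set W) (f : W -> F) x : Sm r.+1 U f -> U x -> hasd f x (dif f x).
Proof. by move=> [D [h _]] Ux; rewrite (hasd_dif (h _ Ux)); apply: h. Qed.

Lemma Sm_dif W F r (U : set W) (f : W -> F) : vopen U -> Sm r.+1 U f -> Sm r U (dif f).
Proof.
move=> Uo [D [h hD]]; apply: Sm_ext hD => // x Ux.
by rewrite (hasd_dif (h _ Ux)).
Qed.

(** The norm is a maximum of coordinates, so the scalar mean value theorem along
    the segment applies to each of them. *)
Lemma mvt_ineq W F (f : W -> F) (x v : W) (M : R) : 0 <= M ->
  (forall t : R, 0 <= t <= 1 -> exists2 D, hasd f (t *: v + x) D & vnorm (D v) <= M) ->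
  vnorm (f (v + x) - f x) <= M.
Proof.
move=> M0 h; rewrite /vnorm linearB; apply/rowP_le => // j; rewrite !mxE.
pose g (t : R) : R := vc (f (t *: v + x)) j.
have /choice[dg hdg] : forall t : R, exists d : R, 0 <= t <= 1 ->
    is_derive t (1 : R) g d /\ `|d| <= M.
  move=> t; have [t01|] := boolP (0 <= t <= 1); last by exists 0.
  have [D hD hM] := h t t01; exists (vc (D v) j) => _; split; last first.
    exact: le_trans (vc_le _ _) hM.
  have [hd hv] := hasd_derive v hD.
  have := (derivable_mxP (hat f) _ _).1 hd 0 j.
  have dE : vc (D v) j = 'D_(v2r v) (fun z => hat f z 0 j) (v2r (t *: v + x)).
    by rewrite -hv /vc /vderive r2vK derive_mx // mxE.
  have gE : (fun s : R => s^-1 *: (((fun z => hat f z 0 j) \o shift (v2r (t *: v + x))) (s *: v2r v)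
      - hat f (v2r (t *: v + x)) 0 j)) = (fun s : R => s^-1 *: ((g \o shift t) (s *: 1) - g t)).
    apply/funext => s; rewrite /g /hat /= -linearZ -linearD !v2rK.
    by rewrite addrA -scalerDl -[s *: 1]/(s * 1) mulr1.
  rewrite /derivable gE => hc; split; first exact: hc.
  by rewrite dE /derive gE.
have hc : {within `[0 : R, 1], continuous g}.
  apply: derivable_within_continuous => t; rewrite in_itv /= => t01.
  by have [[]] := hdg t t01.
have ho (t : R) : t \in `]0, 1[%R -> is_derive t (1 : R) g (dg t).
  rewrite in_itv /= => /andP[t0 t1]; have t01 : 0 <= t <= 1 by rewrite !ltW.
  by have [] := hdg t t01.
have [z] := MVT_segment (@ler01 R) ho hc.
rewrite in_itv /= => z01; rewrite subr0 mulr1 /g scale0r add0r scale1r => E.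
by have [_] := hdg z z01; rewrite -E.
Qed.

End Bridge.

(** * Adjoints and the anchor *)
Lemma compE (R : realType) (V : vectType R) (A B : 'End(V)) : (A \o B)%VF = A * B.
Proof. by []. Qed.

Section DotProduct.
Context {R : realType} {V : vectType R} (g : {dot V for @idfun R}).
Implicit Types (x y z : V) (A B : 'End(V)).

Lemma gC x y : g x y = g y x.
Proof. by rewrite (hermC g) expr0 mul1r. Qed.
Lemma gDr x y z : g x (y + z) = g x y + g x z. Proof. exact: linearD. Qed.
Lemma gNr x y : g x (- y) = - g x y. Proof. exact: linearN. Qed.
Lemma gBr x y z : g x (y - z) = g x y - g x z. Proof. exact: linearB. Qed.
Lemma gZr x a y : g x (a *: y) = a * g x y. Proof. exact: linearZ. Qed.
Lemma g0r x : g x 0 = 0. Proof. exact: linear0. Qed.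
Lemma gDl x y z : g (x + y) z = g x z + g y z. Proof. by rewrite gC gDr !(gC z). Qed.
Lemma gNl x y : g (- x) y = - g x y. Proof. by rewrite gC gNr gC. Qed.
Lemma gZl x a y : g (a *: x) y = a * g x y. Proof. by rewrite gC gZr gC. Qed.
Lemma g0l y : g 0 y = 0. Proof. by rewrite gC g0r. Qed.

Lemma g_eq0 x : g x x = 0 -> x = 0.
Proof.
by move=> h; apply/eqP; apply/negPn/negP => /(neq0_dnorm_gt0 (s := g)); rewrite h ltxx.
Qed.

Lemma g_ext x y : (forall z, g z x = g z y) -> x = y.
Proof. by move=> h; apply/eqP; rewrite -subr_eq0; apply/eqP/g_eq0; rewrite gBr h subrr. Qed.

Lemma g_riesz (phi : V -> R^o) : linear phi -> exists y, forall x, phi x = g x y.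
Proof.
move=> hphi; pose l y : 'Hom(V, R^o) := linfun (fun x => g x y : R^o).
have hl1 y : linear (fun x => g x y : R^o) by move=> a u v; rewrite gDl gZl.
have hl : linear l.
  by move=> a u v; apply/lfunP => x; rewrite add_lfunE scale_lfunE !lfnE // gDr gZr.
have l0 : lker (linfun l) == 0%VS.
  apply/lker0P => u v; rewrite !lfnE // => /lfunP E; apply: g_ext => z.
  by have := E z; rewrite !lfnE.
have : limg (linfun l) = fullv.
  apply/eqP; rewrite eqEdim subvf /= limg_dim_eq; last by rewrite (eqP l0) capv0.
  by rewrite !dimvf /dim /= muln1.
move=> E; have : linfun phi \in limg (linfun l) by rewrite E memvf.
case/memv_imgP => y _ e; exists y => x.
by rewrite -(lfnE hphi) e (lfnE hl) lfnE.
Qed.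

Definition adj A : 'End(V) := adjoint g A.

Lemma adj_key A : exists B : 'End(V), forall x y, g (A x) y = g x (B y).
Proof.
have /choice[b hb] : forall y, exists z, forall x, g (A x) y = g x z.
  by move=> y; apply: g_riesz => a u v; rewrite linearP gDl gZl.
have bl : linear b.
  by move=> a u v; apply: g_ext => z; rewrite -hb !gDr !gZr -!hb.
by exists (linfun b) => x y; rewrite lfnE.
Qed.

Lemma adjP A x y : g (A x) y = g x (adj A y).
Proof.
rewrite /adj /adjoint; case: xgetP => [B _ hB|h]; first exact: hB.
by have [B hB] := adj_key A; have := h B.
Qed.

Lemma adj_eq A B : (forall x y, g (A x) y = g x (B y)) -> adj A = B.
Proof. by move=> h; apply/lfunP => y; apply: g_ext => z; rewrite -adjP h. Qed.

Lemma adjP' A x y : g x (A y) = g (adj A x) y.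
Proof. by rewrite gC adjP gC. Qed.
Lemma adjK A : adj (adj A) = A.
Proof. by apply: adj_eq => x y; rewrite -adjP'. Qed.
Lemma adjM A B : adj (A * B) = adj B * adj A.
Proof. by apply: adj_eq => x y; rewrite !mulEE !adjP. Qed.
Lemma adjD A B : adj (A + B) = adj A + adj B.
Proof. by apply: adj_eq => x y; rewrite !add_lfunE gDl gDr !adjP. Qed.
Lemma adjN A : adj (- A) = - adj A.
Proof. by apply: adj_eq => x y; rewrite !opp_lfunE gNl gNr !adjP. Qed.
Lemma adjZ a A : adj (a *: A) = a *: adj A.
Proof. by apply: adj_eq => x y; rewrite !scale_lfunE gZl gZr !adjP. Qed.
Lemma adj_1 : adj 1 = 1.
Proof. by apply: adj_eq => x y; rewrite !oneEE. Qed.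
Lemma adj_0 : adj 0 = 0.
Proof. by apply: adj_eq => x y; rewrite !zero_lfunE g0l g0r. Qed.
Lemma adj_linear : linear adj.
Proof. by move=> a u v; rewrite adjD adjZ. Qed.
Lemma adj_inv A B : A * B = 1 -> adj B * adj A = 1.
Proof. by move=> h; rewrite -adjM h adj_1. Qed.

Lemma skewP A : orthogonal_lie_algebra g A <-> adj A = - A.
Proof.
split=> [h|h x y]; first by apply: adj_eq => x y; rewrite opp_lfunE gNr h.
by rewrite adjP h opp_lfunE gNr.
Qed.

Lemma skew0 A x : adj A = - A -> g (A x) x = 0.
Proof.
move=> h; apply/eqP; rewrite -[_ == 0](mulrn_eq0 _ 2) mulr2n {1}adjP h opp_lfunE gNr gC.
by rewrite addNr.
Qed.

Lemma twistorP K : twistor g K <-> K * K = -1 /\ adj K = - K.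
Proof.
split=> [[kk h]|[kk h]].
  split; first exact: kk.
  apply: adj_eq => x y; rewrite -h -mulEE.
  have -> : K * K = -1 by exact: kk.
  by rewrite !opp_lfunE oneEE gNl gNr.
by split=> // x y; rewrite adjP h opp_lfunE -mulEE kk opp_lfunE oneEE opprK.
Qed.

Lemma tangentP K A : twistor_tangent g K A <-> adj A = - A /\ A * K = - (K * A).
Proof.
rewrite /twistor_tangent /=; split=> -[/skewP h e]; split => //.
  by apply/eqP; rewrite -addr_eq0; apply/eqP.
by rewrite -[LHS]/(A * K + K * A) e addNr.
Qed.

(** If A x = - x then g x x = - g (A x) x = 0 by skewness. *)
Lemma skew_inv A : adj A = - A -> lker (1 + A) == 0%VS.
Proof.
move=> h; rewrite -subv0; apply/subvP => x; rewrite memv_ker memv0 add_lfunE oneEE => /eqP e.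
have : g (x + A x) x = 0 by rewrite e g0l.
by rewrite gDl (skew0 _ h) addr0 => /g_eq0->.
Qed.

(** The anchor in terms of P = AJ + JA, the part of 2AJ commuting with J
    ([sigmaE]); [sigma_xi] shows that every P commuting with J arises. *)
Definition xi (J P L : 'End(V)) : 'End(V) := (J - L) * adj P * (J + L) - (J + L) * P * (J - L).

Section Pair.
Variables (J L : 'End(V)).
Hypotheses (JJ : J * J = -1) (Ja : adj J = - J) (LL : L * L = -1) (La : adj L = - L).
Let S := J + L.
Let T := J - L.

Lemma sigmaE a : sigma g J L a = xi J (a * J + J * a) L.
Proof.
rewrite /sigma /commutator /xi -/(adj a) adjD !adjM Ja.
rewrite !compE.
nc (JJ, LL).
Qed.

Lemma xi_tangent P : adj (xi J P L) = - xi J P L.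
Proof. by rewrite /xi !(adjD, adjM, adjN, adjK, Ja, La); nc. Qed.

Lemma xi_anti P : P * J = J * P -> xi J P L * L = - (L * xi J P L).
Proof.
move=> h; have h' : adj P * J = J * adj P.
  by have := congr1 adj h; rewrite !adjM Ja mulNr mulrN => /oppr_inj.
by rewrite /xi; nc (JJ, LL, h, h').
Qed.

Lemma sigma_xi P : P * J = J * P -> xi J P L = sigma g J L (- 2^-1 *: (P * J)).
Proof.
move=> h; rewrite sigmaE -scaleEl -scaleEr -scalerDr; congr xi.
have -> : P * J * J + J * (P * J) = P *- 2 by nc (JJ, h).
by rewrite scalerN scaleNr opprK -[P *+ 2]scaler_nat scalerA mulVf ?scale1r ?pnatr_eq0.
Qed.

Lemma ac_comm a : (a * J + J * a) * J = J * (a * J + J * a).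
Proof. by nc (JJ). Qed.
End Pair.

End DotProduct.

(** * The action of the complex linear group *)
Section KernelDim.
Context {R : realType} {V : vectType R}.
Implicit Types A B Q : 'End(V).

Lemma lker0_right Q Qi : Q * Qi = 1 -> lker Q == 0%VS.
Proof.
move=> h; have Qi0 := lker0_mul h; apply/lker0P => x y.
have vE z : z = Qi ((Qi^-1)%VF z) by rewrite -mulEE lker0_mulV ?oneEE.
rewrite {1}(vE x) {1}(vE y) -![Q (Qi _)]mulEE h !oneEE => e.
by rewrite (vE x) (vE y) e.
Qed.

Lemma lker_dim A B Q : lker Q == 0%VS -> (forall x, A x = 0 <-> B (Q x) = 0) ->
  \dim (lker A) = \dim (lker B).
Proof.
move=> Q0 h; rewrite -(@limg_dim_eq _ _ _ Q (lker A)) ?(eqP Q0) ?capv0 //.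
congr (\dim _); apply/eqP; rewrite eqEsubv; apply/andP; split; apply/subvP => y.
  by case/memv_imgP => x; rewrite !memv_ker => /eqP/h hx ->; apply/eqP.
rewrite memv_ker => /eqP hy; apply/memv_imgP; exists (Q^-1%VF y); last first.
  by rewrite lker0_lfunVK.
by rewrite memv_ker; apply/eqP/h; rewrite lker0_lfunVK.
Qed.
End KernelDim.

Section Action.
Context {R : realType} {V : vectType R} (g : {dot V for @idfun R}) (J : 'End(V)).
Hypotheses (JJ : J * J = -1) (Ja : adj g J = - J).
Local Notation adj := (adj g).

(** Elements of [GLJ] act on the twistor space; the orbits turn out to be the
    strata. With S = J + L, T = J - L and b the inverse of the adjoint of a, the
    action moves S and T to multiples of aSW and bTW for a common invertible W;
    solving for the new point gives [act] as a fractional linear map. *)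
Definition GLJ (a : 'End(V)) := lker a == 0%VS /\ a * J = J * a.
Definition actn (a L : 'End(V)) := a * (J + L) - adj (a^-1)%VF * (J - L).
Definition actd (a L : 'End(V)) := a * (J + L) + adj (a^-1)%VF * (J - L).
Definition act (a L : 'End(V)) := actn a L * (actd a L)^-1%VF * J.

Lemma GLJ_inv a : GLJ a -> [/\ a * a^-1%VF = 1, a^-1%VF * a = 1,
  adj a * adj (a^-1)%VF = 1, adj (a^-1)%VF * adj a = 1 &
  [/\ a^-1%VF * J = J * a^-1%VF, adj a * J = J * adj a &
  adj (a^-1)%VF * J = J * adj (a^-1)%VF]].
Proof.
move=> [a0 aJ]; have h1 := lker0_mulV a0; have h2 := lker0_Vmul a0.
have h3 : a^-1%VF * J = J * a^-1%VF.
  have : a^-1%VF * (a * J) * a^-1%VF = a^-1%VF * (J * a) * a^-1%VF by rewrite aJ.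
  by rewrite mulrA h2 mul1r !mulrA -(mulrA _ a) h1 mulr1 => ->.
have h : forall c, c * J = J * c -> adj c * J = J * adj c.
  by move=> c hc; have := congr1 adj hc; rewrite !adjM Ja mulNr mulrN => /oppr_inj.
by split=> //; [rewrite -adjM h2 adj_1|rewrite -adjM h1 adj_1|split=> //; apply: h].
Qed.

Lemma GLJ_1 : GLJ 1.
Proof. by split; [apply: (@lker0_mul _ _ 1); rewrite mulr1 | rewrite mul1r mulr1]. Qed.

Section OnePoint.
Variable L : 'End(V).
Hypotheses (LL : L * L = -1) (La : adj L = - L).
Let S := J + L.
Let T := J - L.

(** If (aS + bT) x = 0 then aS x = - bT x, while aS x and bT x are orthogonal,
    since adj(b) = a^-1 and adj(T) S = - TS is skew. So S x = T x = 0, and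
    S + T = 2J. *)
Lemma actd_inv a : GLJ a -> lker (actd a L) == 0%VS.
Proof.
move=> ha; have [h1 h2 h3 h4 [h5 h6 h7]] := GLJ_inv ha.
rewrite -subv0; apply/subvP => x; rewrite memv_ker memv0 => /eqP e.
set b := adj (a^-1)%VF in h3 h4 h7 *.
have e' : (a * S) x = - (b * T) x.
  by apply/eqP; rewrite -addr_eq0 -add_lfunE; apply/eqP.
have aS0 : (a * S) x = 0.
  apply: (@g_eq0 _ _ g); rewrite {2}e' gNr adjP' -mulEE.
  have -> : adj (b * T) * (a * S) = S * T.
    rewrite adjM; have -> : adj b = a^-1%VF by exact: adjK.
    by rewrite /S /T adjD adjN Ja La; nc (h2, JJ, LL).
  by rewrite skew0 ?oppr0 // /S /T adjM !(adjD, adjN) Ja La; nc (JJ, LL).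
have bT0 : (b * T) x = 0 by apply/eqP; rewrite -oppr_eq0 -e' aS0.
have Sx : S x = 0.
  by rewrite -[S]mul1r -h2 -mulrA mulEE aS0 linear0.
have Tx : T x = 0.
  by rewrite -[T]mul1r -h3 -mulrA mulEE bT0 linear0.
have : (J *+ 2) x = 0.
  have -> : J *+ 2 = S + T by rewrite /S /T; nc.
  by rewrite add_lfunE Sx Tx addr0.
rewrite mulr2n add_lfunE -mulr2n => /eqP; rewrite -scaler_nat scaler_eq0 pnatr_eq0 /=.
by move/eqP => Jx; have := congr1 J Jx; rewrite linear0 -mulEE JJ opp_lfunE oneEE => /eqP; rewrite oppr_eq0.
Qed.

Lemma act_char a M : GLJ a -> M * J * actd a L = - actn a L <-> M = act a L.
Proof.
move=> ha; have W0 := actd_inv ha; rewrite /act; set W := actd a L in W0 *.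
have WW := lker0_mulV W0; have WV := lker0_Vmul W0.
split=> [h|->]; last by nc (JJ, WV).
have : (M * J * W) * W^-1%VF * J = - actn a L * W^-1%VF * J by rewrite h.
have -> : (M * J * W) * W^-1%VF * J = - M by nc (WW, JJ).
by move/(congr1 -%R); rewrite opprK => ->; nc.
Qed.

Lemma act_mulJ a : GLJ a -> act a L * (J * actd a L) = - actn a L.
Proof. by move=> ha; have := (act_char (act a L) ha).2 erefl; rewrite mulrA. Qed.

Lemma actdL a : GLJ a -> J * actd a L * L = - actn a L.
Proof.
move=> ha; have [h1 h2 h3 h4 [h5 h6 h7]] := GLJ_inv ha; case: ha => _ aJ.
by rewrite /actd /actn; nc (aJ, h7, JJ, LL).
Qed.

(** The point moves by conjugation, though with a conjugating map that depends
    on the point. *)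
Lemma act_conj a : GLJ a -> act a L * (J * actd a L) = (J * actd a L) * L.
Proof. by move=> ha; rewrite act_mulJ // actdL. Qed.

Lemma act_twistor a : GLJ a -> act a L * act a L = -1 /\ adj (act a L) = - act a L.
Proof.
move=> ha; have W0 := actd_inv ha; have hc := act_conj ha.
have [h1 h2 h3 h4 [h5 h6 h7]] := GLJ_inv ha; have aJ := ha.2.
have hX := act_mulJ ha; move: (act a L) hc hX => M hc hX.
have WW := lker0_mulV W0; have WV := lker0_Vmul W0.
set W := actd a L in W0 WW WV hc hX *; set Wi := W^-1%VF in WW WV.
split.
  have -> : M * M = M * M * (J * W) * (Wi * - J) by nc (WW, JJ).
  by rewrite -(mulrA M M) hc (mulrA M) hc; nc (LL, WW, JJ).
have b' : adj (adj (a^-1)%VF) = a^-1%VF by exact: adjK.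
have hS : adj (actn a L) * J * W = adj W * J * actn a L.
  by rewrite /W /actn /actd !(adjD, adjN, adjM) b' Ja La; nc (aJ, h7, h6, h5, h3, h2, JJ, LL).
have hXJ : actn a L = - (M * J * W) by rewrite -mulrA hX opprK.
move: W Wi W0 WW WV hc hX hS hXJ => W Wi W0 WW WV hc hX hS hXJ.
rewrite hXJ !(adjN, adjM) Ja in hS.
have aWi : adj W * adj Wi = 1 by rewrite -adjM WV adj_1.
have aWi' : adj Wi * adj W = 1 by rewrite -adjM WW adj_1.
have -> : adj M = J * adj Wi * (- (adj W * (- J * adj M)) * J * W) * Wi * J.
  by nc (JJ, WW, aWi').
by rewrite hS; nc (JJ, WW, aWi').
Qed.

Lemma act_plus a : GLJ a -> J + act a L = (a * S * (actd a L)^-1%VF * J) *+ 2.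
Proof.
move=> ha; have W0 := actd_inv ha; have WW := lker0_mulV W0.
have -> : J + act a L = (actd a L + actn a L) * (actd a L)^-1%VF * J.
  by rewrite (mulrDl (actd a L)) WW (mulrDl 1) mul1r.
by rewrite /actd /actn /S; nc.
Qed.

Lemma act_minus a : GLJ a -> J - act a L = (adj (a^-1)%VF * T * (actd a L)^-1%VF * J) *+ 2.
Proof.
move=> ha; have W0 := actd_inv ha; have WW := lker0_mulV W0.
have -> : J - act a L = (actd a L - actn a L) * (actd a L)^-1%VF * J.
  by rewrite (mulrDl (actd a L)) WW (mulrDl 1) mul1r !mulNr.
by rewrite /actd /actn /T; nc.
Qed.

Lemma lker_double (A B : 'End(V)) (Q : 'End(V)) c : lker c == 0%VS -> lker Q == 0%VS ->
  A = (c * B * Q) *+ 2 -> \dim (lker A) = \dim (lker B).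
Proof.
move=> c0 Q0 ->; apply: (lker_dim Q0) => x.
rewrite mulr2n add_lfunE -mulr2n -scaler_nat !mulEE; split=> [/eqP|->]; last by rewrite linear0 scaler0.
rewrite scaler_eq0 pnatr_eq0 /= => /eqP h.
by apply: (lker0P c0); rewrite h linear0.
Qed.

Lemma act_kernel a : GLJ a -> \dim (lker (J + act a L)) = \dim (lker (J + L)) /\
  \dim (lker (J - act a L)) = \dim (lker (J - L)).
Proof.
move=> ha; have W0 := actd_inv ha; have [h1 h2 h3 h4 _] := GLJ_inv ha.
have Q0 : lker ((actd a L)^-1%VF * J) == 0%VS.
  apply: (@lker0_mul _ _ (- J * actd a L)).
  by have WW := lker0_mulV W0; nc (WW, JJ).
split.
  by apply: (lker_double (c := a) _ Q0); [case: ha | rewrite act_plus // mulrA].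
apply: (lker_double (c := adj (a^-1)%VF) _ Q0); last by rewrite act_minus // mulrA.
exact: lker0_mul h3.
Qed.

(** Recognises a point of the orbit without inverting [actd]. *)
Lemma act_eq a M : GLJ a -> M * M = -1 ->
  (J - M) * a * S + (J + M) * adj (a^-1)%VF * T = 0 -> act a L = M.
Proof.
move=> ha MM h; symmetry; apply/(act_char M ha); rewrite /actd /actn -/S -/T.
have [h1 h2 h3 h4 [h5 h6 h7]] := GLJ_inv ha; have aJ := ha.2.
have SL : S * L = J * S by rewrite /S; nc (JJ, LL).
have TL : T * L = - (J * T) by rewrite /T; nc (JJ, LL).
apply/eqP; rewrite -subr_eq0; apply/eqP; set b := adj _ in h h7 *.
have : - (((J - M) * a * S + (J + M) * b * T) * L) = 0 by rewrite h mul0r oppr0.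
move=> <-; move: SL TL; rewrite /=; move: S T => s t SL TL.
by nc (SL, TL, JJ, aJ, h7).
Qed.

Lemma act_1 : act 1 L = L.
Proof.
apply: act_eq => //; first exact: GLJ_1.
have -> : (1 : 'End(V))^-1%VF = 1 by rewrite -(@mul1_inv _ _ 1) // mulr1.
by rewrite adj_1 /S /T; nc (JJ, LL).
Qed.
End OnePoint.

End Action.

(** * The image of the anchor *)
Section Decomposition.
Context {R : realType} {V : vectType R} (g : {dot V for @idfun R}) (J : 'End(V)).
Hypotheses (JJ : J * J = -1) (Ja : adj g J = - J).
Local Notation adj := (adj g).
Implicit Types A B C e f : 'End(V).

Lemma dbl0 A : A *+ 2 = 0 -> A = 0.
Proof. by move=> h; apply/eqP; have := eqxx (0 : 'End(V)); rewrite -{1}h -scaler_nat scaler_eq0 pnatr_eq0. Qed.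

Lemma dbl_inj A B : A *+ 2 = B *+ 2 -> A = B.
Proof. by move=> h; apply/eqP; rewrite -subr_eq0; apply/eqP/dbl0; rewrite mulrnBl h subrr. Qed.

Lemma fun0 A : (forall x, A x = 0) -> A = 0.
Proof. by move=> h; apply/lfunP => x; rewrite h zero_lfunE. Qed.

(** For skew A the image is the orthogonal complement of the kernel. *)
Lemma kerproj A : adj A = - A -> exists e, [/\ e * e = e, adj e = e, A * e = 0, e * A = 0 &
  forall x, A x = 0 -> e x = x].
Proof.
move=> As; pose U := lker A; pose U' := limg A.
have gA x y : g (A x) y = - g x (A y) by rewrite adjP As opp_lfunE gNr.
have dir : (U :&: U' = 0)%VS.
  apply/eqP; rewrite -subv0; apply/subvP => x; rewrite memv_cap memv0 memv_ker.
  move=> /andP[/eqP Ax /memv_imgP[y _ e]]; apply/eqP/(g_eq0 (g := g)).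
  by rewrite {1}e gA Ax g0r oppr0.
have full : (U + U' = fullv)%VS.
  apply/eqP; rewrite eqEdim subvf /= dimv_disjoint_sum // -(limg_ker_dim A fullv) capfv.
  by rewrite leqnn.
exists (daddv_pi U U').
have p1 x : A (daddv_pi U U' x) = 0.
  by apply/eqP; rewrite -memv_ker; apply: memv_pi.
have p2 x : A x = 0 -> daddv_pi U U' x = x.
  by move=> h; apply: daddv_pi_id => //; rewrite memv_ker h.
have dir' : (U' :&: U = 0)%VS by rewrite capvC.
have p3 x : daddv_pi U U' x + daddv_pi U' U x = x.
  by apply: daddv_pi_add => //; rewrite full memvf.
have p4 x : daddv_pi U U' (A x) = 0.
  have := p3 (A x); rewrite (daddv_pi_id dir'); last by apply: memv_img; rewrite memvf.
  by move/eqP; rewrite -subr_eq0 addrK => /eqP.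
split=> //; try by apply/lfunP => x; rewrite mulEE ?zero_lfunE // p2.
apply: adj_eq => x y; have h u v : g (daddv_pi U U' u) v = g (daddv_pi U U' u) (daddv_pi U U' v).
  rewrite -{1}(p3 v) gDr; have /memv_imgP[z _ ->] : daddv_pi U' U v \in limg A by apply: memv_pi.
  by rewrite [g _ (A z)]gC gA p1 g0r oppr0 addr0.
by rewrite h gC -h gC.
Qed.

Lemma proj_commute A e C C' : e * e = e -> adj e = e -> A * e = 0 ->
  (forall x, A x = 0 -> e x = x) -> A * C = C' * A -> adj C = - C -> e * C = C * e.
Proof.
move=> ee ea Ae ek AC Ca.
have h : e * (C * e) = C * e.
  apply/lfunP => x; rewrite mulEE ek // -mulEE mulrA AC -mulrA Ae mulr0 zero_lfunE //.
have := congr1 adj h; rewrite !adjM ea Ca !(mulrN, mulNr) => /oppr_inj <-.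
by rewrite -mulrA h.
Qed.

(** The splitting of V into Ker (J + L), Ker (J - L) and the rest, through
   orthogonal projections e, f onto the two kernels. *)
Record kersplit (L e f : 'End(V)) : Prop := KerSplit {
  ks_ee : e * e = e; ks_ff : f * f = f; ks_ef : e * f = 0; ks_fe : f * e = 0;
  ks_ea : adj e = e; ks_fa : adj f = f;
  ks_Se : (J + L) * e = 0; ks_eS : e * (J + L) = 0;
  ks_Tf : (J - L) * f = 0; ks_fT : f * (J - L) = 0;
  ks_eJ : e * J = J * e; ks_fJ : f * J = J * f;
  ks_eL : e * L = L * e; ks_fL : f * L = L * f;
  ks_ek : forall x, (J + L) x = 0 -> e x = x;
  ks_fk : forall x, (J - L) x = 0 -> f x = x }.

Lemma kersplit_ex L : L * L = -1 -> adj L = - L -> exists e f, kersplit L e f.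
Proof.
move=> LL La.
have Sa : adj (J + L) = - (J + L) by rewrite adjD Ja La opprD.
have Ta : adj (J - L) = - (J - L) by rewrite adjD adjN Ja La opprD.
have [e [ee ea Se eS ek]] := kerproj Sa; have [f [ff fa Tf fT fk]] := kerproj Ta.
have eJ : e * J = J * e.
  by apply: (proj_commute ee ea Se ek (C' := L)) Ja; nc (JJ, LL).
have eL : e * L = L * e.
  by apply: (proj_commute ee ea Se ek (C' := J)) La; nc (JJ, LL).
have fJ : f * J = J * f.
  by apply: (proj_commute ff fa Tf fk (C' := - L)) Ja; nc (JJ, LL).
have fL : f * L = L * f.
  by apply: (proj_commute ff fa Tf fk (C' := - J)) La; nc (JJ, LL).
have fe : f * e = 0.
  apply: dbl0; have -> : f * e *+ 2 = - (f * J * ((J - L) * e)) - f * J * ((J + L) * e) by nc (JJ).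
  rewrite Se mulr0 subr0 fJ.
  have -> : J * f * ((J - L) * e) = J * (f * (J - L)) * e by nc.
  by rewrite fT mulr0 mul0r oppr0.
have ef : e * f = 0 by have := congr1 adj fe; rewrite adjM ea fa adj_0.
by exists e, f; split.
Qed.

Section Split.
Variables (L e f : 'End(V)).
Hypotheses (LL : L * L = -1) (La : adj L = - L) (ks : kersplit L e f).
Let S := J + L.
Let T := J - L.
Let o := 1 - e - f.

Let SL : S * L = J * S. Proof. by rewrite /S; nc (JJ, LL). Qed.
Let TL : T * L = - (J * T). Proof. by rewrite /T; nc (JJ, LL). Qed.
Let SJ : S * J = L * S. Proof. by rewrite /S; nc (JJ, LL). Qed.
Let TS : T * S = - (S * T). Proof. by rewrite /S /T; nc (JJ, LL). Qed.
Let Sa : adj S = - S. Proof. by rewrite /S adjD Ja La opprD. Qed.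
Let Ta : adj T = - T. Proof. by rewrite /T adjD adjN Ja La opprD. Qed.
Let ee := ks_ee ks. Let ff := ks_ff ks. Let ef := ks_ef ks. Let fe := ks_fe ks.
Let ea := ks_ea ks. Let fa := ks_fa ks.
Let Se : S * e = 0 := ks_Se ks. Let eS : e * S = 0 := ks_eS ks.
Let Tf : T * f = 0 := ks_Tf ks. Let fT : f * T = 0 := ks_fT ks.
Let eT : e * T = T * e. Proof. by rewrite /T; have h1 := ks_eJ ks; have h2 := ks_eL ks; nc (h1, h2). Qed.
Let fS : f * S = S * f. Proof. by rewrite /S; have h1 := ks_fJ ks; have h2 := ks_fL ks; nc (h1, h2). Qed.

(** S kills exactly Ker S, on which T is 2J. *)
Lemma ST_inv : lker (S + T * e) == 0%VS.
Proof.
rewrite -subv0; apply/subvP => x; rewrite memv_ker memv0 => /eqP h.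
have ex : e x = 0.
  have : (J * e * (S + T * e)) x = 0 by rewrite mulEE h linear0.
  have -> : J * e * (S + T * e) = - (e *+ 2).
    have -> : T * e = J * e *+ 2 - S * e by rewrite /T /S; nc.
    by rewrite Se; have h1 := ks_eJ ks; nc (h1, ee, eS, JJ).
  rewrite opp_lfunE mulr2n add_lfunE -mulr2n => /eqP; rewrite oppr_eq0 -scaler_nat scaler_eq0 pnatr_eq0 /=.
  by move/eqP.
have Sx : S x = 0 by move: h; rewrite add_lfunE mulEE ex linear0 addr0.
by rewrite -(ks_ek ks Sx) ex.
Qed.

Lemma TS_inv : lker (T + S * f) == 0%VS.
Proof.
rewrite -subv0; apply/subvP => x; rewrite memv_ker memv0 => /eqP h.
have fx : f x = 0.
  have : (J * f * (T + S * f)) x = 0 by rewrite mulEE h linear0.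
  have -> : J * f * (T + S * f) = - (f *+ 2).
    have -> : S * f = J * f *+ 2 - T * f by rewrite /T /S; nc.
    by rewrite Tf; have h1 := ks_fJ ks; nc (h1, ff, fT, JJ).
  rewrite opp_lfunE mulr2n add_lfunE -mulr2n => /eqP; rewrite oppr_eq0 -scaler_nat scaler_eq0 pnatr_eq0 /=.
  by move/eqP.
have Tx : T x = 0 by move: h; rewrite add_lfunE mulEE fx linear0 addr0.
by rewrite -(ks_fk ks Tx) fx.
Qed.

(** Since [xi g J P L] = T adj(P) S - S P T, one has to solve adj(Y) - Y = X with
    Y = S P T. The blocks of X on Ker S and Ker T being zero, the other blocks
    can be distributed between Y and its adjoint so that eY = 0 = Yf; such a Y
    is divisible by S on the left and T on the right, modulo the two kernels,
    and S + Te, T + Sf invert that division. *)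
Lemma xi_onto X : adj X = - X -> X * L = - (L * X) -> e * X * e = 0 -> f * X * f = 0 ->
  exists2 P, P * J = J * P & xi g J P L = X.
Proof.
move=> Xa XL eXe fXf.
pose D := S + T * e; pose D' := T + S * f.
pose Y := - 2^-1 *: (f * X * e *+ 2 + o * X * e *+ 2 + f * X * o *+ 2 + o * X * o).
have D0 := lker0_mulV ST_inv; have D1 := lker0_Vmul ST_inv.
have D'0 := lker0_mulV TS_inv; have D'1 := lker0_Vmul TS_inv.
rewrite -/D in D0 D1; rewrite -/D' in D'0 D'1.
move: (D^-1%VF) (D'^-1%VF) D0 D1 D'0 D'1 => Di Di' D0 D1 D'0 D'1.
have eD : e * D = D * e by rewrite /D; nc (Se, eS, eT, ee).
have fD' : f * D' = D' * f by rewrite /D'; nc (Tf, fT, fS, ff).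
have eDi : e * Di = Di * e.
  have -> : e * Di = Di * (D * e) * Di by nc (D1).
  by rewrite -eD; nc (D0).
have fDi' : f * Di' = Di' * f.
  have -> : f * Di' = Di' * (D' * f) * Di' by nc (D'1).
  by rewrite -fD'; nc (D'0).
have SDi : S * Di = 1 - e.
  have -> : S * Di = D * Di - T * (e * Di) by rewrite /D; nc.
  rewrite D0 eDi; congr (_ - _).
  have -> : T * (Di * e) = (T * e) * (e * Di) by rewrite eDi; nc (ee, eDi).
  have -> : T * e * (e * Di) = e * (D * Di) - (e * S) * Di by rewrite /D; nc (ee, eT).
  by rewrite eS D0 mul0r subr0 mulr1.
have DiT : Di' * T = 1 - f.
  have -> : Di' * T = Di' * D' - (Di' * f) * S by rewrite /D'; nc (fS).
  rewrite D'1 -fDi'; congr (_ - _).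
  have -> : f * Di' * S = Di' * f * (f * S) by rewrite -fDi'; nc (ff, fS, fDi').
  have -> : Di' * f * (f * S) = (Di' * D') * f - Di' * (T * f) by rewrite /D'; nc (ff, fS).
  by rewrite Tf D'1 mulr0 subr0 mul1r.
have eL := ks_eL ks; have fL := ks_fL ks.
have Y2 : Y *+ 2 = - (f * X * e *+ 2 + o * X * e *+ 2 + f * X * o *+ 2 + o * X * o).
  by rewrite -scaler_nat /Y scalerA mulrN mulfV ?pnatr_eq0 // scaleN1r.
have eY : e * Y = 0 by apply: dbl0; rewrite -mulrnAr Y2 /o; nc (ee, ef).
have Yf : Y * f = 0 by apply: dbl0; rewrite -mulrnAl Y2 /o; nc (ff, ef).
have YL : Y * L = - (L * Y).
  by apply: dbl_inj; rewrite -mulrnAl mulNrn -mulrnAr Y2 /o; nc (XL, eL, fL).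
have Ya : adj Y - Y = X.
  apply: dbl_inj; rewrite mulrnBl Y2; have -> : adj Y *+ 2 = adj (Y *+ 2) by rewrite !mulr2n adjD.
  rewrite Y2 /o !mulr2n !(adjN, adjD, adjM) adj_1 ea fa Xa; have := eXe; have := fXf => h1 h2.
  have -> : X + X = (X - e * X * e - f * X * f) *+ 2 by rewrite h1 h2 !subr0.
  by nc.
have DiL : L * (1 - f) * Di' = - (Di' * J * (1 - f)).
  have -> : L * (1 - f) * Di' = Di' * (D' * L * (1 - f)) * Di' by rewrite !mulrA D'1 mul1r.
  have -> : D' * L * (1 - f) = - (J * D' * (1 - f)) by rewrite /D'; nc (fL, TL, ff, Tf).
  have -> : Di' * - (J * D' * (1 - f)) * Di' = - (Di' * J * (D' * Di') - Di' * J * D' * (f * Di')) by nc.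
  by rewrite fDi'; nc (D'0).
have DJ : J * (1 - e) * Di = Di * L * (1 - e).
  have -> : J * (1 - e) * Di = Di * (D * J * (1 - e)) * Di by rewrite !mulrA D1 mul1r.
  have -> : D * J * (1 - e) = L * D * (1 - e).
    by rewrite /D; have eJ := ks_eJ ks; nc (eJ, SJ, ee, Se).
  have -> : Di * (L * D * (1 - e)) * Di = Di * L * (D * Di) - Di * L * D * (e * Di) by nc.
  by rewrite eDi; nc (D0).
exists (Di * Y * Di').
  have Y1 : Y = (1 - e) * Y * (1 - f) by rewrite mulrBl mul1r eY subr0 mulrBr mulr1 Yf subr0.
  have h1 : Y * Di' * J = - (Y * (L * (1 - f) * Di')).
    rewrite DiL; have fJ := ks_fJ ks.
    have -> : - (Y * - (Di' * J * (1 - f))) = Y * Di' * J - Y * (Di' * f) * J by nc (fJ).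
    by rewrite -fDi'; nc (Yf).
  have -> : Di * Y * Di' * J = Di * L * Y * Di'.
    have -> : Di * Y * Di' * J = Di * (Y * Di' * J) by nc.
    by rewrite h1; nc (YL, Yf).
  have -> : Di * L * Y * Di' = Di * L * (1 - e) * Y * Di' by nc (eY).
  rewrite -DJ. have -> : J * (1 - e) * Di = J * Di - J * (e * Di) by nc. rewrite eDi. nc (eY).
rewrite /xi -/S -/T.
have -> : S * (Di * Y * Di') * T = S * Di * Y * (Di' * T) by nc.
have -> : T * adj (Di * Y * Di') * S = adj (S * Di * Y * (Di' * T)).
  by rewrite !adjM Sa Ta; nc.
by rewrite SDi DiT mulrBl mul1r eY subr0 mulrBr mulr1 Yf subr0.
Qed.
End Split.
End Decomposition.

(** * The stratum in a Cayley chart *)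

Section Schur.
Context {R : realType} {V : vectType R} (g : {dot V for @idfun R}).
Local Notation adj := (adj g).

(** One of the two kernels, in the coordinate A of the Cayley transform: the
   kernel of S + TA is governed by a Schur complement on Ker S. The other
   kernel is obtained by exchanging the roles of (S, e) and (T, f). *)
Section OneKernel.
Variables (S T e f A : 'End(V)).
Let o := 1 - e - f.
Hypotheses (ee : e * e = e) (ff : f * f = f) (ef : e * f = 0) (fe : f * e = 0).
Hypotheses (Se : S * e = 0) (eS : e * S = 0) (Tf : T * f = 0) (fT : f * T = 0).
Hypotheses (eT : e * T = T * e) (fS : f * S = S * f).
Hypothesis ek : forall x, S x = 0 -> e x = x.

(** On the complement of the two kernels [schurD] is the block of S + TA, while it
    is T on Ker S and S on Ker T, so that it is invertible near A = 0. Inverting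
    it eliminates the component in that complement and leaves the equation
    eAe = eAMAe, with M = [schurM], on Ker S. *)
Definition schurD : 'End(V) := S + T * e + T * (1 - e - f) * A * (1 - e - f).
Definition schurM : 'End(V) := (1 - e - f) * schurD^-1%VF * T * (1 - e - f).
Definition schurQ : 'End(V) := e * A * schurM * A * e.

Hypothesis D0 : lker schurD == 0%VS.
Let D := schurD.
Let DDi : D * D^-1%VF = 1 := lker0_mulV D0.
Let DiD : D^-1%VF * D = 1 := lker0_Vmul D0.

Lemma oo : o * o = o. Proof. by rewrite /o; nc (ee, ff, ef, fe). Qed.
Lemma oe : o * e = 0. Proof. by rewrite /o; nc (ee, fe). Qed.
Lemma eo : e * o = 0. Proof. by rewrite /o; nc (ee, ef). Qed.
Lemma of0 : o * f = 0. Proof. by rewrite /o; nc (ff, ef). Qed.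
Lemma fo : f * o = 0. Proof. by rewrite /o; nc (ff, fe). Qed.
Lemma oT : o * T = T * o. Proof. by rewrite /o; nc (eT, Tf, fT). Qed.
Lemma oS : o * S = S * o. Proof. by rewrite /o; nc (fS, Se, eS). Qed.

Lemma oD : o * D = D * o.
Proof. by rewrite /D /schurD -/o; move: o oo oe eo oT oS => o' h1 h2 h3 h4 h5; nc (h1, h2, h3, h4, h5). Qed.
Lemma eD : e * D = D * e.
Proof. by rewrite /D /schurD -/o; move: o oe eo  => o' h2 h3; nc (h2, h3, eS, Se, eT, ee). Qed.

Lemma schur_inj_e x : T (e x) = 0 -> e x = 0.
Proof.
move=> h; apply: (lker0P D0); rewrite linear0 -mulEE /schurD -/o.
have -> : (S + T * e + T * o * A * o) * e = T * e.
  by move: o oe => o' h1; nc (h1, Se, ee).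
by rewrite mulEE.
Qed.

Lemma schur_inj_f x : S (f x) = 0 -> f x = 0.
Proof.
move=> h; apply: (lker0P D0); rewrite linear0 -mulEE /schurD -/o.
have -> : (S + T * e + T * o * A * o) * f = S * f.
  by move: o of0 => o' h1; nc (h1, ef).
by rewrite mulEE.
Qed.

(** The f-component of the equation is S (f x) = 0, the o-component determines
    o x from e x, and substitution leaves the Schur complement in the
    e-component. *)
Lemma schur_ker x : (S + T * A) x = 0 <->
  [/\ f x = 0, o x = - (schurM * A * e) x & (e * A * e - schurQ) x = 0].
Proof.
have hM : o * D^-1%VF = D^-1%VF * o.
  have -> : o * D^-1%VF = D^-1%VF * (D * o) * D^-1%VF by nc (DiD).
  by rewrite -oD; nc (DDi).
have sum : x = e x + f x + o x.
  by rewrite -!add_lfunE (_ : e + f + o = 1) ?oneEE // /o; nc.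
split=> [h|[h1 h2 h3]].
  have hf : f x = 0.
    apply: schur_inj_f; have : (f * (S + T * A)) x = 0 by rewrite mulEE h linear0.
    have -> : f * (S + T * A) = S * f by nc (fS, fT).
    by rewrite mulEE.
  have ho : o x = - (schurM * A * e) x.
    have h1 : (o * (S + T * A)) x = 0 by rewrite mulEE h linear0.
    have h2 : (T * o * A * f) x = 0 by rewrite mulEE hf linear0.
    have h3 : (D * o + T * o * A * e) x = 0.
      have -> : D * o + T * o * A * e = o * (S + T * A) - T * o * A * f.
        by rewrite /D /schurD /o; nc (ee, ff, ef, fe, Se, eS, Tf, fT, eT, fS).
      by rewrite add_lfunE opp_lfunE h1 h2 subrr.
    have : (D^-1%VF * (D * o + T * o * A * e)) x = 0 by rewrite mulEE h3 linear0.
    have -> : D^-1%VF * (D * o + T * o * A * e) = o + schurM * A * e.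
      rewrite /schurM -/o -/D hM; have a3 := oT; have a4 := oo.
      by move: D^-1%VF DiD a3 a4 => Di a1; move: o => o' a3 a4; nc (a1, a3, a4).
    by rewrite add_lfunE => /eqP; rewrite addr_eq0 => /eqP.
  split=> //; apply/eqP.
  have : (e * A) x = 0.
    rewrite mulEE; apply: schur_inj_e; rewrite -!mulEE -mulrA.
    have -> : T * (e * A) = e * (S + T * A) by nc (eS, eT).
    by rewrite mulEE h linear0.
  rewrite {1}sum hf addr0 !linearD /= ho linearN /= -!mulEE => E.
  by rewrite add_lfunE opp_lfunE /schurQ -!mulrA in E *; rewrite E.
have eA : (e * A) x = 0.
  rewrite {1}sum h1 addr0 !linearD /= h2 linearN /= -!mulEE.
  by rewrite -h3 add_lfunE opp_lfunE /schurQ !mulrA.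
have : (o * (S + T * A)) x = 0.
  have -> : o * (S + T * A) = D * o + T * o * A * e + T * o * A * f.
    by rewrite /D /schurD /o; nc (ee, ff, ef, fe, Se, eS, Tf, fT, eT, fS).
  have hD : (D * o) x = - (D * (schurM * A * e)) x by rewrite !mulEE h2 linearN /= !mulEE.
  have hf : (T * o * A * f) x = 0 by rewrite mulEE h1 linear0.
  rewrite 2!add_lfunE hf hD addr0; have -> : D * (schurM * A * e) = T * o * A * e.
    rewrite /schurM -/o -/D hM; have a3 := oT; have a4 := oo.
    by move: D^-1%VF DDi a3 a4 => Di a1; move: o => o' a3 a4; nc (a1, a3, a4).
  by rewrite addNr.
move=> ho; have hsum : (S + T * A) = (e + f + o) * (S + T * A).
  by rewrite (_ : e + f + o = 1) ?mul1r // /o; nc.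
rewrite hsum 2!mulrDl 2!add_lfunE ho addr0.
have -> : e * (S + T * A) = T * (e * A) by nc (eS, eT).
have -> : f * (S + T * A) = S * f by nc (fS, fT).
by rewrite !mulEE h1 -(mulEE e) eA !linear0 addr0.
Qed.

(** By [schur_ker], e embeds Ker (S + TA) into Ker S, with image the kernel of
    the Schur complement. *)
Lemma schur_dim : \dim (lker (S + T * A)) = \dim (lker S) <-> e * A * e = schurQ.
Proof.
pose k := e - schurM * A * e.
have eM : e * schurM = 0 by rewrite /schurM -/o !mulrA eo !mul0r.
have fM : f * schurM = 0 by rewrite /schurM -/o !mulrA fo !mul0r.
have oM : o * schurM = schurM by rewrite /schurM -/o !mulrA oo.
have ker_e : lker S = limg e.
  apply/eqP; rewrite eqEsubv; apply/andP; split; apply/subvP => x.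
    by rewrite memv_ker => /eqP/ek <-; rewrite memv_img ?memvf.
  by case/memv_imgP => y _ ->; rewrite memv_ker -mulEE Se zero_lfunE.
have inj : ((lker (S + (T * A)%R)%R) :&: lker e = 0)%VS.
  apply/eqP; rewrite -subv0; apply/subvP => x; rewrite memv_cap !memv_ker memv0.
  move=> /andP[/eqP/schur_ker[h1 h2 _] /eqP h3]; apply/eqP.
  have -> : x = e x + f x + o x.
    by rewrite -!add_lfunE (_ : e + f + o = 1) ?oneEE // /o; nc.
  by rewrite h1 h3 h2 mulEE h3 linear0 oppr0 !addr0.
split=> [h|h].
  have : (e @: (lker (S + (T * A)%R)%R) = limg e)%VS.
    by apply/eqP; rewrite eqEdim limgS ?subvf //= (limg_dim_eq inj) h ker_e.
  move=> E; apply/eqP; rewrite -subr_eq0; apply/eqP/fun0 => y.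
  have : e y \in limg e by rewrite memv_img ?memvf.
  rewrite -E => /memv_imgP[x]; rewrite memv_ker => /eqP/schur_ker[_ _ h3] exy.
  have q : e * A * e - schurQ = (e * A * e - schurQ) * e.
    by rewrite mulrBl /schurQ -!mulrA ee.
  by rewrite q mulEE exy -mulEE -q.
rewrite ker_e -(limg_dim_eq inj); congr (\dim _).
apply/eqP; rewrite eqEsubv limgS ?subvf //=; apply/subvP => y /memv_imgP[z _ ->].
have ek' : e * k = e by rewrite /k; nc (ee, eM).
have fk' : f * k = 0 by rewrite /k; nc (fe, fM).
have ok' : o * k = - (schurM * A * e * k).
  by rewrite /k; have h1 := oe; move: o h1 oM => o' h1 h2; nc (h1, h2, ee, eM).
apply/memv_imgP; exists (k z); last by rewrite -mulEE ek'.
rewrite memv_ker; apply/eqP/schur_ker; rewrite h subrr zero_lfunE; split=> //.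
  by rewrite -mulEE fk' zero_lfunE.
by rewrite -!mulEE ok' opp_lfunE.
Qed.

End OneKernel.
End Schur.

Section CayleyChart.
Context {R : realType} {V : vectType R} (g : {dot V for @idfun R}) (J : 'End(V)).
Hypotheses (JJ : J * J = -1) (Ja : adj g J = - J).
Local Notation adj := (adj g).
Implicit Types A B C L : 'End(V).
Variables (K e f : 'End(V)).
Hypotheses (KK : K * K = -1) (Ka : adj K = - K) (ks : kersplit g J K e f).
Let S := J + K.
Let T := J - K.

(** The Cayley transform centred at K: L (1 + A) = K (1 - A). Then
    J + L = (S + TA)(1 + A)^-1 and J - L = (T + SA)(1 + A)^-1, so that the kernels
    of J + L and J - L are those studied above. *)
Definition cay A : 'End(V) := K * (1 - A) * (1 + A)^-1%VF.
Definition icay L : 'End(V) := (K + L)^-1%VF * (K - L).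
Definition skanti A := adj A = - A /\ A * K = - (K * A).

Lemma cay_char A L : skanti A -> L * (1 + A) = K * (1 - A) <-> L = cay A.
Proof.
move=> [As _]; have i0 := skew_inv As; have h1 := lker0_mulV i0; have h2 := lker0_Vmul i0.
rewrite /cay; move: ((1 + A)^-1%VF) h1 h2 => I h1 h2; split=> [h|->].
  by rewrite -h -mulrA h1 mulr1.
by rewrite -mulrA h2 mulr1.
Qed.

Lemma cayE A : skanti A -> cay A * (1 + A) = K * (1 - A).
Proof. by move=> h; apply/(cay_char _ h). Qed.

Lemma cay_twistor A : skanti A -> cay A * cay A = -1 /\ adj (cay A) = - cay A.
Proof.
move=> hA; have [As AK] := hA; have i0 := skew_inv As.
have h1 := lker0_mulV i0; have h2 := lker0_Vmul i0.
rewrite /cay; move: ((1 + A)^-1%VF) h1 h2 => I h1 h2.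
have AI : A * I = 1 - I by rewrite -h1 mulrDl mul1r addrC addKr.
have IA : I * A = 1 - I by rewrite -h2 mulrDr mulr1 addrC addKr.
have h1' : adj I * (1 - A) = 1 by have := congr1 adj h1; rewrite adjM adjD adj_1 As.
have IK : adj I * K = K * I.
  have -> : adj I * K = adj I * ((1 - A) * K) * I.
    have -> : (1 - A) * K = K * (1 + A) by nc (AK).
    by nc (AI).
  by rewrite mulrA h1' mul1r.
have KI : K * I = adj I * K by rewrite IK.
split.
  have E : I * (K * (1 - A)) = K.
    have -> : K * (1 - A) = (1 + A) * K by nc (AK).
    by rewrite mulrA h2 mul1r.
  have -> : K * (1 - A) * I * (K * (1 - A) * I) = K * (1 - A) * (I * (K * (1 - A))) * I by nc.
  by rewrite E; nc (AK, KK, AI).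
rewrite !adjM adjD adjN adj_1 Ka As opprK; have -> : adj I * ((1 + A) * - K) = - (adj I * K * (1 - A)) by nc (AK).
by rewrite IK; nc (IA, AI).
Qed.

Lemma cay_sum A : skanti A -> (K + cay A) * (1 + A) = K *+ 2.
Proof. by move=> hA; rewrite mulrDl cayE //; nc. Qed.

Lemma cay_sum_inv A : skanti A -> lker (K + cay A) == 0%VS.
Proof.
move=> hA; apply: (@lker0_right _ _ _ (2^-1 *: ((1 + A) * - K))).
have E : (K + cay A) * ((1 + A) * - K) = 1 *+ 2 by rewrite mulrA cay_sum //; nc (KK).
by rewrite -scaleEr E -[(1 : 'End(V)) *+ 2]scaler_nat scalerA mulVf ?pnatr_eq0 // scale1r.
Qed.

Lemma icay_cay A : skanti A -> icay (cay A) = A.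
Proof.
move=> hA; have h0 := cay_sum_inv hA; rewrite /icay.
have -> : K - cay A = (K + cay A) * A.
  have h := cayE hA.
  transitivity (cay A * (1 + A) - cay A + K * A); first by rewrite h; nc.
  by nc.
by rewrite mulrA lker0_Vmul // mul1r.
Qed.

Lemma icay_skanti L : L * L = -1 -> adj L = - L -> lker (K + L) == 0%VS -> skanti (icay L).
Proof.
move=> LL La h0; have h1 := lker0_mulV h0; have h2 := lker0_Vmul h0.
rewrite /icay; have aX : adj ((K + L)^-1%VF) = - (K + L)^-1%VF.
  have h3 : adj ((K + L)^-1%VF) * (- (K + L)) = 1.
    by have := congr1 adj h1; rewrite adjM adjD adj_1 Ka La opprD.
  move: h1 h2 h3; move: ((K + L)^-1%VF) => X h1 h2 h3.
  by rewrite -[LHS]mulr1 -h1 -[K + L]opprK mulNr mulrN mulrA h3 mul1r.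
move: h1 h2 aX; move: ((K + L)^-1%VF) => X h1 h2 aX.
have XK : X * K = L * X.
  have -> : X * K = X * (K * (K + L)) * X by rewrite -!mulrA h1 mulr1.
  have -> : K * (K + L) = (K + L) * L by nc (KK, LL).
  by rewrite mulrA h2 mul1r.
have XL : X * L = K * X.
  have -> : X * L = X * (L * (K + L)) * X by rewrite -!mulrA h1 mulr1.
  have -> : L * (K + L) = (K + L) * K by nc (KK, LL).
  by rewrite mulrA h2 mul1r.
have YX : (K - L) * X = - (X * (K - L)).
  have -> : (K - L) * X = X * ((K + L) * (K - L)) * X by rewrite !mulrA h2 mul1r.
  have -> : (K + L) * (K - L) = - ((K - L) * (K + L)) by nc (KK, LL).
  by rewrite mulrN mulNr -!mulrA h1 mulr1.
split.
  by rewrite adjM adjD adjN Ka La aX -YX; nc.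
have -> : X * (K - L) * K = X * (- (L * (K - L))) by nc (KK, LL).
by rewrite mulrN (mulrA X) XL mulrA.
Qed.

Lemma cay_icay L : L * L = -1 -> adj L = - L -> lker (K + L) == 0%VS -> cay (icay L) = L.
Proof.
move=> LL La h0; symmetry; apply/cay_char; first exact: icay_skanti.
have h : (K + L) * icay L = K - L by rewrite /icay mulrA lker0_mulV // mul1r.
apply/eqP; rewrite -subr_eq0; apply/eqP.
transitivity ((K + L) * icay L - (K - L)); first by nc.
by rewrite h subrr.
Qed.

Definition QE A : 'End(V) := schurQ S T e f A.
Definition QF A : 'End(V) := schurQ T S f e A.
Definition goodA A := lker (schurD S T e f A) == 0%VS /\ lker (schurD T S f e A) == 0%VS.
(** [m0] is the space of free parameters, the tangent vectors at K with vanishing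
    blocks on the two kernels; [phi] restores the blocks prescribed by the Schur
    conditions, and [pr] forgets them. *)
Definition phi A := A + QE A + QF A.
Definition m0 A := [/\ skanti A, e * A * e = 0 & f * A * f = 0].
Definition pr A := A - e * A * e - f * A * f.

Let ee := ks_ee ks. Let ff := ks_ff ks. Let ef := ks_ef ks. Let fe := ks_fe ks.
Let ea := ks_ea ks. Let fa := ks_fa ks.
Let Se : S * e = 0 := ks_Se ks. Let eS : e * S = 0 := ks_eS ks.
Let Tf : T * f = 0 := ks_Tf ks. Let fT : f * T = 0 := ks_fT ks.
Let eK := ks_eL ks. Let fK := ks_fL ks.
Let eT : e * T = T * e. Proof. by rewrite /T; have h1 := ks_eJ ks; have h2 := ks_eL ks; nc (h1, h2). Qed.
Let fS : f * S = S * f. Proof. by rewrite /S; have h1 := ks_fJ ks; have h2 := ks_fL ks; nc (h1, h2). Qed.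

Lemma cay_stratum A : skanti A -> goodA A ->
  (\dim (lker (J + cay A)) = \dim (lker S) /\ \dim (lker (J - cay A)) = \dim (lker T)) <->
  (e * A * e = QE A /\ f * A * f = QF A).
Proof.
move=> hA [D1 D2]; have i0 := skew_inv hA.1.
have h1 : \dim (lker (S + T * A)) = \dim (lker (J + cay A)).
  apply: (lker_dim i0) => x; rewrite -mulEE (_ : (J + cay A) * (1 + A) = S + T * A) //.
  by rewrite mulrDl cayE // /S /T; nc.
have h2 : \dim (lker (T + S * A)) = \dim (lker (J - cay A)).
  apply: (lker_dim i0) => x; rewrite -mulEE (_ : (J - cay A) * (1 + A) = T + S * A) //.
  by rewrite mulrBl cayE // /S /T; nc.
rewrite -h1 -h2.
have := schur_dim ee ff ef fe Se eS Tf fT eT fS (ks_ek ks) D1.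
have := schur_dim ff ee fe ef Tf fT Se eS fS eT (ks_fk ks) D2.
by rewrite /QE /QF; tauto.
Qed.

(** Both Schur corrections are tangent at K. The two cases, of Ker S and of
    Ker T, differ by exchanging (S, e) with (T, f) and J with - J, hence the
    primed variables. *)
Section Q.
Variables (S' T' e' f' : 'End(V)).
Hypotheses (ee' : e' * e' = e') (ff' : f' * f' = f') (ef' : e' * f' = 0) (fe' : f' * e' = 0).
Hypotheses (ea' : adj e' = e') (fa' : adj f' = f').
Hypotheses (Se' : S' * e' = 0) (eS' : e' * S' = 0) (Tf' : T' * f' = 0) (fT' : f' * T' = 0).
Hypotheses (eT' : e' * T' = T' * e') (fS' : f' * S' = S' * f').
Hypotheses (Sa' : adj S' = - S') (Ta' : adj T' = - T') (TS' : T' * S' = - (S' * T')).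
Variables (J' : 'End(V)).
Hypotheses (SK' : S' * K = J' * S') (TK' : T' * K = - (J' * T')).
Hypotheses (eK' : e' * K = K * e') (fK' : f' * K = K * f').
Hypotheses (eJ' : e' * J' = J' * e') (fJ' : f' * J' = J' * f').
Variable A : 'End(V).
Hypotheses (hA : skanti A) (D0 : lker (schurD S' T' e' f' A) == 0%VS).
Let o := 1 - e' - f'.

Let DDi := lker0_mulV D0.
Let DiD := lker0_Vmul D0.
Let Dio : o * (schurD S' T' e' f' A)^-1%VF = (schurD S' T' e' f' A)^-1%VF * o.
Proof.
have oD : o * schurD S' T' e' f' A = schurD S' T' e' f' A * o.
  rewrite /schurD /o; nc (ee', ff', ef', fe', Se', eS', Tf', fT', eT', fS').
move: DDi DiD oD; move: (schurD _ _ _ _ _) => D; move: (D^-1)%VF => Di h1 h2 h3.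
have -> : o * Di = Di * (D * o) * Di by nc (h2).
by rewrite -h3; nc (h1).
Qed.

(** D intertwines K with J' off the kernels, and T anti-intertwines them. *)
Lemma schurM_anti : K * schurM S' T' e' f' A = - (schurM S' T' e' f' A * K).
Proof.
have h : schurD S' T' e' f' A * K * o = J' * schurD S' T' e' f' A * o.
  have AK := hA.2.
  rewrite /schurD /o; nc (ee', ff', ef', fe', Se', eS', Tf', fT', eT', fS', SK', TK', eK', fK', AK, eJ', fJ').
rewrite /schurM -/o; move: DDi DiD Dio h; move: (schurD _ _ _ _ _) => D; move: (D^-1)%VF => Di h1 h2 h3 h.
have oK : o * K = K * o by rewrite /o; nc (eK', fK').
have oT : o * T' = T' * o by rewrite /o; nc (eT', Tf', fT').
have oo : o * o = o by rewrite /o; nc (ee', ff', ef', fe').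
have oJ : o * J' = J' * o by rewrite /o; nc (eJ', fJ').
have h' : K * o * Di = Di * J' * o.
  have -> : K * o * Di = Di * (D * K * o) * Di by nc (h2).
  rewrite h; have -> : Di * (J' * D * o) * Di = Di * J' * D * (o * Di) by nc.
  by rewrite h3; nc (h1).
have -> : K * (o * Di * T' * o) = K * o * Di * T' * o by nc.
rewrite h'; move: o h' h3 h oK oT oo oJ => o' h' h3 h oK oT oo oJ.
have -> : Di * J' * o' * T' * o' = Di * o' * (J' * T') by nc (oT, oo, oJ).
have -> : J' * T' = - (T' * K) by rewrite TK' opprK.
by rewrite h3; nc (oT, oo, oK).
Qed.

(** D T o is T o times the adjoint of D, so that D^-1 T o is skew. *)
Lemma schurM_skew : adj (schurM S' T' e' f' A) = - schurM S' T' e' f' A.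
Proof.
have oa : adj o = o by rewrite /o !(adjD, adjN) ea' fa' adj_1.
have h : schurD S' T' e' f' A * (T' * o) = (T' * o) * adj (schurD S' T' e' f' A).
  have As := hA.1.
  have STe : S' * T' * e' = 0 by rewrite -mulrA -eT' mulrA Se' mul0r.
  rewrite /schurD /o !(adjD, adjN, adjM) adj_1 ea' fa' Sa' Ta' As; nc (ee', ff', ef', fe', Se', eS', Tf', fT', eT', fS', TS', STe).
rewrite /schurM -/o !adjM oa Ta'.
have aD : adj (schurD S' T' e' f' A) * adj ((schurD S' T' e' f' A)^-1)%VF = 1.
  by rewrite -adjM DiD adj_1.
move: aD DDi DiD Dio h; move: (schurD _ _ _ _ _) => D; move: (D^-1)%VF => Di h0 h1 h2 h3 h.
have oT : o * T' = T' * o by rewrite /o; nc (eT', Tf', fT').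
have -> : o * (- T' * (adj Di * o)) = - (T' * o * adj Di * o) by nc (oT).
have -> : T' * o * adj Di = Di * (T' * o).
  have -> : T' * o * adj Di = Di * (D * (T' * o)) * adj Di by nc (h2).
  by rewrite h; nc (h0).
by rewrite h3; nc (oT).
Qed.

Lemma schurQ_skanti : skanti (schurQ S' T' e' f' A).
Proof.
have h1 := schurM_skew; have h2 := schurM_anti; have [As AK] := hA.
rewrite /schurQ; move: (schurM _ _ _ _ _) h1 h2 => M h1 h2; split.
  by rewrite !adjM ea' As h1; nc.
have KM : M * K = - (K * M) by rewrite h2 opprK.
by nc (AK, KM, eK').
Qed.
End Q.

Let Sa : adj S = - S. Proof. by rewrite /S adjD Ja Ka opprD. Qed.
Let Ta : adj T = - T. Proof. by rewrite /T adjD adjN Ja Ka opprD. Qed.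

Lemma QE_skanti A : skanti A -> goodA A -> skanti (QE A).
Proof.
move=> hA [D1 _]; apply: (@schurQ_skanti S T e f ee ff ef fe ea fa Se eS Tf fT eT fS Sa Ta _ J _ _ eK fK _ _ A hA D1);
  by rewrite /S /T; have h1 := ks_eJ ks; have h2 := ks_fJ ks; nc (JJ, KK, h1, h2).
Qed.

Lemma QF_skanti A : skanti A -> goodA A -> skanti (QF A).
Proof.
move=> hA [_ D2]; apply: (@schurQ_skanti T S f e ff ee fe ef fa ea Tf fT Se eS fS eT Ta Sa _ (- J) _ _ fK eK _ _ A hA D2);
  by rewrite /S /T; have h1 := ks_eJ ks; have h2 := ks_fJ ks; nc (JJ, KK, h1, h2).
Qed.

Lemma skantiD A B : skanti A -> skanti B -> skanti (A + B).
Proof. by move=> [a1 a2] [b1 b2]; split; [rewrite adjD a1 b1; nc | nc (a2, b2)]. Qed.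

Lemma phi_skanti A : skanti A -> goodA A -> skanti (phi A).
Proof. by move=> h1 h2; exact: (skantiD (skantiD h1 (QE_skanti h1 h2)) (QF_skanti h1 h2)). Qed.

Lemma QE_e A : e * QE A * e = QE A /\ f * QE A = 0 /\ QE A * f = 0.
Proof.
by rewrite /QE /schurQ; move: (schurM _ _ _ _ _) => M; split; [|split]; nc (ee, fe, ef).
Qed.

Lemma QF_f A : f * QF A * f = QF A /\ e * QF A = 0 /\ QF A * e = 0.
Proof.
by rewrite /QF /schurQ; move: (schurM _ _ _ _ _) => M; split; [|split]; nc (ff, fe, ef).
Qed.

(** The Schur correction does not see the diagonal blocks on the kernels, so it
    is a function of the free parameters alone. *)
Lemma schur_pr A B : (1 - e - f) * A * (1 - e - f) = (1 - e - f) * B * (1 - e - f) ->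
  (1 - e - f) * A * e = (1 - e - f) * B * e -> e * A * (1 - e - f) = e * B * (1 - e - f) ->
  schurD S T e f A = schurD S T e f B /\ QE A = QE B.
Proof.
move=> h1 h2 h3; have hD : schurD S T e f A = schurD S T e f B.
  by rewrite /schurD -[T * _ * A]mulrA -[T * _ * B]mulrA -[T * (_ * A) * _]mulrA h1 !mulrA.
split=> //; rewrite /QE /schurQ /schurM hD; move: (schurD _ _ _ _ _)^-1%VF => Di.
move: (1 - e - f) h1 h2 h3 => o _ h2 h3.
transitivity ((e * A * o) * Di * T * (o * A * e)); first by nc.
by rewrite h2 h3; nc.
Qed.

Lemma goodA_pr A : goodA (pr A) = goodA A /\ QE (pr A) = QE A /\ QF (pr A) = QF A.
Proof.
have [h1 h2] : schurD S T e f (pr A) = schurD S T e f A /\ QE (pr A) = QE A.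
  by apply: schur_pr; rewrite /pr; nc (ee, ff, ef, fe).
have [h3 h4] : schurD T S f e (pr A) = schurD T S f e A /\ QF (pr A) = QF A.
  have hD : schurD T S f e (pr A) = schurD T S f e A.
    by rewrite /schurD /pr; nc (ee, ff, ef, fe).
  split=> //; rewrite /QF /schurQ /schurM hD; move: (schurD _ _ _ _ _)^-1%VF => Di.
  by rewrite /pr; nc (ee, ff, ef, fe).
by rewrite /goodA h1 h3.
Qed.

Lemma goodA_phi A : goodA (phi A) = goodA A.
Proof.
have [e1 [e2 e3]] := QE_e A; have [f1 [f2 f3]] := QF_f A.
have -> : goodA A = goodA (pr A) by have [->] := goodA_pr A.
have [<- _] := goodA_pr (phi A); congr (goodA _); rewrite /pr /phi.
have -> : e * (A + QE A + QF A) * e = e * A * e + QE A by rewrite -{2}e1; nc (f2).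
have -> : f * (A + QE A + QF A) * f = f * A * f + QF A by rewrite -{2}f1; nc (e2).
by nc.
Qed.

Lemma pr_phi A : m0 A -> pr (phi A) = A.
Proof.
move=> [_ hE hF]; have [e1 [e2 e3]] := QE_e A; have [f1 [f2 f3]] := QF_f A; rewrite /pr /phi.
have -> : e * (A + QE A + QF A) * e = e * A * e + QE A by rewrite -{2}e1; nc (f2).
have -> : f * (A + QE A + QF A) * f = f * A * f + QF A by rewrite -{2}f1; nc (e2).
by rewrite hE hF; nc.
Qed.

Lemma pr_m0 A : skanti A -> m0 (pr A).
Proof.
move=> [Aa AK]; split; [split|by rewrite /pr; nc (ee, ef, fe)|by rewrite /pr; nc (ff, ef, fe)].
  by rewrite /pr !(adjD, adjN, adjM) ea fa Aa; nc.
by rewrite /pr; nc (AK, eK, fK).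
Qed.

(** The stratum near K is the graph of phi over m0 in the chart cay. *)
Lemma chart_in A : m0 A -> goodA A -> let L := cay (phi A) in
  [/\ L * L = -1, adj L = - L, \dim (lker (J + L)) = \dim (lker S),
      \dim (lker (J - L)) = \dim (lker T) & lker (K + L) == 0%VS].
Proof.
move=> hm hg L; have [hA hE hF] := hm; have hp := phi_skanti hA hg.
have [LL La] := cay_twistor hp; have hg' : goodA (phi A) by rewrite goodA_phi.
have [e1 [e2 e3]] := QE_e A; have [f1 [f2 f3]] := QF_f A.
have [_ [q1 q2]] := goodA_pr (phi A); rewrite pr_phi // in q1 q2.
have [|-> ->] := (cay_stratum hp hg').2.
- rewrite -q1 -q2 /phi; split.
    have -> : e * (A + QE A + QF A) * e = e * A * e + QE A by rewrite -{2}e1; nc (f2).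
    by rewrite hE add0r.
  have -> : f * (A + QE A + QF A) * f = f * A * f + QF A by rewrite -{2}f1; nc (e2).
  by rewrite hF add0r.
- by split=> //; apply: cay_sum_inv.
Qed.

Lemma chart_onto L : L * L = -1 -> adj L = - L -> lker (K + L) == 0%VS ->
  goodA (pr (icay L)) -> \dim (lker (J + L)) = \dim (lker S) ->
  \dim (lker (J - L)) = \dim (lker T) ->
  m0 (pr (icay L)) /\ L = cay (phi (pr (icay L))).
Proof.
move=> LL La h0 hg h1 h2; have hA := icay_skanti LL La h0.
split; first exact: pr_m0.
rewrite -{1}(cay_icay LL La h0); congr cay.
have [hg' [q1 q2]] := goodA_pr (icay L); rewrite hg' in hg.
have [] := (cay_stratum hA hg).1; first by rewrite cay_icay.
by rewrite /phi q1 q2 /pr => -> ->; nc.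
Qed.

End CayleyChart.

(** * Transitivity of the action on a stratum *)

Section Symplectic.
Context {R : realType} {V : vectType R} (g : {dot V for @idfun R}) (J : 'End(V)).
Hypotheses (JJ : J * J = -1) (Ja : adj g J = - J).
Local Notation adj := (adj g).
Implicit Types (U : {vspace V}) (t a : 'End(V)) (u v w z : V).

(** Skew J-antilinear t, equivalently the J-bilinear alternating form with real
    and imaginary parts [fp] and [fq] (up to sign). *)
Definition skewJ t := adj t = - t /\ t * J = - (J * t).

Section Form.
Variable t : 'End(V).
Hypothesis ht : skewJ t.

Definition fp w z := g (t w) z.
Definition fq w z := g (t w) (J z).

Lemma JJx x : J (J x) = - x.
Proof. by rewrite -mulEE JJ opp_lfunE oneEE. Qed.
Lemma gJ x y : g (J x) y = - g x (J y).
Proof. by rewrite adjP Ja opp_lfunE gNr. Qed.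
Lemma tJ x : t (J x) = - J (t x).
Proof. by rewrite -!mulEE ht.2 opp_lfunE. Qed.
Lemma gt x y : g (t x) y = - g x (t y).
Proof. by rewrite adjP ht.1 opp_lfunE gNr. Qed.

Lemma fpC w z : fp w z = - fp z w. Proof. by rewrite /fp gt gC. Qed.
Lemma fqC w z : fq w z = - fq z w.
Proof. by rewrite /fq gt tJ gNr opprK gC gJ. Qed.
Lemma fpJl w z : fp (J w) z = fq w z. Proof. by rewrite /fp /fq tJ gNl gJ opprK. Qed.
Lemma fpJr w z : fp w (J z) = fq w z. Proof. by []. Qed.
Lemma fqJl w z : fq (J w) z = - fp w z. Proof. by rewrite /fp /fq tJ gNl gJ opprK JJx gNr. Qed.
Lemma fqJr w z : fq w (J z) = - fp w z. Proof. by rewrite /fp /fq JJx gNr. Qed.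
Lemma fp0 w : fp w w = 0. Proof. by have := fpC w w; lra. Qed.
Lemma fq0 w : fq w w = 0. Proof. by have := fqC w w; lra. Qed.
Lemma fpDl x w z : fp (x + w) z = fp x z + fp w z. Proof. by rewrite /fp linearD gDl. Qed.
Lemma fqDl x w z : fq (x + w) z = fq x z + fq w z. Proof. by rewrite /fq linearD gDl. Qed.
Lemma fpZl (a : R) w z : fp (a *: w) z = a * fp w z. Proof. by rewrite /fp linearZ gZl. Qed.
Lemma fqZl (a : R) w z : fq (a *: w) z = a * fq w z. Proof. by rewrite /fq linearZ gZl. Qed.
Lemma fpNl w z : fp (- w) z = - fp w z. Proof. by rewrite /fp linearN gNl. Qed.
Lemma fqNl w z : fq (- w) z = - fq w z. Proof. by rewrite /fq linearN gNl. Qed.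
Lemma fpDr x w z : fp z (x + w) = fp z x + fp z w. Proof. by rewrite /fp gDr. Qed.
Lemma fpZr (a : R) w z : fp z (a *: w) = a * fp z w. Proof. by rewrite /fp gZr. Qed.
Lemma fpNr w z : fp z (- w) = - fp z w. Proof. by rewrite /fp gNr. Qed.

Lemma fqDr x w z : fq z (x + w) = fq z x + fq z w. Proof. by rewrite /fq linearD gDr. Qed.
Lemma fqZr (a : R) w z : fq z (a *: w) = a * fq z w. Proof. by rewrite /fq linearZ gZr. Qed.

(** For a normed pair u, v this is the complex linear map that sends u, v to
    u', v' and kills the complement of u, v for the form. *)
Definition hmf u v u' v' w : V :=
  fp w v *: u' - fq w v *: J u' - fp w u *: v' + fq w u *: J v'.
Definition hm u v u' v' : 'End(V) := linfun (hmf u v u' v').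

Lemma hmE u v u' v' w : hm u v u' v' w = hmf u v u' v' w.
Proof.
rewrite lfnE // => a x y; rewrite /hmf !(fpDl, fqDl, fpZl, fqZl) !scalerDr !scalerDl !scalerN !scalerA.
by abel.
Qed.

Lemma hmJ u v u' v' : hm u v u' v' * J = J * hm u v u' v'.
Proof.
apply/lfunP => w; rewrite !mulEE !hmE /hmf !(fpJl, fqJl) !(linearD, linearN, linearZ) /= !JJx.
by rewrite !scalerN !scaleNr; abel.
Qed.

Definition normed u v := fp u v = 1 /\ fq u v = 0.
End Form.

Section TwoForms.
Variables t t' : 'End(V).
Hypotheses (ht : skewJ t) (ht' : skewJ t').
Variables u v u' v' : V.
Hypotheses (n : normed t u v) (n' : normed t' u' v').

Lemma hm_pair w : [/\ fp t' (hm t u v u' v' w) v' = fp t w v, fq t' (hm t u v u' v' w) v' = fq t w v,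
  fp t' (hm t u v u' v' w) u' = fp t w u & fq t' (hm t u v u' v' w) u' = fq t w u].
Proof.
have [n1 n2] := n'.
have n3 : fp t' v' u' = -1 by rewrite fpC // n1.
have n4 : fq t' v' u' = 0 by rewrite fqC // n2 oppr0.
rewrite hmE // /hmf !(fpDl, fqDl, fpNl, fqNl, fpZl, fqZl, fpJl, fqJl, fp0, fq0) // n1 n2 n3 n4.
by split; ring.
Qed.

Lemma fp_hmr x z : fp t' x (hm t u v u' v' z) =
  fp t z v * fp t' x u' - fq t z v * fq t' x u' - fp t z u * fp t' x v' + fq t z u * fq t' x v'.
Proof. by rewrite hmE // /hmf !(fpDr, fpNr, fpZr, fpJr). Qed.

Lemma fp_hm2 w z : fp t' (hm t u v u' v' w) (hm t u v u' v' z) =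
  fp t z v * fp t w u - fq t z v * fq t w u - fp t z u * fp t w v + fq t z u * fq t w v.
Proof. by rewrite fp_hmr; have [-> -> -> ->] := hm_pair w. Qed.
End TwoForms.

Lemma hm_comp t t' u v u' v' u2 v2 : skewJ t' -> normed t' u' v' ->
  hm t' u' v' u2 v2 * hm t u v u' v' = hm t u v u2 v2.
Proof.
move=> ht' n'; apply/lfunP => w; rewrite mulEE hmE // /hmf.
by have [-> -> -> ->] := hm_pair t ht' u v n' w; rewrite hmE.
Qed.

Definition stable U := forall x, x \in U -> J x \in U.
Definition nondeg t U := forall x, x \in U -> (forall y, y \in U -> fp t x y = 0) -> x = 0.

(** Divide a vector v with fp u v nonzero by the complex number
    fp u v - i fq u v. *)
Lemma normed_ex t U u : skewJ t -> stable U -> nondeg t U -> u \in U -> u != 0 ->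
  exists2 v, v \in U & normed t u v.
Proof.
move=> ht sU nd Uu u0.
have [v Uv pv] : exists2 v, v \in U & fp t u v != 0.
  apply/not_exists2P => h; case/eqP: u0; apply: (nd _ Uu) => y Uy.
  by have := h y; case=> // /negP/negPn/eqP.
pose c := fp t u v ^+ 2 + fq t u v ^+ 2.
have c0 : c != 0.
  by rewrite gt_eqF // ltr_wpDr ?sqr_ge0 // lt0r sqrf_eq0 pv sqr_ge0.
exists ((fp t u v / c) *: v + (fq t u v / c) *: J v).
  by rewrite memvD // memvZ // sU.
have c0' : fp t u v ^+ 2 + fq t u v ^+ 2 != 0 := c0.
split; rewrite !(fpDr, fpZr, fpJr, fqDr, fqZr, fqJr) /c; field.
  by rewrite c0'.
by rewrite c0'.
Qed.

(** Complex Darboux theorem: split off a hyperbolic plane spanned by a normed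
    pair on each side and induct on the complements. *)
Lemma symp_iso t t' n U U' : skewJ t -> skewJ t' -> (\dim U <= n)%N -> \dim U = \dim U' ->
  stable U -> stable U' -> nondeg t U -> nondeg t' U' ->
  exists a, [/\ a * J = J * a, forall x, x \in U -> a x \in U' &
    forall x y, x \in U -> y \in U -> fp t' (a x) (a y) = fp t x y].
Proof.
move=> ht ht'; elim: n U U' => [|n IH] U U' dU dUU' sU sU' nU nU'.
  have U0 : U = 0%VS by apply/eqP; rewrite -dimv_eq0 -leqn0.
  exists 0; split; first by rewrite mul0r mulr0.
    by move=> x _; rewrite zero_lfunE mem0v.
  by move=> x y; rewrite U0 memv0 => /eqP-> _; rewrite !zero_lfunE /fp !linear0 !g0l.
have [U0|U0] := eqVneq U 0%VS; first by apply: (IH U U') => //; rewrite U0 dimv0.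
have U'0 : U' != 0%VS by rewrite -dimv_eq0 -dUU' dimv_eq0.
pose u := vpick U; pose u' := vpick U'.
have u0 : u != 0 by rewrite vpick0.
have u'0 : u' != 0 by rewrite vpick0.
have Uu : u \in U by exact: memv_pick.
have U'u : u' \in U' by exact: memv_pick.
have [v Uv nv] := normed_ex ht sU nU Uu u0.
have [v' U'v nv'] := normed_ex ht' sU' nU' U'u u'0.
pose h := hm t u v u' v'; pose h' := hm t' u' v' u v.
pose p := hm t u v u v; pose p' := hm t' u' v' u' v'.
have hmU W s x y x' y' w : skewJ s -> stable W -> x' \in W -> y' \in W -> hm s x y x' y' w \in W.
  by move=> hs sW Wx Wy; rewrite hmE // /hmf !(memvD, memvN, memvZ) // ?memvN ?memvZ ?sW.
have dimle (A B : 'End(V)) (W : {vspace V}) : (\dim ((A * B) @: W) <= \dim (B @: W))%N.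
  rewrite (_ : ((A * B) @: W)%VS = (A @: (B @: W))%VS); last exact: limg_comp.
  exact: leq_trans (leq_addl _ _) (eq_leq (limg_ker_dim A (B @: W))).
have pU s x y W : skewJ s -> stable W -> x \in W -> y \in W -> normed s x y ->
    (hm s x y x y @: W)%VS = limg (hm s x y x y).
  move=> hs sW Wx Wy ns; apply/eqP; rewrite eqEsubv limgS ?subvf //=.
  apply/subvP => z /memv_imgP[w _ ->].
  have -> : hm s x y x y w = hm s x y x y (hm s x y x y w).
    by rewrite -mulEE (hm_comp s x y x y hs ns).
  by rewrite memv_img // hmU.
have dimp s s' x y x' y' : skewJ s -> skewJ s' -> normed s x y -> normed s' x' y' ->
    (\dim (limg (hm s x y x y)) <= \dim (limg (hm s' x' y' x' y')))%N.
  move=> hs hs' ns ns'.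
  rewrite -(hm_comp s x y x y hs' ns') (leq_trans (dimle _ _ _)) //.
  by rewrite -(hm_comp s x y x' y' hs' ns') dimvS // limg_comp limgS ?subvf.
have dpp : \dim (p @: U)%VS = \dim (p' @: U')%VS.
  by rewrite pU // pU //; apply/eqP; rewrite eqn_leq !dimp.
pose U2 := (U :&: lker p)%VS; pose U2' := (U' :&: lker p')%VS.
have d2 : \dim U2 = \dim U2'.
  have := limg_ker_dim p U; have := limg_ker_dim p' U'; rewrite -/U2 -/U2' dUU' dpp; lia.
have stab2 s x y W : skewJ s -> stable W -> stable (W :&: lker (hm s x y x y))%VS.
  move=> hs sW z; rewrite !memv_cap !memv_ker => /andP[Wz /eqP hz].
  by rewrite sW // -mulEE hmJ // mulEE hz linear0 eqxx.
have nd2 s x y W : skewJ s -> stable W -> nondeg s W -> x \in W -> y \in W -> normed s x y ->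
    nondeg s (W :&: lker (hm s x y x y))%VS.
  move=> hs sW nW Wx Wy ns w; rewrite memv_cap memv_ker => /andP[Ww /eqP hw] hz.
  apply: (nW w Ww) => z Wz.
  have [q1 q2 q3 q4] := hm_pair s hs x y ns w.
  rewrite hw in q1 q2 q3 q4.
  have z0 c : fp s 0 c = 0 by rewrite /fp linear0 g0l.
  have zq c : fq s 0 c = 0 by rewrite /fq linear0 g0l.
  rewrite !(z0, zq) in q1 q2 q3 q4.
  have -> : z = (z - hm s x y x y z) + hm s x y x y z by rewrite subrK.
  rewrite fpDr fp_hmr // -q1 -q2 -q3 -q4 !mulr0 subr0 !addr0 subr0 addr0 hz //.
  rewrite memv_cap memvB ?hmU //= memv_ker linearB /= -mulEE.
  by rewrite (hm_comp s x y x y hs ns) subrr.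
have dU2 : (\dim U2 <= n)%N.
  have : (0 < \dim (p @: U))%N.
    rewrite lt0n dimv_eq0; apply: contra u0 => /eqP e.
    have : p u \in (p @: U)%VS by rewrite memv_img.
    rewrite e memv0 hmE // /hmf fp0 // fq0 // nv.1 nv.2 !scale0r scale1r.
    by rewrite !subr0 addr0.
  have := limg_ker_dim p U; rewrite -/U2; lia.
have [a2 [a2J a2U a2f]] := IH U2 U2' dU2 d2 (stab2 _ _ _ _ ht sU) (stab2 _ _ _ _ ht' sU')
  (nd2 _ _ _ _ ht sU nU Uu Uv nv) (nd2 _ _ _ _ ht' sU' nU' U'u U'v nv').
have in2 x : x \in U -> x - p x \in U2.
  move=> Ux; rewrite memv_cap memvB ?hmU //= memv_ker linearB /= -mulEE.
  by rewrite (hm_comp t u v u v ht nv) subrr.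
exists (h + a2 * (1 - p)); split.
- have hJ : h * J = J * h := hmJ ht u v u' v'.
  have pJ : p * J = J * p := hmJ ht u v u v.
  by nc (hJ, pJ, a2J).
- move=> x Ux; rewrite add_lfunE mulEE add_lfunE opp_lfunE oneEE memvD ?hmU //.
  by have := a2U _ (in2 _ Ux); rewrite memv_cap => /andP[].
move=> x y Ux Uy; rewrite !add_lfunE !mulEE !add_lfunE !opp_lfunE !oneEE.
have cross z w : z \in U2' -> fp t' z (h w) = 0.
  rewrite memv_cap memv_ker => /andP[_ /eqP hz]; rewrite fp_hmr //.
  have [q1 q2 q3 q4] := hm_pair t' ht' u' v' nv' z; rewrite hz in q1 q2 q3 q4.
  have z0 c : fp t' 0 c = 0 by rewrite /fp linear0 g0l.
  have zq c : fq t' 0 c = 0 by rewrite /fq linear0 g0l.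
  by rewrite !(z0, zq) in q1 q2 q3 q4; rewrite -q1 -q2 -q3 -q4 !mulr0 !subr0 addr0.
have cross1 z w : z \in U2 -> fp t z (p w) = 0.
  rewrite memv_cap memv_ker => /andP[_ /eqP hz]; rewrite fp_hmr //.
  have [q1 q2 q3 q4] := hm_pair t ht u v nv z; rewrite hz in q1 q2 q3 q4.
  have z0 c : fp t 0 c = 0 by rewrite /fp linear0 g0l.
  have zq c : fq t 0 c = 0 by rewrite /fq linear0 g0l.
  by rewrite !(z0, zq) in q1 q2 q3 q4; rewrite -q1 -q2 -q3 -q4 !mulr0 !subr0 addr0.
rewrite fpDl !fpDr (cross _ _ (a2U _ (in2 _ Ux))) (fpC ht' (h x) (a2 _)) (cross _ _ (a2U _ (in2 _ Uy))).
have E : fp t x y = fp t (p x) (p y) + fp t (x - p x) (y - p y).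
  transitivity (fp t ((x - p x) + p x) ((y - p y) + p y)); first by rewrite !subrK.
  move: (in2 _ Ux) (in2 _ Uy); move: (x - p x) (y - p y) => x2 y2 h1 h2.
  by rewrite fpDl !fpDr cross1 // (fpC ht (p x) y2) cross1 // oppr0 addr0 add0r addrC.
by rewrite a2f ?in2 // oppr0 addr0 add0r E /h /p !fp_hm2.
Qed.

End Symplectic.

Section ComplexBasis.
Context {R : realType} {W : vectType R} (j : 'End(W)).
Hypothesis jj : j * j = -1.
Implicit Types U : {vspace W}.

Definition clin d (p : 'Hom(cspace d, W)) := lker p == 0%VS /\ forall v, p (imul v) = j (p v).

Lemma jjx x : j (j x) = - x. Proof. by rewrite -mulEE jj opp_lfunE oneEE. Qed.

Lemma clin_stable d (p : 'Hom(cspace d, W)) x : clin p -> x \in limg p -> j x \in limg p.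
Proof. by move=> [_ h] /memv_imgP[v _ ->]; rewrite -h memv_img ?memvf. Qed.

(** The span of x and j x meets the stable subspace limg p trivially as soon as x
    lies outside it. *)
Lemma clin_ext d (p : 'Hom(cspace d, W)) x : clin p -> x \notin limg p ->
  exists p' : 'Hom(cspace d.+1, W), [/\ clin p', (limg p <= limg p')%VS, x \in limg p' &
    forall U, (forall y, y \in U -> j y \in U) -> (limg p <= U)%VS -> x \in U -> (limg p' <= U)%VS].
Proof.
move=> [p0 pJ] xp.
pose f (v : cspace d.+1) : W := v.1 0 ord0 *: x + v.2 0 ord0 *: j x +
  p ((rsubmx (v.1 : 'rV_(1 + d)), rsubmx (v.2 : 'rV_(1 + d))) : cspace d).
have fl : linear f.
  move=> a u v; rewrite /f /= !mxE !scalerDl !scalerDr !scalerA.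
  rewrite (_ : (_, _) = a *: ((rsubmx (u.1 : 'rV_(1 + d)), rsubmx (u.2 : 'rV_(1 + d))) : cspace d)
     + ((rsubmx (v.1 : 'rV_(1 + d)), rsubmx (v.2 : 'rV_(1 + d))) : cspace d)); last first.
    by rewrite -[RHS]/((_, _)); congr (_, _); apply/rowP => i; rewrite !mxE.
  by rewrite linearP; abel.
pose p' : 'Hom(cspace d.+1, W) := linfun f.
have p'E v : p' v = f v by rewrite /p' lfnE.
have emb (u : cspace d) : exists v, p' v = p u.
  exists ((row_mx 0 u.1 : 'rV_(1 + d)), (row_mx 0 u.2 : 'rV_(1 + d))).
  rewrite p'E /f /= !(row_mxKr) -(surjective_pairing u).
  have z (w : 'rV[R]_d) : (row_mx (0 : 'rV[R]_1) w : 'rV_(1 + d)) 0 ord0 = 0.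
    by rewrite (_ : ord0 = lshift d (ord0 : 'I_1)) ?row_mxEl ?mxE //; apply: val_inj.
  by rewrite !z !scale0r !add0r.
have hx : exists v, p' v = x.
  exists ((row_mx (1%:M) 0 : 'rV_(1 + d)), (0 : 'rV_(1 + d))).
  rewrite p'E /f /= row_mxKr.
  have z (w : 'rV[R]_d) : (row_mx (1%:M : 'rV[R]_1) w : 'rV_(1 + d)) 0 ord0 = 1.
    by rewrite (_ : ord0 = lshift d (ord0 : 'I_1)) ?row_mxEl ?mxE //; apply: val_inj.
  rewrite z mxE scale1r scale0r addr0 (_ : rsubmx _ = 0); last by rewrite linear0.
  by rewrite [X in p X](_ : _ = 0) ?linear0 ?addr0.
exists p'; split.
- split; last first.
    move=> v; rewrite !p'E /f /= !linearD !linearZ /= jjx -pJ /imul /= mxE.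
    rewrite (_ : rsubmx (- v.2 : 'rV_(1 + d)) = - rsubmx (v.2 : 'rV_(1 + d))); last by rewrite linearN.
    by rewrite scalerN scaleNr; abel.
  rewrite -subv0; apply/subvP => v; rewrite memv_ker memv0 p'E => /eqP fv.
  pose a := v.1 0 ord0; pose b := v.2 0 ord0.
  have xin : a *: x + b *: j x \in limg p.
    have -> : a *: x + b *: j x = - p ((rsubmx (v.1 : 'rV_(1 + d)), rsubmx (v.2 : 'rV_(1 + d))) : cspace d).
      by apply/eqP; rewrite -addr_eq0; apply/eqP; exact: fv.
    by rewrite memvN memv_img ?memvf.
  have ab : a = 0 /\ b = 0.
    suff : a ^+ 2 + b ^+ 2 == 0.
      by rewrite paddr_eq0 ?sqr_ge0 // !sqrf_eq0 => /andP[/eqP-> /eqP->].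
    apply/negPn/negP => ab0; move/negP: xp; apply.
    have h : a *: (a *: x + b *: j x) - b *: j (a *: x + b *: j x) \in limg p.
      by rewrite memvB // memvZ // (clin_stable _ xin).
    have : a *: (a *: x + b *: j x) - b *: j (a *: x + b *: j x) = (a ^+ 2 + b ^+ 2) *: x.
      rewrite [j (_ + _)]linearD /= ![j (_ *: _)]linearZ /= jjx !scalerDr !scalerN !scalerA scalerDl -!expr2 (mulrC b a).
      by abel.
    move=> e; rewrite e in h; rewrite -[x]scale1r -(mulVf ab0) -scalerA memvZ //.
  have pz : p ((rsubmx (v.1 : 'rV_(1 + d)), rsubmx (v.2 : 'rV_(1 + d))) : cspace d) = 0.
    by rewrite -fv /f -/a -/b ab.1 ab.2 !scale0r !add0r.
  have := lker0P p0 _ 0; rewrite linear0 => /(_ _ pz)[v1 v2].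
  have row0 (w : 'rV[R]_d.+1) : w 0 ord0 = 0 -> rsubmx (w : 'rV_(1 + d)) = 0 -> w = 0.
    move=> w0 wr; apply/rowP => i; rewrite mxE.
    case: (unliftP ord0 i) => [k ->|->] //; have := congr1 (fun M : 'rV_d => M 0 k) wr.
    by rewrite !mxE (_ : rshift 1 k = lift ord0 k) //; apply: val_inj.
  rewrite [v]surjective_pairing; apply/eqP; congr (_, _); apply: row0 => //.
  - exact: ab.1.
  - exact: ab.2.
- by apply/subvP => y /memv_imgP[u _ ->]; have [v <-] := emb u; rewrite memv_img ?memvf.
- by have [v <-] := hx; rewrite memv_img ?memvf.
move=> U sU pU Ux; apply/subvP => y /memv_imgP[v _ ->]; rewrite p'E /f !memvD ?memvZ ?sU //.
by apply: (subvP pU); rewrite memv_img ?memvf.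
Qed.

Lemma cbasis U : (forall y, y \in U -> j y \in U) ->
  exists d (p : 'Hom(cspace d, W)), clin p /\ limg p = U.
Proof.
move=> sU.
have main n : forall d (p : 'Hom(cspace d, W)), clin p -> (limg p <= U)%VS ->
    (\dim U <= \dim (limg p) + n)%N -> exists d (p : 'Hom(cspace d, W)), clin p /\ limg p = U.
  elim: n => [|n IH] d p cp pU dU.
    by exists d, p; split=> //; apply/eqP; rewrite eqEdim pU -(addn0 (\dim (limg p))).
  have [Up|] := boolP (U <= limg p)%VS.
    by exists d, p; split=> //; apply/eqP; rewrite eqEsubv pU.
  move/subvPn => [x Ux xp]; have [p' [cp' pp' xp' p'U]] := clin_ext cp xp.
  apply: (IH d.+1 p' cp'); first exact: p'U.
  apply: leq_trans dU _; rewrite addnS -addSn leq_add2r.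
  rewrite ltnNge; apply/negP => h; move/negP: xp; apply.
  by have /eqP -> : limg p == limg p' by rewrite eqEdim pp'.
have z (v : @cspace R 0) : v = 0.
  by rewrite [v]surjective_pairing; congr (_, _); apply/rowP => -[].
apply: (main (\dim U) 0 0).
- split; first by rewrite -subv0; apply/subvP => v _; rewrite (z v) mem0v.
  by move=> v; rewrite !zero_lfunE linear0.
- by rewrite lim0g sub0v.
- by rewrite leq_addl.
Qed.

Lemma clin_dim d (p : 'Hom(cspace d, W)) : clin p -> \dim (limg p) = d.*2.
Proof.
move=> [p0 _]; rewrite limg_dim_eq ?(eqP p0) ?capv0 // dimvf.
change (1 * d + 1 * d = d.*2)%N.
by rewrite mul1n addnn.
Qed.
End ComplexBasis.

Section Transitive.
Context {R : realType} {V : vectType R} (g : {dot V for @idfun R}) (J : 'End(V)).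
Hypotheses (JJ : J * J = -1) (Ja : adj g J = - J).
Local Notation adj := (adj g).

(** Compose complex bases of the two images, given by [cbasis]; precomposing with
    the projection p extends the isomorphism by zero. *)
Lemma jiso (p p' : 'End(V)) : p * J = J * p -> p' * J = J * p' -> p * p = p -> p' * p' = p' ->
  \dim (limg p) = \dim (limg p') ->
  exists a, [/\ a * J = J * a, p' * a = a, a * p = a & forall x, p x = x -> a x = 0 -> x = 0].
Proof.
move=> pJ p'J pp p'p' dd.
have st q : q * J = J * q -> forall y, y \in limg q -> J y \in limg q.
  by move=> qJ y /memv_imgP[z _ ->]; rewrite -mulEE -qJ mulEE memv_img ?memvf.
have [d [c [hc lc]]] := cbasis JJ (st _ pJ).
have [d' [c' [hc' lc']]] := cbasis JJ (st _ p'J).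
have : d.*2 = d'.*2 by rewrite -(clin_dim hc) -(clin_dim hc') lc lc'.
move/double_inj => E; subst d'.
have [c0 cJ] := hc; have [c'0 c'J] := hc'.
have cV x : p x = x -> c ((c^-1)%VF x) = x.
  by move=> e; rewrite limg_lfunVK // lc -e memv_img ?memvf.
have ppx x : p (p x) = p x by rewrite -mulEE pp.
exists (linfun (fun x => c' ((c^-1)%VF (p x)))).
have lin : linear (fun x => c' ((c^-1)%VF (p x))) by move=> k u v; rewrite !linearP.
have p'c v : p' (c' v) = c' v.
  have : c' v \in limg p' by rewrite -lc' memv_img ?memvf.
  by case/memv_imgP => z _ ->; rewrite -mulEE p'p'.
split.
- apply/lfunP => x; rewrite !mulEE !lfnE // -c'J; congr (c' _); apply: (lker0P c0).
  by rewrite cJ !cV // -?[p (J x)]mulEE ?pJ ?mulEE ?ppx // -[J (p x)]mulEE -pJ mulEE -mulEE mulrA pp.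
- by apply/lfunP => x; rewrite mulEE lfnE // p'c.
- by apply/lfunP => x; rewrite mulEE !lfnE // ppx.
move=> x px; rewrite lfnE // px => h; have : (c^-1)%VF x = 0 by apply: (lker0P c'0); rewrite h linear0.
by move=> e; rewrite -(cV x px) e linear0.
Qed.
End Transitive.

Section Tau.
Context {R : realType} {V : vectType R} (g : {dot V for @idfun R}) (J : 'End(V)).
Hypotheses (JJ : J * J = -1) (Ja : adj g J = - J).
Local Notation adj := (adj g).

Section OnePoint.
Variables (L e f : 'End(V)).
Hypotheses (LL : L * L = -1) (La : adj L = - L) (ks : kersplit g J L e f).
Let S := J + L.
Let T := J - L.
Let o := 1 - e - f.

(** On the complement of the two kernels, L is encoded by the complex
   two-form of tau = T S^-1; the group acts on tau by congruence. *)
Definition tau : 'End(V) := (J - L) * (J + L + (J - L) * e)^-1%VF * (1 - e - f).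

Let ee := ks_ee ks. Let ff := ks_ff ks. Let ef := ks_ef ks. Let fe := ks_fe ks.
Let ea := ks_ea ks. Let fa := ks_fa ks.
Let Se : S * e = 0 := ks_Se ks. Let eS : e * S = 0 := ks_eS ks.
Let Tf : T * f = 0 := ks_Tf ks. Let fT : f * T = 0 := ks_fT ks.
Let eT : e * T = T * e. Proof. by rewrite /T; have h1 := ks_eJ ks; have h2 := ks_eL ks; nc (h1, h2). Qed.
Let fS : f * S = S * f. Proof. by rewrite /S; have h1 := ks_fJ ks; have h2 := ks_fL ks; nc (h1, h2). Qed.

Lemma o_props : [/\ o * o = o, adj o = o, o * J = J * o, o * S = S * o & o * T = T * o].
Proof.
have eJ := ks_eJ ks; have fJ := ks_fJ ks; split.
- by rewrite /o; nc (ee, ff, ef, fe).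
- by rewrite /o !(adjD, adjN) adj_1 ea fa.
- by rewrite /o; nc (eJ, fJ).
- by rewrite /o; nc (Se, eS, fS).
- by rewrite /o; nc (eT, Tf, fT).
Qed.

Lemma o_ortho : [/\ o * e = 0, e * o = 0, o * f = 0 & f * o = 0].
Proof. by rewrite /o; split; nc (ee, ff, ef, fe). Qed.

Lemma limg_proj_ker (p A : 'End(V)) : A * p = 0 -> (forall x, A x = 0 -> p x = x) -> limg p = lker A.
Proof.
move=> Ap h; apply/eqP; rewrite eqEsubv; apply/andP; split; apply/subvP => x.
  by case/memv_imgP => y _ ->; rewrite memv_ker -mulEE Ap zero_lfunE.
by rewrite memv_ker => /eqP/h <-; rewrite memv_img ?memvf.
Qed.

Lemma limg_e : limg e = lker S. Proof. exact: limg_proj_ker Se (ks_ek ks). Qed.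
Lemma limg_f : limg f = lker T. Proof. exact: limg_proj_ker Tf (ks_fk ks). Qed.

Lemma dim_o : (\dim (lker S) + \dim (lker T) + \dim (limg o) = \dim {:V})%N.
Proof.
have [oo oa oJ oS oT] := o_props; have [oe eo of0 fo] := o_ortho.
rewrite -limg_e -limg_f -(limg_ker_dim o fullv) capfv; congr addn.
rewrite -dimv_disjoint_sum; last first.
  apply/eqP; rewrite -subv0; apply/subvP => x; rewrite memv_cap memv0.
  case/andP => /memv_imgP[y _ ->] /memv_imgP[z _ E].
  by rewrite -ee mulEE E -mulEE ef zero_lfunE.
congr (\dim _); apply/eqP; rewrite eqEsubv; apply/andP; split.
  rewrite subv_add; apply/andP; split; apply/subvP => x /memv_imgP[y _ ->].
    by rewrite memv_ker -mulEE oe zero_lfunE.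
  by rewrite memv_ker -mulEE of0 zero_lfunE.
apply/subvP => x; rewrite memv_ker => /eqP h.
have -> : x = e x + f x.
  have : x = (e + f + o) x by rewrite (_ : e + f + o = 1) ?oneEE // /o; nc.
  by rewrite 2!add_lfunE h addr0.
by rewrite memv_add ?memv_img ?memvf.
Qed.

Lemma tau_props : [/\ skewJ g J tau, tau * S * o = T * o, S * tau = - (T * o), o * tau = tau &
  nondeg g tau (limg o)].
Proof.
have [oo oa oJ oS oT] := o_props; have [oe eo of0 fo] := o_ortho.
have Sa : adj S = - S by rewrite /S adjD Ja La opprD.
have Ta : adj T = - T by rewrite /T adjD adjN Ja La opprD.
have TS : T * S = - (S * T) by rewrite /S /T; nc (JJ, LL).
have SL : S * L = J * S by rewrite /S; nc (JJ, LL).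
have SJ : S * J = L * S by rewrite /S; nc (JJ, LL).
have TL : T * L = - (J * T) by rewrite /T; nc (JJ, LL).
have oL : o * L = L * o by rewrite /o; have q1 := ks_eL ks; have q2 := ks_fL ks; nc (q1, q2).
have D0 := ST_inv JJ ks; have h1 := lker0_mulV D0; have h2 := lker0_Vmul D0.
rewrite -/S -/T in D0 h1 h2; rewrite /tau -/S -/T -/o.
have Do : (S + T * e) * o = S * o by move: o eo => o' eo; nc (eo).
have oD : o * (S + T * e) = (S + T * e) * o.
  rewrite Do mulrDr oS (mulrA o) oT; have -> : T * o * e = T * (o * e) by nc.
  by rewrite oe mulr0 addr0.
have Da : adj (S + T * e) = - (S + T * e).
  by rewrite adjD adjM Sa Ta ea; nc (eT).
have aD : adj ((S + T * e)^-1%VF) * - (S + T * e) = 1 by rewrite -Da -adjM h1 adj_1.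
move: (S + T * e) D0 h1 h2 Do oD aD {Da} => D D0; move: (D^-1)%VF => Di h1 h2 Do oD aD.
have aDi : adj Di = - Di.
  by rewrite -[LHS]mulr1 -h1 -[D]opprK mulNr mulrN mulrA aD mul1r.
have oDi : o * Di = Di * o.
  have -> : o * Di = Di * (D * o) * Di by nc (h2).
  by rewrite -oD; nc (h1).
have SoDi : S * o * Di = o.
  rewrite -Do; have -> : D * o * Di = D * (o * Di) by nc.
  by rewrite oDi; nc (h1).
have DSo : Di * S * o = o.
  have -> : Di * S * o = Di * (S * o) by nc.
  by rewrite -Do; nc (h2).
move: o oo oa oJ oL oS oT oe eo of0 fo Do oD oDi SoDi DSo => o' oo oa oJ oL oS oT oe eo of0 fo Do oD oDi SoDi DSo.
have eq1 : Di * T * o' = - (T * Di * o').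
  have -> : Di * T * o' = Di * (T * (S * o' * Di)) by rewrite SoDi; nc.
  have -> : Di * (T * (S * o' * Di)) = - (Di * S * o' * (T * Di)) by nc (TS, oT).
  by rewrite DSo; nc (oT, oDi).
have LDo : L * Di * o' = Di * J * o'.
  have -> : L * Di * o' = (Di * S * o') * L * Di.
    by rewrite DSo; nc (oL, oDi).
  have -> : Di * S * o' * L * Di = Di * (S * L) * o' * Di by nc (oL).
  rewrite SL; have -> : Di * (J * S) * o' * Di = Di * J * (S * o' * Di) by nc.
  by rewrite SoDi.
split.
- split.
    rewrite !adjM oa aDi Ta; have -> : o' * (- Di * - T) = Di * T * o' by nc (oDi, oT).
    exact: eq1.
  have -> : T * Di * o' * J = T * (Di * J * o') by nc (oJ).
  by rewrite -LDo; nc (TL).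
- by have -> : T * Di * o' * S * o' = T * (Di * S * o') by [nc (oS, oo)]; rewrite DSo.
- have -> : S * (T * Di * o') = - (T * (S * o' * Di)) by nc (TS, oDi).
  by rewrite SoDi.
- by nc (oT, oDi, oo).
move=> x /memv_imgP[z _ ->] h.
have tz : (T * Di * o') (o' z) = 0.
  apply: (g_eq0 (g := g)); apply: h; apply/memv_imgP; exists ((T * Di * o') (o' z)); first exact: memvf.
  by rewrite -!mulEE; congr (fun_of_lfun _ _); nc (oT, oDi, oo).
have fDz : f (Di (o' z)) = Di (o' z).
  by apply: (ks_fk ks); rewrite -/T -mulEE -[RHS]tz -!mulEE; congr (fun_of_lfun _ _); nc (oo).
have : (o' * f) (Di (o' z)) = 0 by rewrite of0 zero_lfunE.
rewrite mulEE fDz -!mulEE; have -> : o' * Di * o' = Di * o' by nc (oDi, oo).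
by move=> h'; apply: (lker0P (lker0_mul h1)); rewrite linear0 -mulEE.
Qed.
End OnePoint.

(** Match Ker S with Ker S', Ker T with Ker T' by any complex isomorphisms, and the
    remaining parts by an isomorphism of the forms tau and tau'. The criterion
    [act_eq] then holds block by block. *)
Lemma act_transitive L L' : L * L = -1 -> adj L = - L -> L' * L' = -1 -> adj L' = - L' ->
  \dim (lker (J + L)) = \dim (lker (J + L')) -> \dim (lker (J - L)) = \dim (lker (J - L')) ->
  exists2 a, GLJ J a & act g J a L = L'.
Proof.
move=> LL La LL' La' d1 d2.
have [e [f ks]] := kersplit_ex JJ Ja LL La.
have [e' [f' ks']] := kersplit_ex JJ Ja LL' La'.
pose o := 1 - e - f; pose o' := 1 - e' - f'.
have [oo oa oJ oS oT] := o_props ks; have [oe eo of0 fo] := o_ortho ks.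
have [oo' oa' oJ' oS' oT'] := o_props ks'; have [oe' eo' of0' fo'] := o_ortho ks'.
rewrite -/o in oo oa oJ oS oT oe eo of0 fo; rewrite -/o' in oo' oa' oJ' oS' oT' oe' eo' of0' fo'.
have [aE [aEJ e'aE aEe aEi]] := jiso JJ (ks_eJ ks) (ks_eJ ks') (ks_ee ks) (ks_ee ks')
  (etrans (congr1 _ (limg_e ks)) (etrans d1 (esym (congr1 _ (limg_e ks'))))).
have [aF [aFJ f'aF aFf aFi]] := jiso JJ (ks_fJ ks) (ks_fJ ks') (ks_ff ks) (ks_ff ks')
  (etrans (congr1 _ (limg_f ks)) (etrans d2 (esym (congr1 _ (limg_f ks'))))).
have [st1 st2 st3 st4 st5] := tau_props LL La ks.
have [st1' st2' st3' st4' st5'] := tau_props LL' La' ks'.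
set t := tau L e f in st1 st2 st3 st4 st5.
set t' := tau L' e' f' in st1' st2' st3' st4' st5'.
rewrite -/o in st2 st3 st4 st5; rewrite -/o' in st2' st3' st4' st5'.
have dO : \dim (limg o) = \dim (limg o').
  by have := dim_o ks; rewrite -(dim_o ks') -/o -/o' d1 d2 => /addnI.
have stb p : p * J = J * p -> stable J (limg p).
  by move=> pJ x /memv_imgP[y _ ->]; rewrite -mulEE -pJ mulEE memv_img ?memvf.
have [a0 [a0J a0U a0f]] := symp_iso JJ Ja st1 st1' (leqnn _) dO (stb _ oJ) (stb _ oJ') st5 st5'.
pose b0 := a0 * o; pose a := b0 + aE + aF.
have b0o : b0 * o = b0 by rewrite /b0 -mulrA oo.
have o'b0 : o' * b0 = b0.
  apply/lfunP => x; rewrite /b0 !mulEE.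
  have /memv_imgP[z _ ->] := a0U (o x) (memv_img _ (memvf x)).
  by rewrite -mulEE oo'.
have b0f x y : g (t' (b0 x)) (b0 y) = g (t (o x)) (o y).
  by rewrite /b0 !(mulEE a0 o); apply: a0f; rewrite memv_img ?memvf.
have e'b0 : e' * b0 = 0 by rewrite -o'b0 mulrA eo' mul0r.
have f'b0 : f' * b0 = 0 by rewrite -o'b0 mulrA fo' mul0r.
have e'aF : e' * aF = 0 by rewrite -f'aF mulrA (ks_ef ks') mul0r.
have f'aE : f' * aE = 0 by rewrite -e'aE mulrA (ks_fe ks') mul0r.
have aJ : a * J = J * a by rewrite /a /b0; nc (aEJ, aFJ, a0J, oJ).
have e'a : e' * a = aE by rewrite /a !mulrDr e'b0 e'aE e'aF addr0 add0r.
have f'a : f' * a = aF by rewrite /a !mulrDr f'b0 f'aE f'aF !add0r.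
have o'a : o' * a = b0 by rewrite /o' !mulrBl mul1r e'a f'a /a; nc.
have ae : a * e = aE.
  rewrite /a !mulrDl aEe -b0o -(mulrA b0) oe mulr0 add0r -aFf -(mulrA aF) (ks_fe ks) mulr0 addr0 //.
have a_inv : lker a == 0%VS.
  rewrite -subv0; apply/subvP => x; rewrite memv_ker memv0 => /eqP ax.
  have ex : e x = 0.
    apply: aEi; first by rewrite -mulEE (ks_ee ks).
    by rewrite -mulEE aEe -e'a mulEE ax linear0.
  have fx : f x = 0.
    apply: aFi; first by rewrite -mulEE (ks_ff ks).
    by rewrite -mulEE aFf -f'a mulEE ax linear0.
  have bx : b0 x = 0 by rewrite -o'a mulEE ax linear0.
  have ox : o x = 0.
    apply: st5; first by rewrite memv_img ?memvf.
    move=> y /memv_imgP[z _ ->]; rewrite /fp -b0f bx !linear0.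
    exact: g0l.
  have : x = (e + f + o) x by rewrite (_ : e + f + o = 1) ?oneEE // /o; nc.
  by rewrite 2!add_lfunE ex fx ox !addr0 => ->.
have ha : GLJ J a by split.
exists a => //; apply: (act_eq JJ Ja LL La ha LL').
have [h1 h2 h3 h4 [h5 h6 h7]] := GLJ_inv Ja ha.
set S := J + L in oS st2 st3 *; set T := J - L in oT st2 st3 *.
set S' := J + L' in oS' st2' st3' *; set T' := J - L' in oT' st2' st3' *.
move: (adj (a^-1)%VF) h3 h4 h7 => b h3 h4 h7.
have be : b * e = e' * b.
  have e'a' : e' * a = a * e by rewrite e'a ae.
  have := congr1 adj e'a'; rewrite !adjM (ks_ea ks) (ks_ea ks') => E.
  have -> : b * e = b * (e * adj a) * b by nc (h3).
  by rewrite -E; nc (h4).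
(* Z will turn out to be b T o, here expressed through the form tau'. *)
pose Z := t' * b0 * S * o.
have aZ : adj a * Z = T * o.
  apply/lfunP => x; apply: (g_ext (g := g)) => y.
  rewrite [(adj a * Z) x]mulEE -adjP.
  have zo' : o' * Z = Z.
    by rewrite /Z; have -> : o' * (t' * b0 * S * o) = o' * t' * b0 * S * o by [nc]; rewrite st4'.
  have zo : Z x = o' (Z x) by rewrite -mulEE zo'.
  rewrite zo adjP' oa' -mulEE o'a gC.
  have -> : Z x = t' (b0 (S (o x))) by rewrite /Z !mulEE.
  rewrite b0f -!mulEE adjP' oa -mulEE gC; congr (g y (_ x)).
  have -> : o * (t * o * S * o) = (o * t) * (o * S) * o by nc.
  by rewrite st4 oS; have -> : t * (S * o) * o = t * S * (o * o) by [nc]; rewrite oo st2.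
have -> : T' * a * S = T' * b0 * S.
  rewrite /a; have -> : T' * (b0 + aE + aF) * S = T' * b0 * S + T' * aE * S + T' * aF * S by nc.
  have -> : T' * aF = 0 by rewrite -f'aF mulrA (ks_Tf ks') mul0r.
  have -> : T' * aE * S = 0 by rewrite -aEe -!mulrA (ks_eS ks) !mulr0.
  by rewrite mul0r !addr0.
have eT : e * T = T * e by rewrite /T; have q1 := ks_eJ ks; have q2 := ks_eL ks; nc (q1, q2).
have -> : S' * b * T = S' * Z.
  have -> : Z = b * (T * o) by rewrite -aZ mulrA h4 mul1r.
  have -> : S' * (b * (T * o)) = S' * b * T - S' * b * (T * e) - S' * b * (T * f) by rewrite /o; nc.
  rewrite (ks_Tf ks) -eT mulr0 subr0; have -> : S' * b * (e * T) = S' * (b * e) * T by nc.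
  rewrite be; have -> : S' * (e' * b) * T = (S' * e') * b * T by nc.
  by rewrite (ks_Se ks') !mul0r subr0.
have -> : S' * Z = S' * t' * b0 * S * o by rewrite /Z; nc.
rewrite st3' -b0o; have -> : - (T' * o') * (b0 * o) * S * o = - (T' * (o' * b0) * ((o * S) * o)) by nc.
rewrite o'b0 oS; have -> : T' * (b0 * o) * S = T' * b0 * (o * S) by nc.
by rewrite oS -(mulrA S) oo; nc.
Qed.
End Tau.

(** * Paths of complex linear maps *)
Section GLPath.
Context {R : realType} {V : vectType R} (J : 'End(V)).
Hypothesis JJ : J * J = -1.
Implicit Types (a P : 'End(V)) (v : V).

Lemma complex_scale_inj (x y : R) v : (x, y) != (0, 0) -> x *: v + y *: J v = 0 -> v = 0.
Proof.
move=> xy0 h; have c0 : x ^+ 2 + y ^+ 2 != 0.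
  apply: contra xy0; rewrite paddr_eq0 ?sqr_ge0 // !sqrf_eq0.
  by move=> /andP[/eqP-> /eqP->].
apply/eqP; have : (x ^+ 2 + y ^+ 2) *: v = 0.
  have <- : x *: (x *: v + y *: J v) - y *: J (x *: v + y *: J v) = (x ^+ 2 + y ^+ 2) *: v.
    rewrite [J (_ + _)]linearD /= ![J (_ *: _)]linearZ /= -[J (J v)]mulEE JJ opp_lfunE oneEE.
    rewrite !scalerDr !scalerN !scalerA scalerDl -!expr2 (mulrC y x); abel.
  by rewrite h !(linear0, scaler0) ?subrr ?oppr0 ?addr0.
by move/eqP; rewrite scaler_eq0 (negPf c0).
Qed.

(** A complex linear map has finitely many complex eigenvalues: each factor
    a - x - yJ of the product P enlarges its kernel by one dimension. *)
Lemma finite_eigen a (x y : nat -> R) (v : nat -> V) : a * J = J * a ->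
  (forall i, v i != 0) -> (forall i, a (v i) = x i *: v i + y i *: J (v i)) ->
  (forall i j, (x i, y i) = (x j, y j) -> i = j) -> False.
Proof.
move=> aJ v0 av inj.
have main m : exists P, [/\ P * J = J * P, P * a = a * P, (m <= \dim (lker P))%N &
    forall i, (m <= i)%N -> P (v i) != 0].
  elim: m => [|m [P [PJ Pa dP Pv]]].
    by exists 1; split; rewrite ?mul1r ?mulr1 // => i _; rewrite oneEE.
  pose N := a - x m *: (1 : 'End(V)) - y m *: J.
  have NJ : N * J = J * N.
    rewrite /N !mulrBl !mulrBr aJ -!scaleEl -!scaleEr mul1r mulr1 //.
  have Na : N * a = a * N.
    by rewrite /N !mulrBl !mulrBr -!scaleEl -!scaleEr mul1r mulr1 aJ.
  have PN : P * N = N * P.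
    by rewrite /N !mulrBl !mulrBr -!scaleEl -!scaleEr mul1r mulr1 Pa PJ.
  have Nv i : N (v i) = (x i - x m) *: v i + (y i - y m) *: J (v i).
    rewrite /N !add_lfunE !opp_lfunE !scale_lfunE oneEE av !scalerBl; abel.
  exists (P * N); split.
  - by rewrite -mulrA NJ mulrA PJ mulrA.
  - by rewrite -mulrA Na mulrA Pa mulrA.
  - apply: leq_ltn_trans dP _; rewrite ltnNge; apply/negP => h.
    have sub : (lker P <= lker (P * N))%VS.
      apply/subvP => z; rewrite !memv_ker => /eqP Pz.
      by rewrite PN mulEE Pz linear0.
    have /eqP E : lker P == lker (P * N) by rewrite eqEdim sub.
    have : v m \in lker (P * N) by rewrite memv_ker mulEE Nv !subrr !scale0r addr0 linear0.
    by rewrite -E memv_ker (negPf (Pv m _)).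
  move=> i mi; rewrite mulEE Nv linearD !linearZ /= -mulEE PJ mulEE.
  apply: contraTneq (Pv i (ltnW mi)) => h; rewrite negbK; apply/eqP.
  apply: complex_scale_inj h; apply/negP => /eqP[/eqP + /eqP].
  rewrite !subr_eq0 => /eqP e1 /eqP e2.
  by have := inj i m; rewrite e1 e2 => /(_ erefl) E; rewrite E ltnn in mi.
have [P [_ _ dP _]] := main (\dim {:V}).+1.
by have := leq_trans dP (dimvS (subvf (lker P))); rewrite ltnn.
Qed.

(** A path from 1 to a through complex linear maps; the bump in the direction J
    serves to avoid the singular ones. *)
Definition gpath a (k t : R) : 'End(V) := (1 - t) *: (1 : 'End(V)) + t *: a + (t * (1 - t) * k) *: J.

(** If the path with parameter k is singular at t, then a has the eigenvalue
    - (1 - t)/t - i (1 - t) k, which has negative real part and determines k.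
    Distinct integers k would thus give infinitely many eigenvalues. *)
Lemma gpath_ex a : a * J = J * a -> lker a == 0%VS ->
  exists k, forall t, 0 <= t <= 1 -> lker (gpath a k t) == 0%VS.
Proof.
move=> aJ a0; apply: contrapT => h.
have h' : forall i : nat, exists q : R * R * V, [/\ q.2 != 0,
    a q.2 = q.1.1 *: q.2 + q.1.2 *: J q.2, q.1.1 < 0 & q.1.2 * (1 - q.1.1) = q.1.1 * i%:R].
  move=> i; apply: contrapT => hi; apply: h; exists i%:R => t t01.
  apply/negPn/negP => hl; apply: hi.
  pose v := vpick (lker (gpath a i%:R t)).
  have v0 : v != 0 by rewrite vpick0.
  have vker : gpath a i%:R t v = 0.
    by apply/eqP; rewrite -memv_ker; apply: memv_pick.
  have t0 : t != 0.
    apply: contraNneq hl => ->; rewrite /gpath !mul0r !scale0r !addr0 subr0 scale1r.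
    by apply: (@lker0_mul _ _ 1); rewrite mulr1.
  have t1 : t != 1.
    apply: contraNneq hl => ->; rewrite /gpath subrr mulr0 mul0r !scale0r scale1r addr0 add0r.
    exact: a0.
  have tp : 0 < t by rewrite lt0r t0; case/andP: t01.
  have t1' : 0 < 1 - t by rewrite subr_gt0 lt_neqAle t1; case/andP: t01.
  exists (- ((1 - t) / t), - ((1 - t) * i%:R), v); split=> //=.
  - move: vker; rewrite /gpath !add_lfunE !scale_lfunE oneEE => E.
    apply: (scalerI t0); have -> : t *: a v = - ((1 - t) *: v) - (t * (1 - t) * i%:R) *: J v.
      apply/eqP; rewrite -subr_eq0 -E; apply/eqP; abel.
    rewrite -[- (_ *: v)]scaleNr -[- (_ *: J v)]scaleNr [RHS]scalerDr !scalerA.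
    have -> : t * - ((1 - t) / t) = - (1 - t) by field.
    by have -> : t * - ((1 - t) * i%:R) = - (t * (1 - t) * i%:R) by ring.
  - by rewrite oppr_lt0 divr_gt0.
  - by field.
have /choice[q hq] := h'.
apply: (@finite_eigen a (fun i => (q i).1.1) (fun i => (q i).1.2) (fun i => (q i).2)) => //.
- by move=> i; case: (hq i).
- by move=> i; case: (hq i).
move=> i j [e1 e2]; have [_ _ n1 E1] := hq i; have [_ _ n2 E2] := hq j.
move: E1; rewrite e1 e2 E2 => /mulfI E; apply/eqP; rewrite -(eqr_nat R).
by apply/eqP/esym/E; rewrite lt_eqF.
Qed.

Lemma gpath_J a k t : a * J = J * a -> gpath a k t * J = J * gpath a k t.
Proof. by move=> aJ; rewrite /gpath !mulrDl !mulrDr -!scaleEl -!scaleEr mul1r mulr1 aJ. Qed.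

Lemma gpath0 a k : gpath a k 0 = 1.
Proof. by rewrite /gpath !mul0r !scale0r !addr0 subr0 scale1r. Qed.
Lemma gpath1 a k : gpath a k 1 = a.
Proof. by rewrite /gpath subrr mulr0 mul0r !scale0r scale1r addr0 add0r. Qed.

End GLPath.

(** * Directional derivatives and maps defined on the twistor space *)

Section Directional.
Context {R : realType}.
Implicit Types W F G H : vectType R.

(** Carrying differentiability together with the value of the derivative makes
    the rules below compose without side conditions. *)
Definition isd W F (f : W -> F) (x v : W) (y : F) :=
  exists2 D : 'Hom(W, F), hasd f x D & D v = y.

Lemma isd_unique W F (f : W -> F) x v y z : isd f x v y -> isd f x v z -> y = z.
Proof. by move=> [D h <-] [D' h' <-]; rewrite (hasd_unique h h'). Qed.

Lemma isd_vderive W F (f : W -> F) x v y : isd f x v y -> vderive f x v = y.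
Proof. by move=> [D h <-]; rewrite (hasd_vderive h). Qed.

Lemma Sm_isd W F r (U : set W) (f : W -> F) x v : Sm r.+1 U f -> U x ->
  isd f x v (vderive f x v).
Proof. by move=> hf Ux; have h := Sm_hasd hf Ux; exists (dif f x) => //; rewrite (hasd_vderive h). Qed.

Lemma isd_ext W F (f h : W -> F) x v y : (\forall z \near vnb x, f z = h z) ->
  isd f x v y -> isd h x v y.
Proof. by move=> e [D hD Dv]; exists D => //; exact: hasd_ext e hD. Qed.

Lemma isd_cst W F (c : F) (x v : W) : isd (fun=> c) x v 0.
Proof. by exists 0; [exact: hasd_cst | rewrite zero_lfunE]. Qed.

Lemma isd_lin W F (L : 'Hom(W, F)) (x v : W) : isd L x v (L v).
Proof. by exists L => //; exact: hasd_lin. Qed.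

Lemma isd_id W (x v : W) : isd id x v v.
Proof.
have h := hasd_lin (\1%VF : 'Hom(W, W)) x.
have e : (\1%VF : 'Hom(W, W)) = id :> (W -> W) by apply/funext => z; rewrite id_lfunE.
by exists \1%VF; [rewrite -{1}e | rewrite id_lfunE].
Qed.

Lemma isdD W F (f h : W -> F) x v y z : isd f x v y -> isd h x v z ->
  isd (fun u => f u + h u) x v (y + z).
Proof. by move=> [D hD <-] [D' hD' <-]; exists (D + D'); [exact: hasdD | rewrite add_lfunE]. Qed.

Lemma isd_bilin W F G H (b : F -> H -> G) (f : W -> F) (h : W -> H) x v y z : bilin b ->
  isd f x v y -> isd h x v z -> isd (fun u => b (f u) (h u)) x v (b y (h x) + b (f x) z).
Proof.
move=> hb [D hD <-] [D' hD' <-]; have [h1 h2] := hb.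
by eexists; [exact: hasd_bilin hb hD hD' | rewrite add_lfunE !precompE].
Qed.

Lemma isd_linl W F G (L : 'Hom(F, G)) (f : W -> F) x v y : isd f x v y ->
  isd (fun u => L (f u)) x v (L y).
Proof.
move=> [D hD <-]; exists (L \o D)%VF; last by rewrite comp_lfunE.
exact: (hasd_comp hD (hasd_lin L _)).
Qed.

Lemma isdN W F (f : W -> F) x v y : isd f x v y -> isd (fun u => - f u) x v (- y).
Proof.
move=> h; have := isd_linl (- \1%VF : 'Hom(F, F)) h.
rewrite opp_lfunE id_lfunE; congr isd.
by apply/funext => z; rewrite opp_lfunE id_lfunE.
Qed.

Lemma isdB W F (f h : W -> F) x v y z : isd f x v y -> isd h x v z ->
  isd (fun u => f u - h u) x v (y - z).
Proof. by move=> hf hh; apply: isdD => //; apply: isdN. Qed.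

Lemma isd_mul W (V : vectType R) (f h : W -> 'End(V)) x v y z :
  isd f x v y -> isd h x v z -> isd (fun u => f u * h u) x v (y * h x + f x * z).
Proof. exact: (isd_bilin (mul_bilin V)). Qed.

Lemma isd_inv W (V : vectType R) (f : W -> 'End(V)) x v y : lker (f x) == 0%VS ->
  isd f x v y -> isd (fun u => (f u)^-1%VF) x v (- ((f x)^-1%VF * y * (f x)^-1%VF)).
Proof.
move=> f0 [D hD <-]; have [_ h] := hasd_inv f0; eexists; first exact: hasd_comp hD h.
rewrite comp_lfunE lfnE // => a u w.
by rewrite mulrDr mulrDl opprD -scaleEr -scaleEl scalerN.
Qed.

Lemma isd_comp W F G (f : W -> F) (h : F -> G) x v y z : isd f x v y -> isd h (f x) y z ->
  isd (h \o f) x v z.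
Proof.
move=> [D hD <-] [D' hD' <-]; exists (D' \o D)%VF; last by rewrite comp_lfunE.
exact: hasd_comp.
Qed.

Lemma isd_cont W F (f : W -> F) x v y : isd f x v y -> vcont f x.
Proof. by case=> D /hasd_cont. Qed.

Lemma isd_scale W F (f : W -> R^o) (h : W -> F) x v (y : R^o) z :
  isd f x v y -> isd h x v z ->
  isd (fun u => (f u : R) *: h u) x v ((y : R) *: h x + (f x : R) *: z).
Proof.
apply: (isd_bilin (b := fun (a : R^o) u => (a : R) *: u)); split=> [a|w] k u u' /=.
  by rewrite scalerDr !scalerA mulrC.
by rewrite scalerDl -scalerA.
Qed.

Definition dif_linear W F (f : W -> F) x (D : 'Hom(W, F)) (h : hasd f x D) : linear (vderive f x).
Proof. by rewrite (hasd_vderive h); move=> a u v; rewrite linearP. Qed.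
End Directional.

Section TwistorMaps.
Context {R : realType} {V : vectType R} (g : {dot V for @idfun R}).
Local Notation adj := (adj g).
Local Notation TW := (twistor g).
Implicit Types (p q : TW).

Lemma twP p : \val p * \val p = -1 /\ adj (\val p) = - \val p.
Proof. by apply/twistorP; have := set_valP p. Qed.

(** The Cayley transform turns the line of multiples of LX/2 into a curve in the
    twistor space. *)
Lemma tangent_curve (L X : 'End(V)) : twistor g L -> twistor_tangent g L X ->
  exists c : R^o -> 'End(V), [/\ c 0 = L, forall t, twistor g (c t) & isd c 0 (1 : R^o) X].
Proof.
move=> /twistorP[LL La] /tangentP[Xa XL].
pose A := 2^-1 *: (L * X).
have A2 : A *+ 2 = L * X by rewrite -scaler_nat scalerA mulfV ?pnatr_eq0 // scale1r.
have AS : skanti g L A.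
  split; apply: dbl_inj.
    have -> : adj A *+ 2 = adj (A *+ 2) by rewrite !mulr2n adjD.
    by rewrite mulNrn A2 adjM Xa La; nc (XL).
  by rewrite -mulrnAl mulNrn -mulrnAr A2; nc (XL).
have AtS (t : R) : skanti g L (t *: A).
  case: AS => a1 a2; split.
    by rewrite adjZ a1 scalerN.
  by rewrite -scaleEl a2 scalerN scaleEr.
exists (fun t : R^o => cay L ((t : R) *: A)); split.
- rewrite scale0r; symmetry; apply/(cay_char (g := g)); last by rewrite addr0 subr0.
  by have := AtS 0; rewrite scale0r.
- by move=> t; apply/twistorP; apply: cay_twistor.
pose i0 : lker (1 + (0 : R) *: A) == 0%VS := skew_inv (AtS 0).1.
have d1 : isd (fun t : R^o => (t : R) *: A) 0 (1 : R^o) A.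
  by have := isd_scale (isd_id (0 : R^o) (1 : R^o)) (isd_cst A (0 : R^o) (1 : R^o)); rewrite scaler0 addr0 scale1r.
have d2 := isd_mul (isd_cst L (0 : R^o) (1 : R^o)) (isdB (isd_cst (1 : 'End(V)) (0 : R^o) (1 : R^o)) d1).
have d3 := isd_mul d2 (@isd_inv _ _ _ (fun t : R^o => 1 + (t : R) *: A) 0 1 _ i0
  (isdD (isd_cst (1 : 'End(V)) (0 : R^o) (1 : R^o)) d1)).
have I1 : (1 : 'End(V))^-1%VF = 1 by rewrite -(@mul1_inv _ _ 1 1) ?mulr1.
move: d3; rewrite scale0r addr0 subr0 I1.
rewrite [Y in isd _ _ _ Y -> _](_ : _ = X) //.
transitivity (- (L * (A *+ 2))); first by nc.
by rewrite A2; nc (LL).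
Qed.

(** Two extensions agree along a curve in the twistor space with velocity X. *)
Lemma ext_unique (F : vectType R) (f : TW -> F) p G G' X : twistor_tangent g (\val p) X ->
  local_extension f p G -> local_extension f p G' -> vderive G (\val p) X = vderive G' (\val p) X.
Proof.
move=> hX [U [Uo Up GU hG]] [U' [U'o U'p GU' hG']].
have [c [c0 ct dc]] := tangent_curve (set_valP p) hX.
have d1 := Sm_isd X ((vsmoothP _ Uo).1 GU 1%N) Up.
have d2 := Sm_isd X ((vsmoothP _ U'o).1 GU' 1%N) U'p.
rewrite -c0 in d1 d2; have e1 := isd_comp dc d1; have e2 := isd_comp dc d2.
rewrite -c0; apply: (isd_unique _ e2); apply: isd_ext e1.
have n1 := isd_cont dc ((vopenP _).1 Uo (c 0) _); rewrite c0 in n1.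
have n2 := isd_cont dc ((vopenP _).1 U'o (c 0) _); rewrite c0 in n2.
apply: filterS2 (n1 Up) (n2 U'p) => t /= u1 u2.
pose q : TW := exist _ (c t) (mem_set (ct t)).
by rewrite (hG q u1) (hG' q u2).
Qed.

Lemma dmapE (F : vectType R) (f : TW -> F) p G X : twistor_tangent g (\val p) X ->
  local_extension f p G -> dmap f p X = vderive G (\val p) X.
Proof.
move=> hX hG; rewrite /dmap; case: xgetP => [y _ [G' hG' ->]|h]; first exact: ext_unique hX hG' hG.
by have := h (vderive G (\val p) X); case; exists G.
Qed.
End TwistorMaps.

(** * The skew algebroid *)

Section Algebroid.
Context {R : realType} {V : vectType R} (g : {dot V for @idfun R}).
Local Notation adj := (adj g).
Local Notation TW := (twistor g).
Local Notation E := 'End(V).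
Implicit Types (p q : TW).

(** A relational form of [dmap]: stating derivatives of maps on the twistor space
    through a witnessing extension lets sum, product and chain rules be composed
    before uniqueness of the derivative is invoked once, in [dsm_dmap]. *)
Definition dsm (F : vectType R) (f : TW -> F) p (v : E) (y : F) :=
  exists G, local_extension f p G /\ isd G (\val p) v y.

Lemma local_isd (F : vectType R) (f : TW -> F) p v G : local_extension f p G ->
  isd G (\val p) v (vderive G (\val p) v).
Proof. by move=> [U [Uo Up GU hG]]; exact: Sm_isd v ((vsmoothP _ Uo).1 GU 1%N) Up. Qed.

Lemma dsm_dmap (F : vectType R) (f : TW -> F) p v y : twistor_tangent g (\val p) v ->
  dsm f p v y -> dmap f p v = y.
Proof.
by move=> hv [G [hG dG]]; rewrite (dmapE hv hG); exact: isd_vderive.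
Qed.

Lemma smooth_dsm (F : vectType R) (f : TW -> F) p v : twistor_tangent g (\val p) v ->
  smooth_map f -> dsm f p v (dmap f p v).
Proof.
move=> hv /(_ p)[G hG]; exists G; split=> //.
by rewrite (dmapE hv hG); exact: local_isd hG.
Qed.

Lemma ext_bilin (F G H : vectType R) (b : F -> H -> G) (A : TW -> F) (B : TW -> H) p GA GB :
  bilin b -> local_extension A p GA -> local_extension B p GB ->
  local_extension (fun q => b (A q) (B q)) p (fun x => b (GA x) (GB x)).
Proof.
move=> hb [U [Uo Up GU hG]] [U' [U'o U'p GU' hG']]; exists (U `&` U'); split.
- exact: vopenI.
- by [].
- apply/(vsmoothP _ (vopenI Uo U'o)) => r; apply: Sm_bilin => //.
    by apply: Sm_sub ((vsmoothP _ Uo).1 GU r) => x [].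
  by apply: Sm_sub ((vsmoothP _ U'o).1 GU' r) => x [].
by move=> q [u u']; rewrite hG ?hG'.
Qed.

Lemma ext_add (F : vectType R) (A B : TW -> F) p GA GB :
  local_extension A p GA -> local_extension B p GB ->
  local_extension (fun q => A q + B q) p (fun x => GA x + GB x).
Proof.
move=> [U [Uo Up GU hG]] [U' [U'o U'p GU' hG']]; exists (U `&` U'); split.
- exact: vopenI.
- by [].
- apply/(vsmoothP _ (vopenI Uo U'o)) => r; apply: SmD => //.
    by apply: Sm_sub ((vsmoothP _ Uo).1 GU r) => x [].
  by apply: Sm_sub ((vsmoothP _ U'o).1 GU' r) => x [].
by move=> q [u u']; rewrite hG ?hG'.
Qed.

Lemma ext_lin (F G : vectType R) (L : 'Hom(F, G)) (A : TW -> F) p GA :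
  local_extension A p GA -> local_extension (fun q => L (A q)) p (fun x => L (GA x)).
Proof.
move=> [U [Uo Up GU hG]]; exists U; split=> //; last by move=> q /hG ->.
by apply/(vsmoothP _ Uo) => r; apply: Sm_linl; exact: ((vsmoothP _ Uo).1 GU r).
Qed.

Lemma ext_of (F : vectType R) (G : E -> F) p : (forall r, Sm r [set: E] G) ->
  local_extension (fun q : TW => G (\val q)) p G.
Proof. by move=> h; exists setT; split=> //; [exact: vopenT | apply/vsmoothP => //; exact: vopenT]. Qed.

Lemma Sm_id r (W : vectType R) (U : set W) : Sm r U (fun x => x).
Proof. by have := Sm_lin r U (\1%VF : 'End(W)); congr Sm; apply/funext => x; rewrite id_lfunE. Qed.

Lemma dsm_bilin (F G H : vectType R) (b : F -> H -> G) (A : TW -> F) (B : TW -> H) p v y z :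
  bilin b -> dsm A p v y -> dsm B p v z ->
  dsm (fun q => b (A q) (B q)) p v (b y (B p) + b (A p) z).
Proof.
move=> hb [GA [eA dA]] [GB [eB dB]]; eexists; split; first exact: ext_bilin hb eA eB.
have vA : GA (\val p) = A p by case: eA => U [_ Up _ ->].
have vB : GB (\val p) = B p by case: eB => U [_ Up _ ->].
by rewrite -vA -vB; exact: isd_bilin.
Qed.

Lemma dsm_mul (A B : TW -> E) p v y z : dsm A p v y -> dsm B p v z ->
  dsm (fun q => A q * B q) p v (y * B p + A p * z).
Proof. exact: (dsm_bilin (mul_bilin V)). Qed.

Lemma dsmD (F : vectType R) (A B : TW -> F) p v y z : dsm A p v y -> dsm B p v z ->
  dsm (fun q => A q + B q) p v (y + z).
Proof.
move=> [GA [eA dA]] [GB [eB dB]]; eexists; split; first exact: ext_add eA eB.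
exact: isdD.
Qed.

Lemma dsm_lin (F G : vectType R) (L : 'Hom(F, G)) (A : TW -> F) p v y : dsm A p v y ->
  dsm (fun q => L (A q)) p v (L y).
Proof.
move=> [GA [eA dA]]; eexists; split; first exact: ext_lin eA.
exact: isd_linl.
Qed.

Lemma dsmN (F : vectType R) (A : TW -> F) p v y : dsm A p v y ->
  dsm (fun q => - A q) p v (- y).
Proof.
move=> h; have := dsm_lin (- \1%VF : 'Hom(F, F)) h.
rewrite opp_lfunE id_lfunE; congr dsm.
by apply/funext => z; rewrite opp_lfunE id_lfunE.
Qed.

Lemma dsm_cst (F : vectType R) (c : F) p v : dsm (fun=> c) p v 0.
Proof.
exists (fun=> c); split; last exact: isd_cst.
by apply: (@ext_of _ (fun=> c)) => r; exact: Sm_cst.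
Qed.

Lemma dsm_val p v : dsm (fun q => \val q : E) p v v.
Proof.
exists id; split; last exact: isd_id.
by apply: (@ext_of _ id) => r; exact: Sm_id.
Qed.

Lemma dsm_scale (F : vectType R) (f : TW -> R^o) (A : TW -> F) p v (y : R^o) z :
  dsm f p v y -> dsm A p v z ->
  dsm (fun q => (f q : R) *: A q) p v ((y : R) *: A p + (f p : R) *: z).
Proof.
apply: (dsm_bilin (b := fun (a : R^o) u => (a : R) *: u)); split=> [a|w] k u u' /=.
  by rewrite scalerDr !scalerA mulrC.
by rewrite scalerDl -scalerA.
Qed.

Lemma smooth_bilin (F G H : vectType R) (b : F -> H -> G) (A : TW -> F) (B : TW -> H) :
  bilin b -> smooth_map A -> smooth_map B -> smooth_map (fun q => b (A q) (B q)).
Proof.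
by move=> hb hA hB p; have [GA eA] := hA p; have [GB eB] := hB p; eexists; exact: ext_bilin hb eA eB.
Qed.
Lemma smooth_mul (A B : TW -> E) : smooth_map A -> smooth_map B -> smooth_map (fun q => A q * B q).
Proof. exact: (smooth_bilin (mul_bilin V)). Qed.
Lemma smoothD (F : vectType R) (A B : TW -> F) : smooth_map A -> smooth_map B ->
  smooth_map (fun q => A q + B q).
Proof.
by move=> hA hB p; have [GA eA] := hA p; have [GB eB] := hB p; eexists; exact: ext_add eA eB.
Qed.
Lemma smooth_linl (F G : vectType R) (L : 'Hom(F, G)) (A : TW -> F) : smooth_map A ->
  smooth_map (fun q => L (A q)).
Proof. by move=> hA p; have [GA eA] := hA p; eexists; exact: ext_lin eA. Qed.
Lemma smoothN (F : vectType R) (A : TW -> F) : smooth_map A -> smooth_map (fun q => - A q).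
Proof.
move=> h; have := smooth_linl (- \1%VF : 'Hom(F, F)) h; congr smooth_map.
by apply/funext => z; rewrite opp_lfunE id_lfunE.
Qed.
Lemma smooth_cst (F : vectType R) (c : F) : smooth_map (fun _ : TW => c).
Proof. by move=> p; have [G [h _]] := dsm_cst c p 0; exists G. Qed.
Lemma smooth_val : smooth_map (fun q : TW => \val q : E).
Proof. by move=> p; have [G [h _]] := dsm_val p 0; exists G. Qed.
Lemma smooth_scale (F : vectType R) (c : R) (A : TW -> F) : smooth_map A ->
  smooth_map (fun q => c *: A q).
Proof.
move=> h; have := smooth_linl (c *: \1%VF : 'Hom(F, F)) h; congr smooth_map.
by apply/funext => z; rewrite scale_lfunE id_lfunE.
Qed.

Lemma smooth_dmap (F : vectType R) (B : TW -> F) (Y : TW -> E) :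
  smooth_map B -> smooth_map Y -> (forall q, twistor_tangent g (\val q) (Y q)) ->
  smooth_map (fun q => dmap B q (Y q)).
Proof.
move=> hB hY tY p; have [GB [U [Uo Up GU hG]]] := hB p; have [GY [U' [U'o U'p GU' hG']]] := hY p.
exists (fun x => (dif GB x) (GY x)); exists (U `&` U'); split.
- exact: vopenI.
- by [].
- have ev : bilin (fun (X : 'Hom(E, F)) (v : E) => X v).
    by split=> [X|v] a u w; rewrite ?linearP // add_lfunE scale_lfunE.
  apply/(vsmoothP _ (vopenI Uo U'o)) => r; apply: (Sm_bilin ev).
    by apply: Sm_sub (Sm_dif Uo ((vsmoothP _ Uo).1 GU r.+1)) => x [].
  by apply: Sm_sub ((vsmoothP _ U'o).1 GU' r) => x [].
move=> q [Uq U'q]; rewrite (dmapE (tY q) (G := GB)); last by exists U; split.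
rewrite hG' // -(hasd_vderive (Sm_hasd ((vsmoothP _ Uo).1 GU 1%N) Uq)) //.
Qed.

Section WithJ.
Variable J : E.
Hypotheses (JJ : J * J = -1) (Ja : adj J = - J).

Lemma sigma_tangent p a : twistor_tangent g (\val p) (sigma g J (\val p) a).
Proof.
have [LL La] := twP p; apply/tangentP; rewrite sigmaE //; split; first exact: xi_tangent.
by apply: xi_anti => //; exact: ac_comm.
Qed.

Lemma sigma_linear L : linear (sigma g J L).
Proof.
move=> k a b; rewrite /sigma /commutator -/(adj _) -/(adj a) -/(adj b) !compE adjD adjZ.
have hs (A B u v : E) : A * (k *: u + v) * B = k *: (A * u * B) + A * v * B.
  by rewrite mulrDr mulrDl -scaleEr -scaleEl.
rewrite !hs; move: (_ * a * _) (_ * b * _) (_ * adj a * _) (_ * adj b * _) => x y z w.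
have -> : k *: x + y - (k *: z + w) = k *: (x - z) + (y - w) by rewrite scalerBr; abel.
move: (x - z) (y - w) => u v.
by rewrite mulrDl mulrDr -scaleEl -scaleEr [in RHS]scalerBr; abel.
Qed.

Definition pj (A : TW -> E) (q : TW) : E := A q * J + J * A q.

Lemma sigma_eq (A : TW -> E) : (fun q => sigma g J (\val q) (A q)) =
  (fun q => (J - \val q) * adj (pj A q) * (J + \val q) - (J + \val q) * pj A q * (J - \val q)).
Proof. by apply/funext => q; have [LL La] := twP q; rewrite sigmaE. Qed.

Let adjL : 'Hom(E, E) := linfun adj.
Let adjLE x : adjL x = adj x. Proof. by rewrite /adjL lfnE //; exact: adj_linear. Qed.

Lemma smooth_sigma (A : TW -> E) : smooth_map A -> smooth_map (fun q => sigma g J (\val q) (A q)).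
Proof.
move=> hA; rewrite sigma_eq.
have hS : smooth_map (fun q : TW => J + \val q) by apply: smoothD; [exact: smooth_cst|exact: smooth_val].
have hT : smooth_map (fun q : TW => J - \val q).
  by apply: smoothD; [exact: smooth_cst | apply: smoothN; exact: smooth_val].
have hP : smooth_map (pj A).
  by apply: smoothD; apply: smooth_mul => //; exact: smooth_cst.
have hP' : smooth_map (fun q => adj (pj A q)).
  by have := smooth_linl adjL hP; congr smooth_map; apply/funext => q; rewrite adjLE.
by apply: smoothD; [|apply: smoothN]; do 2!apply: smooth_mul => //.
Qed.

Lemma dmap_sigma (A : TW -> E) p X : smooth_map A -> twistor_tangent g (\val p) X ->
  let S := J + \val p in let T := J - \val p in let P := pj A p in
  dmap (fun q => sigma g J (\val q) (A q)) p X =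
  sigma g J (\val p) (dmap A p X) - X * adj P * S + T * adj P * X - X * P * T + S * P * X.
Proof.
move=> hA hX S T P; have [LL La] := twP p.
have dA := smooth_dsm hX hA.
have dS : dsm (fun q : TW => J + \val q) p X X.
  by have := dsmD (dsm_cst J p X) (dsm_val p X); rewrite add0r.
have dT : dsm (fun q : TW => J - \val q) p X (- X).
  by have := dsmD (dsm_cst J p X) (dsmN (dsm_val p X)); rewrite add0r.
have dP : dsm (pj A) p X (dmap A p X * J + J * dmap A p X).
  have := dsmD (dsm_mul dA (dsm_cst J p X)) (dsm_mul (dsm_cst J p X) dA).
  by rewrite mulr0 addr0 mul0r add0r.
have dP' : dsm (fun q => adj (pj A q)) p X (adj (dmap A p X * J + J * dmap A p X)).
  by have := dsm_lin adjL dP; rewrite adjLE; congr dsm; apply/funext => q; rewrite adjLE.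
rewrite sigma_eq; have := dsmD (dsm_mul (dsm_mul dT dP') dS) (dsmN (dsm_mul (dsm_mul dS dP) dT)).
move/(dsm_dmap hX) => ->; rewrite sigmaE // /xi -/P -/S -/T.
move: (adj (_ + _)) (adj P) => u w; nc.
Qed.

Section Identity.
Variable L : E.
Hypothesis LL : L * L = -1.
Let S := J + L.
Let T := J - L.

(** The bracket is made so that A |-> AJ + JA turns its terms without derivatives
    into a multiple of J times the commutator of P and Q. *)
Lemma bracket_twist a b : let P := a * J + J * a in let Q := b * J + J * b in
  let c := a * S * L * S * Q - P * T * L * T * b - (b * S * L * S * P - Q * T * L * T * a) in
  c * J + J * c = (- (J * (P * Q - Q * P))) *+ 4.
Proof. by rewrite /= /S /T; nc (JJ, LL). Qed.

(** For fixed P and Q, the fields with values T P' S - S P T and T Q' S - S Q T at L,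
    where P' and Q' stand for the adjoints, have as Lie bracket the field of the
    same form for a multiple of J [P, Q]. *)
Lemma flow_commutator P Q P' Q' : P * J = J * P -> Q * J = J * Q -> P' * J = J * P' -> Q' * J = J * Q' ->
  let X := T * P' * S - S * P * T in let Y := T * Q' * S - S * Q * T in
  T * (J * (Q' * P' - P' * Q') *+ 2) * S - S * (- (J * (P * Q - Q * P)) *+ 2) * T =
  (- (X * Q' * S) + T * Q' * X - X * Q * T + S * Q * X) -
  (- (Y * P' * S) + T * P' * Y - Y * P * T + S * P * Y).
Proof. by move=> h1 h2 h3 h4; rewrite /= /S /T; nc (h1, h2, h3, h4). Qed.
End Identity.

Lemma adj_commute P : P * J = J * P -> adj P * J = J * adj P.
Proof. by move=> h; have := congr1 adj h; rewrite !adjM Ja mulNr mulrN => /oppr_inj. Qed.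

Lemma bracket_anchor (A B : TW -> E) p : smooth_map A -> smooth_map B ->
  sigma g J (\val p) (sigma_bracket J A B p) =
  lie_bracket (fun q => sigma g J (\val q) (A q)) (fun q => sigma g J (\val q) (B q)) p.
Proof.
move=> hA hB; rewrite /lie_bracket !dmap_sigma //; try exact: sigma_tangent.
have [LL La] := twP p.
rewrite /sigma_bracket /sigma_half_bracket /anticommutator !compE.
have sD u v : sigma g J (\val p) (u + v) = sigma g J (\val p) u + sigma g J (\val p) v.
  by have := sigma_linear (\val p) 1 u v; rewrite !scale1r.
have sN u : sigma g J (\val p) (- u) = - sigma g J (\val p) u.
  have := sigma_linear (\val p) (-1) u 0; rewrite !scaleN1r !addr0 => ->.
  by have := sD 0 0; rewrite addr0 -[LHS]addr0 => /addrI <-; rewrite addr0.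
have XE := sigmaE JJ Ja LL (A p); have YE := sigmaE JJ Ja LL (B p).
move: (sigma g J (\val p) (A p)) (sigma g J (\val p) (B p)) XE YE => X Y XE YE.
have bt := bracket_twist LL (A p) (B p); cbv zeta in bt.
rewrite /pj; have PJ : (A p * J + J * A p) * J = J * (A p * J + J * A p) by nc (JJ).
have QJ : (B p * J + J * B p) * J = J * (B p * J + J * B p) by nc (JJ).
move: (dmap B p X) (dmap A p Y) => u v.
move: (A p) (B p) XE YE PJ QJ bt => a b XE YE PJ QJ bt.
move: (a * J + J * a) (b * J + J * b) XE YE PJ QJ bt => P Q XE YE PJ QJ bt.
move: (\val p) LL La sD sN XE YE bt => L LL La sD sN XE YE bt.
set c1 := a * _ * _ * _ * Q in bt *; set c2 := P * _ * _ * _ * b in bt *.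
set c3 := b * _ * _ * _ * P in bt *; set c4 := Q * _ * _ * _ * a in bt *.
move: c1 c2 c3 c4 bt => c1 c2 c3 c4 bt.
have -> : u + 2^-1 *: c1 - 2^-1 *: c2 - (v + 2^-1 *: c3 - 2^-1 *: c4)
   = u - v + 2^-1 *: (c1 - c2 - (c3 - c4)) by rewrite !scalerBr; abel.
move: (c1 - c2 - (c3 - c4)) bt => c bt; rewrite 2!sD sN [sigma g J L (2^-1 *: c)]sigmaE //.
pose r : E := - (J * (P * Q - Q * P)) *+ 2.
have cE : (2^-1 *: c) * J + J * (2^-1 *: c) = r.
  rewrite -scaleEl -scaleEr -scalerDr bt; have -> : - (J * (P * Q - Q * P)) *+ 4 = r *+ 2.
    by rewrite /r -mulrnA.
  by rewrite -[r *+ 2]scaler_nat scalerA mulVf ?scale1r ?pnatr_eq0.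
have Pa := adj_commute PJ; have Qa := adj_commute QJ.
have ra : adj r = J * (adj Q * adj P - adj P * adj Q) *+ 2.
  by rewrite /r mulNrn adjN mulr2n adjD !adjM adjD adjN !adjM Ja; nc (Pa, Qa).
rewrite cE /xi ra /r (flow_commutator L PJ QJ Pa Qa) XE YE /xi.
by move: (adj P) (adj Q) => P' Q'; nc.
Qed.

Lemma tangent_lin p k X Y : twistor_tangent g (\val p) X -> twistor_tangent g (\val p) Y ->
  twistor_tangent g (\val p) (k *: X + Y).
Proof.
move=> /tangentP[Xa XL] /tangentP[Ya YL]; apply/tangentP; split.
  by rewrite adjD adjZ Xa Ya opprD scalerN.
by rewrite mulrDl mulrDr -scaleEl -scaleEr XL YL scalerN opprD.
Qed.

Lemma dmap_linear (F : vectType R) (f : TW -> F) p k X Y : smooth_map f ->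
  twistor_tangent g (\val p) X -> twistor_tangent g (\val p) Y ->
  dmap f p (k *: X + Y) = k *: dmap f p X + dmap f p Y.
Proof.
move=> hf hX hY; have [G hG] := hf p; rewrite !(dmapE _ hG) //; last exact: tangent_lin.
case: hG => U [Uo Up GU _]; exact: (dif_linear (Sm_hasd ((vsmoothP _ Uo).1 GU 1%N) Up)).
Qed.

Lemma half_first (A B C D : TW -> E) p (k : R) : smooth_map C ->
  A p = k *: B p + D p -> sigma_half_bracket J A C p =
  k *: sigma_half_bracket J B C p + sigma_half_bracket J D C p.
Proof.
move=> hC hA; rewrite /sigma_half_bracket /anticommutator !compE hA sigma_linear.
rewrite dmap_linear //; try exact: sigma_tangent.
have hl (u v w : E) : (k *: u + v) * w = k *: (u * w) + v * w by rewrite mulrDl -scaleEl.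
have hac : (k *: B p + D p) * J + J * (k *: B p + D p) =
    k *: (B p * J + J * B p) + (D p * J + J * D p).
  by rewrite hl mulrDr -scaleEr scalerDr; abel.
rewrite hac !hl; move: (_ * _ * _ * _ * _) (_ * _ * _ * _ * _) => x y.
move: (_ * _ * _ * _ * _) (_ * _ * _ * _ * _) => z w.
by rewrite !(scalerDr, scalerN) !scalerA ![_ * k]mulrC; abel.
Qed.

Lemma half_0 (C : TW -> E) p : smooth_map C -> sigma_half_bracket J (fun=> 0) C p = 0.
Proof.
move=> hC; have := @half_first (fun=> 0) (fun=> 0) C (fun=> 0) p 1 hC.
rewrite scaler0 addr0 scale1r => /(_ erefl) h.
by apply: (@addrI _ (sigma_half_bracket J (fun=> 0) C p)); rewrite addr0 -h.
Qed.

Lemma half_second (A B D : TW -> E) (f : TW -> R^o) p :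
  smooth_map A -> smooth_map B -> smooth_map D -> smooth_map f ->
  sigma_half_bracket J A (fun q => (f q : R) *: B q + D q) p =
  (f p : R) *: sigma_half_bracket J A B p + sigma_half_bracket J A D p +
  (dmap f p (sigma g J (\val p) (A p)) : R) *: B p.
Proof.
move=> hA hB hD hf; rewrite /sigma_half_bracket /anticommutator !compE.
have hX := sigma_tangent p (A p).
rewrite (dsm_dmap hX (dsmD (dsm_scale (smooth_dsm hX hf) (smooth_dsm hX hB)) (smooth_dsm hX hD))).
move: (dmap f p _) (dmap B p _) (dmap D p _) => x u v.
have hr (w a b : E) : w * ((f p : R) *: a + b) = (f p : R) *: (w * a) + w * b.
  by rewrite mulrDr -scaleEr.
have hac : ((f p : R) *: B p + D p) * J + J * ((f p : R) *: B p + D p) =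
    (f p : R) *: (B p * J + J * B p) + (D p * J + J * D p).
  by rewrite hr mulrDl -scaleEl scalerDr; abel.
rewrite hac !hr; move: (_ * _ * _ * _ * _) (_ * _ * _ * _ * _) => y z.
move: (_ * _ * _ * _ * _) (_ * _ * _ * _ * _) => w w'.
by rewrite !(scalerDr, scalerN) !scalerA ![_ * (f p : R)]mulrC; abel.
Qed.

Lemma smooth_half (A B : TW -> E) : smooth_map A -> smooth_map B ->
  smooth_map (sigma_half_bracket J A B).
Proof.
move=> hA hB; rewrite /sigma_half_bracket /anticommutator.
have hS : smooth_map (fun q : TW => J + \val q) by apply: smoothD; [exact: smooth_cst|exact: smooth_val].
have hT : smooth_map (fun q : TW => J - \val q).
  by apply: smoothD; [exact: smooth_cst | apply: smoothN; exact: smooth_val].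
have hL := smooth_val.
have hac (C : TW -> E) : smooth_map C -> smooth_map (fun q => C q * J + J * C q).
  by move=> hC; apply: smoothD; apply: smooth_mul => //; exact: smooth_cst.
apply: smoothD; last first.
  apply: smoothN; apply: smooth_scale.
  exact: (smooth_mul (smooth_mul (smooth_mul (smooth_mul (hac _ hA) hT) hL) hT) hB).
apply: smoothD; last first.
  apply: smooth_scale.
  exact: (smooth_mul (smooth_mul (smooth_mul (smooth_mul hA hS) hL) hS) (hac _ hB)).
apply: smooth_dmap => //; first exact: smooth_sigma.
by move=> q; exact: sigma_tangent.
Qed.

(** The conditions are checked pointwise; only the compatibility of the anchor
   with the brackets uses the form of the quadratic terms. *)
Lemma sigma_algebroid :
  skew_algebroid (twistor_tangent g) (sigma_bracket (g := g) J)
    (fun p : TW => sigma g J (\val p)).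
Proof.
have sc (B : TW -> E) k : (fun q => k *: B q + 0) = (fun q => k *: B q) by apply/funext => q; rewrite addr0.
split.
- exact: sigma_tangent.
- by move=> p; exact: sigma_linear.
- exact: smooth_sigma.
- by move=> A B hA hB; apply: smoothD; [|apply: smoothN]; exact: smooth_half.
- move=> c A B C hA hB hC p; rewrite /sigma_bracket.
  rewrite (half_first (B := A) (D := B) (k := c) hC erefl).
  rewrite (@half_second C A B (fun=> c)) //; last exact: smooth_cst.
  rewrite (dsm_dmap (sigma_tangent p (C p)) (dsm_cst _ _ _)) scale0r addr0 [c *: (_ - sigma_half_bracket J C A p)]scalerBr; abel.
- by move=> A B hA hB p; rewrite /sigma_bracket; abel.
- by move=> A B hA hB p; rewrite (bracket_anchor p hA hB).
move=> A B f hA hB hf p; rewrite /sigma_bracket.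
have h0 : smooth_map (fun _ : TW => 0 : E) by exact: smooth_cst.
have := @half_second A B (fun=> 0) f p hA hB h0 hf.
rewrite (_ : (fun q => _ + 0) = (fun q => (f q : R) *: B q)); last by apply/funext => q; rewrite addr0.
move=> ->; rewrite (half_first (A := fun q => (f q : R) *: B q) (B := B) (D := fun=> 0) (k := f p) hA) ?addr0 //.
rewrite half_0 // addr0 [(f p : R) *: (_ - sigma_half_bracket J B A p)]scalerBr.
have -> : sigma_half_bracket J A (fun=> 0) p = 0.
  rewrite /sigma_half_bracket /anticommutator !compE (dsm_dmap (sigma_tangent p _) (dsm_cst _ _ _)).
  by rewrite !(mul0r, mulr0, addr0, scaler0, add0r) oppr0.
by rewrite addr0; abel.
Qed.
End WithJ.
End Algebroid.

(** * Embedded submanifolds presented by retractions *)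
Section Slices.
Context {R : realType} {W M : vectType R}.
Implicit Types (N G O : set W) (c : parametrization (W := W) M) (r : W -> M).

(** A parametrization c of N with a smooth map r inverting it, defined on an open
    set G of the ambient space. Such charts make N an embedded submanifold. *)
Record slice N c r G : Prop := Slice {
  sl_dom : vopen (dom c);
  sl_open : vopen G;
  sl_smooth : forall k, Sm k (dom c) c;
  sl_retract : forall k, Sm k G r;
  sl_in : forall x, dom c x -> [/\ N (c x), G (c x) & r (c x) = x];
  sl_out : forall L, N L -> G L -> dom c (r L) /\ c (r L) = L }.

Lemma slice_isd N c r G x v : slice N c r G -> dom c x ->
  isd r (c x) (vderive c x v) v.
Proof.
move=> s dx; have h : isd c x v (vderive c x v) := Sm_isd v (sl_smooth s 1) dx.
have [_ Gx _] := sl_in s dx.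
have h2 := Sm_isd (vderive c x v) (sl_retract s 1) Gx.
have h3 := isd_comp h h2.
have h4 : isd (r \o c) x v v.
  apply: (@isd_ext _ _ _ id); last exact: isd_id.
  have /vopenP/(_ _ dx) := sl_dom s; apply: filterS => y /(sl_in s)[_ _ e].
  by rewrite /= e.
by rewrite {2}(isd_unique h4 h3).
Qed.

Lemma slice_patch N c r G : slice N c r G -> Defs.patch N c.
Proof.
move=> s; split.
- exact: sl_dom s.
- by apply/vsmoothP; [exact: sl_dom s | exact: sl_smooth s].
- move=> x y /set_mem/(sl_in s)[_ _ ex] /set_mem/(sl_in s)[_ _ ey] E.
  by rewrite -ex -ey E.
- move=> x v dx e; have := slice_isd v s dx; rewrite e => h.
  have h0 : isd r (c x) 0 0 by case: h => D hD _; exists D; rewrite ?linear0.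
  exact: isd_unique h h0.
- by move=> _ [x /(sl_in s)[h _ _] <-].
Qed.

Lemma slice_preim N c r G O : slice N c r G -> vopen O -> vopen (dom c `&` c @^-1` O).
Proof.
move=> s Oo; apply: vopen_preim => //; first exact: sl_dom s.
by move=> x dx; apply: Sm_cont (sl_smooth s 0) dx.
Qed.

Lemma slice_image N c r G c' r' G' x : slice N c r G -> slice N c' r' G' -> dom c x ->
  (c' @` dom c') (c x) <-> G' (c x).
Proof.
move=> s s' dx; split=> [[y dy <-]|h]; first by have [] := sl_in s' dy.
have [Nx _ _] := sl_in s dx; have [h1 h2] := sl_out s' Nx h.
by exists (r' (c x)).
Qed.

(** The transition map is r' composed with c, and its domain is the preimage of
    the open set G'. *)
Lemma slice_compatible N c r G c' r' G' : slice N c r G -> slice N c' r' G' ->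
  compatible c c'.
Proof.
move=> s s'; have E : dom c `&` c @^-1` (c' @` dom c') = dom c `&` c @^-1` G'.
  by apply/seteqP; split=> x [dx h]; split => //; apply/(slice_image s s' dx).
rewrite /compatible E; have o : vopen (dom c `&` c @^-1` G').
  by apply: slice_preim s (sl_open s').
split=> //; exists (r' \o c).
  apply/vsmoothP => // k; apply: (@Sm_comp _ _ _ _ _ _ G').
  - by move=> x [].
  - by apply: Sm_sub (sl_smooth s k) => x [].
  - exact: sl_retract s' k.
by move=> x [dx gx]; have [Nx _ _] := sl_in s dx; apply: (sl_out s').
Qed.

Definition sliced N (Phi : set (parametrization (W := W) M)) :=
  (forall c, Phi c -> exists r G, slice N c r G) /\
  (forall p, N p -> exists2 c, Phi c & (c @` dom c) p).

Lemma sliced_atlas N Phi : sliced N Phi -> is_atlas N Phi.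
Proof.
move=> [h1 h2]; split=> //.
  by move=> c /h1[r [G s]]; exact: slice_patch s.
by move=> c c' /h1[r [G s]] /h1[r' [G' s']]; exact: slice_compatible s s'.
Qed.

(** O is cut out locally by the preimages under r of its charts. *)
Lemma sliced_topology N Phi O : sliced N Phi -> O `<=` N -> manifold_open Phi O ->
  exists2 G : set W, vopen G & O = N `&` G.
Proof.
move=> [h1 h2] ON Oo.
exists [set L | exists c r G, [/\ Phi c, slice N c r G, G L, dom c (r L) & O (c (r L))]].
  apply/vopenP => L [c [r [G [hc s GL dL OL]]]].
  have := vopen_preim (sl_open s) (Oo c hc) (fun x Gx => Sm_cont (sl_retract s 0) Gx).
  move/vopenP/(_ L); case=> // e e0 he.
  by exists e => // y /he[Gy [dy Oy]]; exists c, r, G.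
apply/seteqP; split=> L.
  move=> OL; have NL := ON _ OL; split=> //; have [c hc [x dx e]] := h2 _ NL.
  have [r [G s]] := h1 _ hc; have [_ Gx rx] := sl_in s dx; exists c, r, G.
  by rewrite -e rx e -{1}e; split.
by move=> [NL [c [r [G [hc s GL dL]]]]]; have [_ ->] := sl_out s NL GL.
Qed.

(** c agrees near x with c' composed with the transition map. *)
Lemma slice_tangent N c r G c' r' G' x x' : slice N c r G -> slice N c' r' G' ->
  dom c x -> dom c' x' -> c x = c' x' -> range (vderive c x) `<=` range (vderive c' x').
Proof.
move=> s s' dx dx' e _ [v _ <-]; have [_ Gx rx] := sl_in s' dx'; rewrite -e in Gx rx.
have h1 : isd c x v (vderive c x v) := Sm_isd v (sl_smooth s 1) dx.
have h3 := isd_comp h1 (Sm_isd (vderive c x v) (sl_retract s' 1) Gx).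
set w := vderive r' _ _ in h3.
have dx'' : dom c' ((r' \o c) x) by rewrite /= rx.
have h4 := isd_comp h3 (Sm_isd w (sl_smooth s' 1) dx''); exists w => //.
rewrite /= rx in h4; apply: (isd_unique h4); apply: isd_ext h1.
have /vopenP/(_ x) := slice_preim s (sl_open s'); case=> // t t0 ht; exists t => // y /ht[dy Gy] /=.
by have [Ny _ _] := sl_in s dy; have [_ ->] := sl_out s' Ny Gy.
Qed.
End Slices.

(** * Holomorphic charts of the strata *)
Section BaseChart.
Context {R : realType} {V : vectType R} (g : {dot V for @idfun R}) (J : 'End(V)).
Hypotheses (JJ : J * J = -1) (Ja : adj g J = - J).
Local Notation adj := (adj g).
Local Notation E := 'End(V).
Variables (K e f : 'End(V)).
Hypotheses (KK : K * K = -1) (Ka : adj K = - K) (ks : kersplit g J K e f).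

Lemma lmul_linear (A : E) : linear (fun B : E => A * B).
Proof. by have [h _] := mul_bilin V; exact: h. Qed.
Lemma rmul_linear (A : E) : linear (fun B : E => B * A).
Proof. by have [_ h] := mul_bilin V; exact: h. Qed.

Definition lmul (A : E) : 'End(E) := linfun (fun B : E => A * B).
Lemma lmulE A B : lmul A B = A * B.
Proof. by rewrite /lmul lfnE //; exact: lmul_linear. Qed.

Lemma lmul_sq : lmul K * lmul K = -1.
Proof.
apply/lfunP => B; rewrite mulEE !lmulE opp_lfunE oneEE mulrA KK; exact: mulN1r.
Qed.

Lemma linear_add (F : vectType R) (u v : E -> F) : linear u -> linear v -> linear (fun x => u x + v x).
Proof. by move=> hu hv k x y; rewrite hu hv scalerDr addrACA. Qed.
Lemma linear_comp (u v : E -> E) : linear u -> linear v -> linear (fun x => u (v x)).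
Proof. by move=> hu hv k x y; rewrite hv hu. Qed.

Definition m0_space : {vspace E} :=
  (lker (linfun (fun A : E => adj A + A)%R) :&: lker (linfun (fun A : E => A * K + K * A)%R)
   :&: (lker (linfun (fun A : E => e * A * e)%R) :&: lker (linfun (fun A : E => f * A * f)%R)))%VS.

Lemma sandwich_linear (A B : E) : linear (fun X : E => A * X * B).
Proof. exact: linear_comp (rmul_linear B) (lmul_linear A). Qed.

Lemma m0_spaceP A : reflect (m0 g K e f A) (A \in m0_space).
Proof.
have l1 : linear (fun A : E => (adj A : E) + A) by apply: linear_add; [exact: adj_linear | move=> ? ? ?].
have l2 : linear (fun A : E => A * K + K * A).
  by apply: linear_add; [exact: rmul_linear | exact: lmul_linear].
rewrite /m0_space !memv_cap !memv_ker !lfnE //; try exact: sandwich_linear.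
apply: (iffP andP) => [[/andP[/eqP h1 /eqP h2] /andP[/eqP h3 /eqP h4]]|[[h1 h2] h3 h4]].
  by split=> //; split; apply/eqP; rewrite -addr_eq0; apply/eqP.
by rewrite h1 h2 h3 h4 !addNr eqxx.
Qed.

Lemma m0_stable A : A \in m0_space -> lmul K A \in m0_space.
Proof.
move=> /m0_spaceP[[As AK] hE hF]; apply/m0_spaceP; rewrite lmulE.
have eK := ks_eL ks; have fK := ks_fL ks; split.
- by split; [rewrite adjM Ka As; nc (AK) | nc (AK)].
- have -> : e * (K * A) * e = K * (e * A * e) by nc (eK).
  by rewrite hE mulr0.
have -> : f * (K * A) * f = K * (f * A * f) by nc (fK).
by rewrite hF mulr0.
Qed.

(** The blocks of S P T vanish on Ker S and Ker T since eS = 0 = Se and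
    fT = 0 = Tf; the converse is [xi_onto]. *)
Lemma m0_im_sigma A : A \in m0_space <-> im_sigma g J K A.
Proof.
have Se := ks_Se ks; have eS := ks_eS ks; have Tf := ks_Tf ks; have fT := ks_fT ks.
split=> [/m0_spaceP[[As AK] hE hF]|[a _ <-]].
  have [P PJ <-] := xi_onto JJ Ja KK Ka ks As AK hE hF.
  by rewrite (sigma_xi JJ Ja KK PJ); eexists.
rewrite (sigmaE JJ Ja KK); set P := a * J + J * a.
have PJ : P * J = J * P by rewrite /P; nc (JJ).
apply/m0_spaceP; split.
- by split; [exact: xi_tangent | exact: xi_anti].
- by rewrite /xi; move: (J + K) (J - K) Se eS Tf fT => S T Se eS Tf fT; nc (Se, eS).
by rewrite /xi; move: (J + K) (J - K) Se eS Tf fT => S T Se eS Tf fT; nc (Tf, fT).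
Qed.

Section Coordinates.
Variables (d : nat) (p : 'Hom(cspace d, E)).
Hypotheses (hp : clin (lmul K) p) (lp : limg p = m0_space).

Definition base_dom : set (cspace d) := [set v | goodA J K e f (p v)].
Definition base_map (v : cspace d) : E := cay K (phi J K e f (p v)).
Definition base_chart : parametrization (cspace d) := Parametrization base_dom base_map.
Definition base_retract (L : E) : cspace d := (p^-1)%VF (pr e f (icay K L)).
Definition base_nbhd : set E := [set L | lker (K + L) == 0%VS] `&` base_retract @^-1` base_dom.
Definition stratum_of (K : E) : set E := [set L | twistor g L /\
  \dim (lker (J + L)) = \dim (lker (J + K)) /\ \dim (lker (J - L)) = \dim (lker (J - K))].

Lemma p_m0 v : m0 g K e f (p v).
Proof. by apply/m0_spaceP; rewrite -lp memv_img ?memvf. Qed.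

Lemma p_cancel A : m0 g K e f A -> p ((p^-1)%VF A) = A.
Proof. by move=> h; rewrite limg_lfunVK // lp; apply/m0_spaceP. Qed.

(** Injectivity and surjectivity onto the nearby points of the stratum are
    [chart_in] and [chart_onto]; smoothness holds as every ingredient is built
    from products and inverses of endomorphisms. *)
Lemma base_slice : slice (stratum_of K) base_chart base_retract base_nbhd.
Proof.
have [p0 pK] := hp.
have smp k U : Sm k U (fun v : cspace d => p v) := Sm_lin k U p.
have smD k U (S T a b : E) : Sm k U (fun v => schurD S T a b (p v)).
  rewrite /schurD; do !(apply: Sm_cst || apply: SmD || apply: Sm_mul || apply: Sm_lin).
have lko (W : vectType R) (U : set W) (u : W -> E) : vopen U -> Sm 0 U u ->
    vopen (U `&` [set v | lker (u v) == 0%VS]).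
  move=> Uo su; have o : vopen [set A : E | lker A == 0%VS] by apply/vopenP => A /hasd_inv[].
  exact: (@vopen_preim _ _ _ u U _ Uo o (fun x Ux => Sm_cont su Ux)).
have domE : base_dom = ([set: cspace d] `&` [set v | lker (schurD (J + K) (J - K) e f (p v)) == 0%VS])
    `&` [set v | lker (schurD (J - K) (J + K) f e (p v)) == 0%VS].
  by apply/seteqP; split=> [v [h1 h2]|v [[_ h1] h2]].
have domo : vopen base_dom.
  by rewrite domE; apply: (lko); [apply: (lko); [exact: vopenT | exact: smD] | exact: smD].
have smI k (U : set E) : Sm k U (fun L => L) by exact: Sm_id.
have smr k : Sm k [set L | lker (K + L) == 0%VS] base_retract.
  rewrite /base_retract; apply: Sm_linl; rewrite /pr /icay.
  have h : Sm k [set L | lker (K + L) == 0%VS] (fun L => (K + L)^-1%VF * (K - L)).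
    apply: Sm_mul; last by apply: SmB; [exact: Sm_cst | exact: smI].
    by apply: Sm_inv => //; apply: SmD; [exact: Sm_cst | exact: smI].
  by do !(apply: (h) || apply: Sm_cst || apply: SmB || apply: Sm_mul).
have KLo : vopen [set L : E | lker (K + L) == 0%VS].
  have -> : [set L : E | lker (K + L) == 0%VS] = setT `&` [set L : E | lker (K + L) == 0%VS].
    by rewrite setTI.
  by apply: (lko); [exact: vopenT | apply: SmD; [exact: Sm_cst | exact: smI]].
have inv1 v : base_dom v -> lker (1 + phi J K e f (p v)) == 0%VS.
  move=> hv; have [hs _ _] := p_m0 v; have [As _] := phi_skanti JJ Ja KK Ka ks hs hv.
  exact: skew_inv As.
split=> /=.
- exact: domo.
- by apply: vopen_preim => // L hL; exact: Sm_cont (smr 0%N) hL.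
- move=> k; rewrite /base_map /cay.
  have smM (S T a b : E) : (forall v, base_dom v -> lker (schurD S T a b (p v)) == 0%VS) ->
      Sm k base_dom (fun v => schurQ S T a b (p v)).
    move=> h; rewrite /schurQ /schurM.
    have hi : Sm k base_dom (fun v => (schurD S T a b (p v))^-1%VF) by apply: Sm_inv.
    by do !(apply: (hi) || apply: Sm_cst || apply: Sm_mul || apply: Sm_lin).
  have sphi : Sm k base_dom (fun v => phi J K e f (p v)).
    rewrite /phi /QE /QF; apply: SmD; first apply: SmD => //.
      by apply: (smM) => v [].
    by apply: (smM) => v [].
  apply: Sm_mul; first by apply: Sm_mul; [exact: Sm_cst | apply: SmB => //; exact: Sm_cst].
  by apply: Sm_inv => //; apply: SmD => //; exact: Sm_cst.
- by move=> k; apply: Sm_sub (smr k) => L [].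
- move=> v hv; have hm := p_m0 v; have [hs _ _] := hm.
  have hps := phi_skanti JJ Ja KK Ka ks hs hv.
  have [LL La d1 d2 l0] := chart_in JJ Ja KK Ka ks hm hv.
  have E0 : base_retract (base_map v) = v.
    by rewrite /base_retract /base_map (icay_cay KK hps) (pr_phi ks hm) lker0_lfunK.
  split=> //; first by split=> //; apply/twistorP.
  by split=> //; rewrite /preimage /= E0.
move=> L [/twistorP[LL La] [d1 d2]] [l0 dL].
have hA := icay_skanti KK Ka LL La l0.
have hm := pr_m0 ks hA; have pp := p_cancel hm.
have hg : goodA J K e f (pr e f (icay K L)) by rewrite -pp.
split; first exact: dL.
have [_ EL] := chart_onto KK Ka ks LL La l0 hg d1 d2.
by rewrite [RHS]EL /= /base_map /base_retract pp.
Qed.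

Lemma isd_eq (W F : vectType R) (h : W -> F) x v y z : isd h x v y -> y = z -> isd h x v z.
Proof. by move=> ? <-. Qed.

(** M has no other derivative than - M dA M because D depends on A through
    T o A o only. *)
Lemma isd_schurM S T a b v w : lker (schurD S T a b (p v)) == 0%VS ->
  let M := schurM S T a b (p v) in
  isd (fun v => schurM S T a b (p v)) v w (- (M * p w * M)).
Proof.
move=> D0; set o := 1 - a - b; rewrite /schurM -/o.
have hD : isd (fun v => schurD S T a b (p v)) v w (T * o * p w * o).
  have h1 := isd_mul (isd_mul (isd_cst (T * o) v w) (isd_lin p v w)) (isd_cst o v w).
  by have := isdD (isd_cst (S + T * a) v w) h1; rewrite mulr0 mul0r !addr0 !add0r.
have hi := @isd_inv _ _ _ (fun v => schurD S T a b (p v)) v w _ D0 hD.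
apply: (isd_eq (isd_mul (isd_mul (isd_mul (isd_cst o v w) hi) (isd_cst T v w)) (isd_cst o v w))).
by move: (schurD _ _ _ _ _)^-1%VF => Di; nc.
Qed.

Lemma isd_schurQ S T a b v w : lker (schurD S T a b (p v)) == 0%VS ->
  let M := schurM S T a b (p v) in let A := p v in let X := p w in
  isd (fun v => schurQ S T a b (p v)) v w (a * (X * M * A - A * M * X * M * A + A * M * X) * a).
Proof.
move=> D0 M A X; rewrite /schurQ.
apply: (isd_eq (isd_mul (isd_mul (isd_mul (isd_mul (isd_cst a v w) (isd_lin p v w))
  (isd_schurM w D0)) (isd_lin p v w)) (isd_cst a v w))).
by rewrite -/M -/A -/X; nc.
Qed.

Lemma isd_cay (F : cspace d -> E) v w Y : lker (1 + F v) == 0%VS -> isd F v w Y ->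
  isd (fun v => cay K (F v)) v w (- ((K + cay K (F v)) * Y * (1 + F v)^-1%VF)).
Proof.
move=> h0 hF; rewrite /cay.
have hi := @isd_inv _ _ _ (fun v => 1 + F v) v w _ h0 (isdD (isd_cst (1 : E) v w) hF).
apply: (isd_eq (isd_mul (isd_mul (isd_cst K v w) (isdB (isd_cst (1 : E) v w) hF)) hi)).
by move: (1 + F v)^-1%VF => Di; nc.
Qed.

(** The derivative of [phi] along w at the point v of the chart, in closed form. *)
Definition base_dphi v w : E :=
  let ME := schurM (J + K) (J - K) e f (p v) in let MF := schurM (J - K) (J + K) f e (p v) in
  let A := p v in let X := p w in
  X + e * (X * ME * A - A * ME * X * ME * A + A * ME * X) * e
    + f * (X * MF * A - A * MF * X * MF * A + A * MF * X) * f.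

Lemma base_isd v w : base_dom v ->
  isd base_map v w (- ((K + base_map v) * base_dphi v w * (1 + phi J K e f (p v))^-1%VF)).
Proof.
move=> hv; have [hs _ _] := p_m0 v; have [D1 D2] := hv.
have [As _] := phi_skanti JJ Ja KK Ka ks hs hv.
apply: (@isd_cay (fun v => phi J K e f (p v))); first exact: skew_inv As.
by apply: isdD; [apply: isdD; [exact: isd_lin | exact: isd_schurQ] | exact: isd_schurQ].
Qed.

(** Each term of the derivative of [phi] is linear in dA with an even number of
    factors anticommuting with K to its left, so it commutes with left
    multiplication by K; the derivative of the Cayley transform carries K to the
    current point C since (K + C) K = C (K + C). *)
Lemma base_holomorphic v w : base_dom v ->
  vderive base_map v (imul w) = base_map v * vderive base_map v w.
Proof.
move=> hv; rewrite !(isd_vderive (base_isd _ hv)); have [hs _ _] := p_m0 v.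
have [D1 D2] := hv; have [_ pK] := hp; have [As AK] := hs.
have eK := ks_eL ks; have fK := ks_fL ks; have eJ := ks_eJ ks; have fJ := ks_fJ ks.
have eT : e * (J - K) = (J - K) * e by nc (eK, eJ).
have fT : f * (J + K) = (J + K) * f by nc (fK, fJ).
have CC : base_map v * base_map v = -1 :=
  (cay_twistor KK Ka (phi_skanti JJ Ja KK Ka ks hs hv)).1.
have ME : schurM (J + K) (J - K) e f (p v) * K = - (K * schurM (J + K) (J - K) e f (p v)).
  rewrite (@schurM_anti _ _ g K (J + K) (J - K) e f (ks_ee ks) (ks_ff ks) (ks_ef ks) (ks_fe ks)
    (ks_Se ks) (ks_eS ks) (ks_Tf ks) (ks_fT ks) eT fT J _ _ eK fK eJ fJ _ hs D1) ?opprK //;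
    by nc (JJ, KK).
have eJ' : e * (- J) = - J * e by nc (eJ).
have fJ' : f * (- J) = - J * f by nc (fJ).
have MF : schurM (J - K) (J + K) f e (p v) * K = - (K * schurM (J - K) (J + K) f e (p v)).
  rewrite (@schurM_anti _ _ g K (J - K) (J + K) f e (ks_ff ks) (ks_ee ks) (ks_fe ks) (ks_ef ks)
    (ks_Tf ks) (ks_fT ks) (ks_Se ks) (ks_eS ks) fT eT (- J) _ _ fK eK fJ' eJ' _ hs D2) ?opprK //;
    by nc (JJ, KK).
rewrite /base_dphi pK lmulE; move: (1 + phi _ _ _ _ _)^-1%VF (base_map v) CC => Di C CC.
move: (schurM _ _ _ _ _) ME => M ME; move: (schurM _ _ _ _ _) MF => M' MF.
by move: (p v) AK (p w) => A AK X; nc (CC, KK, AK, ME, MF, eK, fK).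
Qed.

(** At the centre A = 0 all corrections have vanishing derivative, and the Cayley
    transform has derivative A |-> - 2KA. *)
Lemma base_center : [/\ base_dom 0, base_map 0 = K &
  range (vderive base_map 0) = im_sigma g J K].
Proof.
have [p0 pK] := hp; have h0 : base_dom 0.
  rewrite /base_dom /goodA /schurD /= linear0; split.
    by have := ST_inv JJ ks; rewrite mulr0 mul0r addr0.
  by have := TS_inv JJ ks; rewrite mulr0 mul0r addr0.
have hK : base_map 0 = K.
  rewrite /base_map linear0 /phi /QE /QF /schurQ !(mulr0, mul0r, addr0) /cay !(subr0, addr0).
  by rewrite mulr1 (_ : (1 : E)^-1%VF = 1) ?mulr1 // -(mul1_inv (mulr1 1)).
have hd w : vderive base_map 0 w = - (K * p w *+ 2).
  rewrite (isd_vderive (base_isd w h0)) hK /base_dphi linear0.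
  rewrite /phi /QE /QF /schurQ !(mulr0, mul0r, addr0, subr0).
  rewrite (_ : (1 : E)^-1%VF = 1) ?mulr1 -?(mul1_inv (mulr1 1)) //.
  by rewrite mulrDl mulr2n.
split=> //; apply/seteqP; split=> [_ [w _ <-]|A hA].
  rewrite hd; apply/m0_im_sigma; rewrite memvN mulr2n memvD //; rewrite -lmulE;
  by apply: m0_stable; apply/m0_spaceP; exact: p_m0.
have : 2^-1 *: lmul K A \in m0_space by rewrite memvZ // m0_stable //; apply/m0_im_sigma.
move/m0_spaceP/p_cancel => h; exists ((p^-1)%VF (2^-1 *: lmul K A)) => //.
rewrite hd h lmulE -scaleEr mulrA KK mulN1r scalerN mulNrn opprK.
by rewrite -[_ *+ 2]scaler_nat scalerA divff ?scale1r ?pnatr_eq0.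
Qed.
End Coordinates.
End BaseChart.

(** * Connectedness of strata *)
Section Strata.
Context {R : realType} {V : vectType R} (g : {dot V for @idfun R}) (J : 'End(V)).
Hypotheses (JJ : J * J = -1) (Ja : adj g J = - J).
Local Notation adj := (adj g).
Local Notation E := 'End(V).

(** The action carries fundamental fields to fundamental fields, so that Im sigma
    has constant dimension along a stratum. *)
Lemma act_xi a Q L : GLJ J a -> L * L = -1 -> adj L = - L -> Q * J = J * Q ->
  let Di := (actd g J a L)^-1%VF in
  xi g J (adj (a^-1)%VF * Q * adj a) (act g J a L) = (J * adj Di * xi g J Q L * Di * J) *- 4.
Proof.
move=> ha LL La QJ Di; have [_ h2 h3 h4 [h5 h6 h7]] := GLJ_inv Ja ha.
have [LL' La'] := act_twistor JJ Ja LL La ha.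
have hp := act_plus JJ Ja LL La ha; have hm := act_minus JJ Ja LL La ha.
have hp' : J + act g J a L = - (J * adj Di * (J + L) * adj a) *+ 2.
  have : adj (J + act g J a L) = - (J + act g J a L) by rewrite adjD Ja La' opprD.
  move/(congr1 -%R); rewrite opprK => <-; rewrite hp mulr2n adjD !adjM !(adjD) Ja La -/Di.
  by nc.
have hm' : J - act g J a L = - (J * adj Di * (J - L) * a^-1%VF) *+ 2.
  have : adj (J - act g J a L) = - (J - act g J a L) by rewrite adjD adjN Ja La' opprD.
  move/(congr1 -%R); rewrite opprK => <-; rewrite hm mulr2n adjD !adjM adjK !(adjD) adjN Ja La -/Di.
  by nc.
rewrite -/Di in hp hm; rewrite /xi !adjM !adjK.
rewrite [X in X * _ * (_ + _) - _]hm' [X in _ * _ * X - _]hp [X in _ - X * _ * _]hp' [X in _ - _ * _ * X]hm.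
have h1' : a^-1%VF * a = 1 by [].
by nc (h1', h3).
Qed.

(** The congruence X |-> J adj(W) X W J of [act_xi], with W the inverse of [actd],
    embeds one tangent space into the other. *)
Lemma m0_dim_le L e f L' e' f' : L * L = -1 -> adj L = - L -> L' * L' = -1 -> adj L' = - L' ->
  kersplit g J L e f -> kersplit g J L' e' f' ->
  \dim (lker (J + L)) = \dim (lker (J + L')) -> \dim (lker (J - L)) = \dim (lker (J - L')) ->
  (\dim (m0_space g L e f) <= \dim (m0_space g L' e' f'))%N.
Proof.
move=> LL La LL' La' ks ks' d1 d2.
have [a ha EL] := act_transitive JJ Ja LL La LL' La' d1 d2.
have D0 := actd_inv JJ Ja LL La ha; set Di := (actd g J a L)^-1%VF.
have DDi : actd g J a L * Di = 1 := lker0_mulV D0.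
pose h := linfun (fun X : E => (J * adj Di) * X * (Di * J)).
have hE X : h X = (J * adj Di) * X * (Di * J) by rewrite /h lfnE //; exact: sandwich_linear.
have h0 : lker h == 0%VS.
  apply/lker0P => X Y; rewrite !hE => eXY; have DDa := adj_inv g DDi.
  have {}eXY := congr1 (fun Z => adj (actd g J a L) * J * Z * J * actd g J a L) eXY.
  have DiD : Di * actd g J a L = 1 := lker0_Vmul D0.
  have DDa' : adj (actd g J a L) * adj Di = 1 by rewrite -adjM DiD adj_1.
  move: eXY; have k Z : adj (actd g J a L) * J * (J * adj Di * Z * (Di * J)) * J * actd g J a L = Z.
    by nc (JJ, DDa', DiD).
  by rewrite !k.
rewrite -(@limg_dim_eq _ _ _ h (m0_space g L e f)); last by rewrite (eqP h0) capv0.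
apply/dimvS/subvP => _ /memv_imgP[X hX ->].
have [a' _ Ea] := (m0_im_sigma JJ Ja LL La ks X).1 hX.
rewrite (sigmaE JJ Ja LL) in Ea; set Q := a' * J + J * a' in Ea.
have QJ : Q * J = J * Q by rewrite /Q; nc (JJ).
have [_ _ _ _ [_ h6 h7]] := GLJ_inv Ja ha.
set P := adj (a^-1)%VF * Q * adj a.
have PJ : P * J = J * P by rewrite /P; nc (QJ, h6, h7).
have := act_xi ha LL La QJ; rewrite -/Di -/P EL => hx.
have : xi g J P L' \in m0_space g L' e' f'.
  by apply/(m0_im_sigma JJ Ja LL' La' ks'); rewrite (sigma_xi JJ Ja LL' PJ); eexists.
rewrite hx Ea -scaler_nat memvN => /(memvZ 4%:R^-1); rewrite scalerA mulVf ?pnatr_eq0 // scale1r.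
by rewrite hE !mulrA.
Qed.

(** Connectedness of the unit interval, for a property that is locally constant. *)
Lemma unit_interval_ind (P : R -> Prop) : P 0 ->
  (forall t, 0 <= t <= 1 -> exists2 e : R, 0 < e & forall s s', 0 <= s <= 1 -> 0 <= s' <= 1 ->
    `|s - t| < e -> `|s' - t| < e -> P s -> P s') -> P 1.
Proof.
move=> P0 h; pose A : set R := [set t | 0 <= t <= 1 /\ P t].
have A0 : A 0 by split=> //; rewrite lexx ler01.
have hA : has_sup A by split; [exists 0 | exists 1 => t [/andP[]]].
have s0 : 0 <= sup A by apply: (ub_le_sup hA.2).
have s1 : sup A <= 1 by apply: (ge_sup hA.1) => t [/andP[]].
have [e e0 he] := h (sup A) (introT andP (conj s0 s1)).
have [a [a01 Pa] sa] := sup_adherent e0 hA.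
have asup : a <= sup A by apply: (ub_le_sup hA.2).
have da : `|a - sup A| < e by rewrite ltr_norml; apply/andP; split; lra.
have P' s : 0 <= s <= 1 -> `|s - sup A| < e -> P s by move=> ? ?; apply: (he a).
have [s1'|s1'] := leP 1 (sup A).
  by apply: P'; rewrite ?ler01 ?lexx // ltr_norml; apply/andP; split; lra.
pose s := Num.min (sup A + e / 2) 1.
have hs : sup A < s by rewrite /s lt_min s1' andbT; lra.
have hs1 : s <= 1 by rewrite /s ge_min lexx orbT.
have hse : s <= sup A + e / 2 by rewrite /s ge_min lexx.
have : A s.
  by split; [apply/andP; split; lra | apply: P'; rewrite ?ltr_norml; apply/andP; split; lra].
by move/(ub_le_sup hA.2); lra.
Qed.

Lemma vnb_scalar (t : R^o) (P : set R^o) : vnb t P ->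
  exists2 e : R, 0 < e & forall s : R, `|s - t| < e -> P s.
Proof.
move=> [e e0 he]; have n0 := vnorm_ge0 (1 : R^o).
exists (e / (vnorm (1 : R^o) + 1)); first by rewrite divr_gt0 // ltr_wpDl.
move=> s hs; apply: he; have -> : (s : R^o) - t = (s - t) *: (1 : R^o) by rewrite /GRing.scale /= mulr1.
rewrite vnormZ; move: hs; rewrite ltr_pdivlMr ?ltr_wpDl // => hs.
by apply: le_lt_trans hs; rewrite ler_wpM2l ?normr_ge0 // lerDl.
Qed.

Lemma path_connected_manifold (W M : vectType R) (N : set W)
    (Phi : set (parametrization (W := W) M)) p : sliced N Phi -> N p ->
  (forall q, N q -> exists c : R^o -> W, [/\ c 0 = p, c 1 = q &
    forall t : R, 0 <= t <= 1 -> N (c t) /\ vcont c t]) ->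
  manifold_connected N Phi.
Proof.
move=> hS Np hc; split; first by exists p.
have key O : O `<=` N -> manifold_open Phi O -> manifold_open Phi (N `\` O) -> O p -> O = N.
  move=> ON oO oC Op; apply/seteqP; split=> // q /hc[c [c0 <- ct]].
  have [G Go EG] := sliced_topology hS ON oO.
  have [G' G'o EG'] := sliced_topology hS (fun x => @proj1 _ _) oC.
  have m' x : N x -> G' x <-> ~ O x.
    move=> Nx; have -> : G' x = (N `&` G') x by apply/propext; split=> [|[]].
    by rewrite -EG'; split=> [[]|].
  apply: (@unit_interval_ind (fun t : R => O (c t))); first by rewrite c0.
  move=> t t01; have [Nt cc] := ct t t01.
  have ext (H : set W) : vopen H -> H (c t) -> exists2 e : R, 0 < e & forall s : R, `|s - t| < e -> H (c s).
    by move=> /vopenP Ho /Ho/cc/vnb_scalar.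
  have [Ot|nOt] := pselect (O (c t)).
    have : G (c t) by move: Ot; rewrite EG => -[].
    case/(ext _ Go) => e e0 he; exists e => // s s' h1 h1' _ h2' _.
    by rewrite EG; split; [have [] := ct s' h1' | exact: he].
  have : G' (c t) by apply/m'.
  case/(ext _ G'o) => e e0 he; exists e => // s s' h1 h1' h2 _ Os.
  by have [Ns _] := ct s h1; have /(m' _ Ns) := he s h2.
move=> O ON oO oC; have [Op|nOp] := pselect (O p); first by right; exact: key.
left; have oO' : manifold_open Phi (N `\` (N `\` O)).
  by rewrite setDD setIidr.
have := key (N `\` O) (fun x => @proj1 _ _) oC oO' (conj Np nOp) => E0.
apply/seteqP; split=> // x Ox; have : (N `\` O) x by rewrite E0; exact: ON.
by case.
Qed.

(** The orbit map along a path from 1 to the group element taking L to L'. *)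
Lemma stratum_path L L' : L * L = -1 -> adj L = - L -> stratum_of g J L L' ->
  exists c : R^o -> E, [/\ c 0 = L, c 1 = L' &
    forall t : R, 0 <= t <= 1 -> stratum_of g J L (c t) /\ vcont c t].
Proof.
move=> LL La [/twistorP[LL' La'] [d1 d2]].
have [a [a0 aJ] EL] := act_transitive JJ Ja LL La LL' La' (esym d1) (esym d2).
have [k hk] := gpath_ex JJ aJ a0.
exists (fun t : R^o => act g J (gpath J a k t) L); split.
- by rewrite gpath0 act_1.
- by rewrite gpath1.
move=> t t01; have ha : GLJ J (gpath J a k t) by split; [exact: hk | exact: gpath_J].
split.
  have [h1 h2] := act_twistor JJ Ja LL La ha; have [h3 h4] := act_kernel JJ Ja LL La ha.
  by split=> //; apply/twistorP.
pose o := (1 : R^o).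
have di : isd (fun s : R^o => s) (t : R^o) o o := isd_id _ _.
have sc (c : E) : exists y, isd (fun s : R^o => (s : R) *: c) (t : R^o) o y.
  by eexists; exact: isd_scale di (isd_cst c _ _).
have scb : exists y, isd (fun s : R^o => (1 - (s : R)) *: (1 : E)) (t : R^o) o y.
  by eexists; exact: (isd_scale (isdB (isd_cst (1 : R^o) _ _) di) (isd_cst (1 : E) _ _)).
have scq : exists y, isd (fun s : R^o => ((s : R) * (1 - s) * k) *: J) (t : R^o) o y.
  have bl : bilin (fun x y : R^o => (x : R) * y : R^o).
    by split=> [x|y] u v w; rewrite /GRing.scale /=; ring.
  by eexists; exact: (isd_scale (isd_bilin bl (isd_bilin bl di (isdB (isd_cst (1 : R^o) _ _) di))
    (isd_cst (k : R^o) _ _)) (isd_cst J _ _)).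
have [y1 hy1] := scb; have [y2 hy2] := sc a; have [y3 hy3] := scq.
have hp : isd (fun s : R^o => gpath J a k s) (t : R^o) o (y1 + y2 + y3) by exact: isdD (isdD hy1 hy2) hy3.
pose la := linfun adj; have lE x : la x = adj x by rewrite /la lfnE //; exact: adj_linear.
have hi := @isd_inv _ _ _ (fun s : R^o => gpath J a k s) t o _ ha.1 hp.
have hai := isd_linl la hi.
have hb : exists z, isd (fun s : R^o => adj (gpath J a k s)^-1%VF) (t : R^o) o z.
  by eexists; apply: isd_ext hai; exists 1 => // s _; rewrite lE.
have [z hz] := hb.
have hd := isdD (isd_mul hp (isd_cst (J + L) _ _)) (isd_mul hz (isd_cst (J - L) _ _)).
have hn := isdB (isd_mul hp (isd_cst (J + L) _ _)) (isd_mul hz (isd_cst (J - L) _ _)).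
have D0 := actd_inv JJ Ja LL La ha.
have hdi := @isd_inv _ _ _ (fun s : R^o => actd g J (gpath J a k s) L) t o _ D0 hd.
exact: isd_cont (isd_mul (isd_mul hn hdi) (isd_cst J _ _)).
Qed.
End Strata.

(** * A differential inequality *)
Section Gronwall.
Context {R : realType}.
Implicit Types W F G : vectType R.

Lemma vnb_bounded W F (h : W -> F) x : vcont h x ->
  exists2 C : R, 0 <= C & \forall y \near vnb x, vnorm (h y) <= C.
Proof.
move=> hc; exists (vnorm (h x) + 1); first by rewrite addr_ge0 ?vnorm_ge0.
have /vcontP/(_ 1 ltr01) := hc; apply: filterS => y hy.
have -> : h y = h x + (h y - h x) by rewrite addrC subrK.
by apply: le_trans (vnormD _ _) _; rewrite lerD2l ltW.
Qed.

Lemma ball_convex W (x y z : W) (e t : R) : 0 <= t <= 1 -> vnorm (y - x) < e ->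
  vnorm (z - x) < e -> vnorm (t *: (y - z) + z - x) < e.
Proof.
move=> /andP[t0 t1] hy hz; have -> : t *: (y - z) + z - x = t *: (y - x) + (1 - t) *: (z - x).
  have -> : y - z = (y - x) - (z - x) by abel.
  rewrite [t *: (_ - _)]scalerBr scalerBl scale1r; abel.
apply: le_lt_trans (vnormD _ _) _; rewrite !vnormZ !ger0_norm ?subr_ge0 //.
move: (vnorm (y - x)) (vnorm (z - x)) hy hz => a b hy hz; pose m := Num.max a b.
have me : m < e by rewrite gt_max hy hz.
have am : a <= m by rewrite le_max lexx.
have bm : b <= m by rewrite le_max lexx orbT.
apply: le_lt_trans me; clearbody m; nra.
Qed.

Lemma Sm_lip W F (U : set W) (f : W -> F) x : vopen U -> Sm 1 U f -> U x ->
  exists2 C : R, 0 <= C & exists2 e : R, 0 < e & forall y z, vnorm (y - x) < e ->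
    vnorm (z - x) < e -> vnorm (f y - f z) <= C * vnorm (y - z).
Proof.
move=> Uo hf Ux; have [k k0 hk] := bilin_bound (app_bilin W F).
have sd := Sm_dif Uo hf; have [C C0 hC] := vnb_bounded (Sm_cont sd Ux).
have [e e0 he] := filterI ((vopenP U).1 Uo x Ux) hC.
exists (k * C); first by rewrite mulr_ge0.
exists e => // y z hy hz; have -> : f y - f z = f (y - z + z) - f z by rewrite subrK.
apply: mvt_ineq; first by rewrite !mulr_ge0 ?vnorm_ge0.
move=> t t01; have [Uu hu] := he _ (ball_convex t01 hy hz).
exists (dif f (t *: (y - z) + z)); first exact: Sm_hasd hf Uu.
apply: le_trans (hk _ _) _; rewrite ler_wpM2r ?vnorm_ge0 //.
by rewrite ler_wpM2l.
Qed.

(** The form of Gronwall's inequality that is needed for maximality: by the mean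
    value inequality, h on a small ball is at most half its own supremum. *)
Lemma gronwall W F (h : W -> F) (x0 : W) (C : R) : 0 <= C -> h x0 = 0 ->
  (\forall x \near vnb x0, exists2 D, hasd h x D & forall v, vnorm (D v) <= C * vnorm (h x) * vnorm v) ->
  \forall x \near vnb x0, h x = 0.
Proof.
move=> C0 h0 hd; have [D0 /hasd_cont hc _] := vnb_self hd.
have b1 : \forall x \near vnb x0, vnorm (h x) < 1.
  by have /vcontP/(_ 1 ltr01) := hc; apply: filterS => y; rewrite h0 subr0.
(* On a ball of radius r with C r <= 1/2, the supremum s of |h| satisfies
   s <= s/2, by the mean value inequality along rays. *)
have [e e0 he] := filterI b1 hd; pose r := Num.min e (2 * (C + 1))^-1.
have C1 : 0 < 2 * (C + 1) by rewrite mulr_gt0 // ltr_wpDl.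
have r0 : 0 < r by rewrite lt_min e0 invr_gt0.
have re : r <= e by rewrite ge_min lexx.
have rC : C * r <= 2^-1.
  have h1 : r <= (2 * (C + 1))^-1 by rewrite ge_min lexx orbT.
  have h2 : (2 * (C + 1)) * r <= 1 by rewrite -ler_pdivlMl // mulr1.
  by nra.
exists r => // x hx; pose A : set R := [set vnorm (h y) | y in [set y | vnorm (y - x0) < r]].
have A0 : A 0 by exists x0 => /=; rewrite ?subrr ?vnorm0 ?h0 ?vnorm0.
have hA : has_sup A.
  split; first by exists 0.
  by exists 1 => _ [y /= hy <-]; apply: ltW; have [] := he y (lt_le_trans hy re).
have key y : vnorm (y - x0) < r -> vnorm (h y) <= 2^-1 * sup A.
  move=> hy; have s0 : 0 <= sup A by apply: (ub_le_sup hA.2).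
  have -> : h y = h (y - x0 + x0) - h x0 by rewrite subrK h0 subr0.
  apply: mvt_ineq; first by rewrite mulr_ge0.
  move=> t t01; have hb : vnorm (t *: (y - x0) + x0 - x0) < r.
    by apply: ball_convex => //; rewrite subrr vnorm0.
  have [_ [D hD bD]] := he _ (lt_le_trans hb re); exists D => //.
  apply: le_trans (bD _) _; have hs : vnorm (h (t *: (y - x0) + x0)) <= sup A.
    by apply: (ub_le_sup hA.2); exists (t *: (y - x0) + x0).
  have n0 := vnorm_ge0 (y - x0); have m0 := vnorm_ge0 (h (t *: (y - x0) + x0)).
  move: (vnorm (h _)) (vnorm (y - x0)) hs m0 hy n0 => b a hs m0 ar n0.
  move: (sup A) s0 hs => s s0 hs.
  have ba : C * (b * a) <= C * (s * r) by rewrite ler_wpM2l // ler_pM // ltW.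
  have : C * r * s <= 2^-1 * s by rewrite ler_wpM2r.
  by rewrite -!mulrA => h1; apply: le_trans ba _; rewrite [s * r]mulrC.
have sA : sup A <= 2^-1 * sup A by apply: (ge_sup hA.1) => _ [y /= hy <-]; exact: key.
by apply: vnorm_le0; have := key _ hx; lra.
Qed.
End Gronwall.

(** * Integral manifolds of the anchor *)
Section Integral.
Context {R : realType} {V : vectType R} (g : {dot V for @idfun R}) (J : 'End(V)).
Hypotheses (JJ : J * J = -1) (Ja : adj g J = - J).
Local Notation adj := (adj g).
Local Notation E := 'End(V).
Local Notation stratum := (stratum_of g J).

Lemma stratum_eq K L : stratum K L -> stratum L = stratum K.
Proof. by move=> [_ [d1 d2]]; rewrite /stratum_of d1 d2. Qed.

Lemma coordinates_ex K e f : K * K = -1 -> adj K = - K -> kersplit g J K e f ->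
  exists d (p : 'Hom(cspace d, E)), clin (lmul K) p /\ limg p = m0_space g K e f.
Proof. by move=> KK Ka ks; apply: (cbasis (lmul_sq KK)); exact: m0_stable ks. Qed.

Section Charts.
Variables (K e f : E) (d : nat) (p : 'Hom(cspace d, E)).
Hypotheses (KK : K * K = -1) (Ka : adj K = - K) (ks : kersplit g J K e f).
Hypotheses (hp : clin (lmul K) p) (lp : limg p = m0_space g K e f).

(** The dimension d does not depend on L: [m0_dim_le] applies both ways. *)
Lemma center_chart L : stratum K L ->
  exists (c : parametrization (W := E) (cspace d)) r G, [/\ slice (stratum K) c r G,
    dom c 0, c 0 = L, range (vderive c 0) = im_sigma g J L &
    forall x v, dom c x -> vderive c x (imul v) = c x * vderive c x v].
Proof.
move=> hL; have [/twistorP[LL La] [d1 d2]] := hL; have [e' [f' ks']] := kersplit_ex JJ Ja LL La.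
have [d' [p' [hp' lp']]] := coordinates_ex LL La ks'.
have E0 : d' = d.
  apply: double_inj; rewrite -(clin_dim hp') -(clin_dim hp) lp lp'.
  apply/eqP; rewrite eqn_leq (m0_dim_le JJ Ja LL La KK Ka ks' ks d1 d2).
  by rewrite (m0_dim_le JJ Ja KK Ka LL La ks ks' (esym d1) (esym d2)).
subst d'; have s := base_slice JJ Ja LL La ks' hp' lp'; rewrite (stratum_eq hL) in s.
have [c1 c2 c3] := base_center JJ Ja LL La ks' hp' lp'.
exists (base_chart J L e' f' p'), (base_retract L e' f' p'), (base_nbhd J L e' f' p'); split=> //.
by move=> x v; exact: (base_holomorphic JJ Ja LL La ks' hp' lp').
Qed.

Lemma chart_range (c : parametrization (W := E) (cspace d)) r G x : slice (stratum K) c r G ->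
  dom c x -> range (vderive c x) = im_sigma g J (c x).
Proof.
move=> s dx; have [Nx _ _] := sl_in s dx.
have [c' [r' [G' [s' d0 c0 <- _]]]] := center_chart Nx.
by apply/seteqP; split; [apply: (slice_tangent s s') | apply: (slice_tangent s' s)].
Qed.
End Charts.

Definition sigma_map (L : E) : 'End(E) := linfun (sigma g J L).
Lemma sigma_mapE L a : sigma_map L a = sigma g J L a.
Proof. by rewrite /sigma_map lfnE //; exact: sigma_linear. Qed.

Lemma sigma_map_smooth r (U : set E) : Sm r U sigma_map.
Proof.
apply: Sm_hom => a.
rewrite (_ : (fun x => _) = fun L : E => ((J + L) * a * (J - L) - (J - L) * adj a * (J + L)) * L
  - L * ((J + L) * a * (J - L) - (J - L) * adj a * (J + L))); last first.
  by apply/funext => L; rewrite sigma_mapE.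
have i : Sm r U (fun L : E => L) by exact: Sm_id.
by do !(apply: (i) || apply: Sm_cst || apply: SmB || apply: Sm_mul || apply: SmD).
Qed.

(** An integral manifold of Im sigma stays in a stratum: its distance to the
    stratum satisfies a linear differential inequality. *)
Lemma integral_local (M : vectType R) (c : M -> E) (U : set M) x0 : vopen U ->
  (forall r, Sm r U c) -> U x0 -> (forall x, U x -> twistor g (c x)) ->
  (forall x v, U x -> vderive c x v = 0 -> v = 0) ->
  (forall x, U x -> range (vderive c x) = im_sigma g J (c x)) ->
  \forall x \near vnb x0, stratum (c x0) (c x).
Proof.
move=> Uo cs Ux0 ct ci cr; set K := c x0.
have /twistorP[KK Ka] := ct _ Ux0; rewrite -/K in KK Ka.
have [e [f ks]] := kersplit_ex JJ Ja KK Ka.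
have [d [p [hp lp]]] := coordinates_ex KK Ka ks.
have s := base_slice JJ Ja KK Ka ks hp lp; have [c1 c2 c3] := base_center JJ Ja KK Ka ks hp lp.
set c0 := base_chart _ _ _ _ _ in s; set r0 := base_retract _ _ _ _ in s; set G0 := base_nbhd _ _ _ _ _ in s.
have c0d := chart_range KK Ka ks hp lp s; change (dom c0 0) in c1; change (c0 0 = K) in c2.
have [NK GK rK] := sl_in s c1; rewrite c2 in NK GK rK.
pose rho (L : E) : E := c0 (r0 L).
have Gd L : G0 L -> dom c0 (r0 L) by case.
have rs k : Sm k G0 rho by apply: Sm_comp (sl_smooth s k); [exact: Gd | exact: sl_retract s k].
have G0o := sl_open s.
pose Psi (L : E) : 'End(E) := sigma_map L - dif rho L * sigma_map L.
have Ps k : Sm k G0 Psi.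
  by apply: SmB; [|apply: Sm_mul; [exact: Sm_dif|]]; exact: sigma_map_smooth.
have rd L z : G0 L -> isd rho L z (dif rho L z).
  by move=> GL; exists (dif rho L) => //; exact: Sm_hasd (rs 1%N) GL.
(* rho is the identity on the stratum, to which sigma is tangent. *)
have P0 L : stratum K L -> G0 L -> Psi L = 0.
  move=> NL GL; apply/lfunP => u; have [dL eL] := sl_out s NL GL.
  rewrite zero_lfunE add_lfunE opp_lfunE mulEE sigma_mapE.
  have : im_sigma g J L (sigma g J L u) by eexists.
  rewrite -{1}eL -(c0d _ dL) => -[w _ <-].
  have h1 := slice_isd w s dL; have h2 := Sm_isd w (sl_smooth s 1) dL; rewrite eL in h1.
  have h3 := isd_comp h1 h2.
  by rewrite (isd_unique (rd _ _ GL) h3) subrr.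
have rhoK : rho K = K by rewrite /rho rK.
have cd x : U x -> hasd c x (dif c x) by move=> Ux; exact: Sm_hasd (cs 1%N) Ux.
have cdE x v : U x -> dif c x v = vderive c x v by move=> Ux; rewrite (hasd_vderive (cd x Ux)).
have ci' x : U x -> lker (dif c x) == 0%VS.
  by move=> Ux; rewrite -subv0; apply/subvP => v; rewrite memv_ker memv0 cdE // => /eqP/ci-> //.
(* S lifts dc through sigma at x0. In the coordinates l on the tangent space at
   x0, A is sigma composed with this lift and A' is dc, both being the identity
   at x0; correcting S by them gives a lift T of dc through sigma near x0. *)
pose S : 'Hom(M, E) := ((sigma_map K)^-1 \o dif c x0)%VF.
have SE v : sigma_map K (S v) = dif c x0 v.
  rewrite /S comp_lfunE limg_lfunVK // cdE //.
  have : im_sigma g J K (vderive c x0 v) by rewrite -cr //; eexists.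
  by case=> a _ <-; rewrite -sigma_mapE memv_img ?memvf.
clearbody S; pose l : 'Hom(E, M) := ((dif c x0)^-1)%VF.
have lE v : l (dif c x0 v) = v by apply: lker0_lfunK; exact: ci'.
clearbody l.
pose A x : 'End(M) := (l \o (sigma_map (c x) \o S))%VF.
pose A' x : 'End(M) := (l \o dif c x)%VF.
have sA : Sm 0 U A.
  apply: (Sm_bilin (comp_bilin _ _ _)); first exact: Sm_cst.
  apply: (Sm_bilin (comp_bilin _ _ _)); last exact: Sm_cst.
  exact: (@Sm_comp _ _ _ _ _ _ setT c sigma_map (fun _ _ => I) (cs 0%N) (sigma_map_smooth 0 setT)).
have sA' : Sm 0 U A'.
  apply: (Sm_bilin (comp_bilin _ _ _)); first exact: Sm_cst.
  exact: Sm_dif (cs 1%N).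
have Ax0 : A x0 = 1 by apply/lfunP => v; rewrite !comp_lfunE -/K SE lE oneEE.
have A'x0 : A' x0 = 1 by apply/lfunP => v; rewrite comp_lfunE lE oneEE.
have one0 : lker (1 : 'End(M)) == 0%VS by apply: (@lker0_mul _ _ 1 1); exact: mulr1.
have invo (B : M -> 'End(M)) : Sm 0 U B -> vopen (U `&` [set x | lker (B x) == 0%VS]).
  move=> sB; have o : vopen [set A : 'End(M) | lker A == 0%VS] by apply/vopenP => B' /hasd_inv[].
  exact: (@vopen_preim _ _ _ B U _ Uo o (fun x Ux => Sm_cont sB Ux)).
set U1 := U `&` [set x | lker (A x) == 0%VS].
have U1o : vopen U1 := invo _ sA.
have U1x : U1 x0 by split=> //=; rewrite Ax0.
pose T x : 'Hom(M, E) := (S \o ((A x)^-1 \o A' x))%VF.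
have sT : Sm 0 U1 T.
  have U1U : U1 `<=` U by move=> x [].
  apply: (Sm_bilin (comp_bilin _ _ _)); first exact: Sm_cst.
  apply: (Sm_bilin (comp_bilin _ _ _)); last exact: Sm_sub sA'.
  by apply: Sm_inv; [move=> x [] | exact: Sm_sub sA].
have dT x v : U1 x -> lker (A' x) == 0%VS -> dif c x v = sigma_map (c x) (T x v).
  move=> [Ux A0] A0'; set w := T x v.
  have : im_sigma g J (c x) (sigma g J (c x) w) by eexists.
  rewrite -cr // => -[v' _]; rewrite -cdE // => e1.
  have e2 : A' x v' = A' x v.
    rewrite [LHS]comp_lfunE e1 -sigma_mapE /w /T.
    rewrite [(S \o _)%VF v]comp_lfunE [((A x)^-1 \o _)%VF v]comp_lfunE.
    have -> z : l (sigma_map (c x) (S z)) = A x z by rewrite !comp_lfunE.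
    by rewrite -mulEE lker0_mulV // oneEE.
  by rewrite sigma_mapE -e1; congr (dif c x _); apply: (lker0P A0').
have [CT CT0 hT] := vnb_bounded (Sm_cont sT U1x).
have [k k0 hk] := bilin_bound (app_bilin M E).
have [k' k'0 hk'] := bilin_bound (app_bilin E E).
have [C1 C10 [e1 e10 hL]] := Sm_lip G0o (Ps 1%N) GK.
have cc : vcont c x0 := Sm_cont (cs 0%N) Ux0.
have rc : vcont rho K := Sm_cont (rs 0%N) GK.
have nU1 : vnb x0 U1 by apply: (vopenP U1).1.
have nA' : \forall x \near vnb x0, lker (A' x) == 0%VS.
  have /vopenP/(_ x0) := invo _ sA'; case; first by split=> //=; rewrite A'x0.
  by move=> t t0 ht; exists t => // y /ht[].
have nG : \forall x \near vnb x0, G0 (c x) by apply: cc; apply: (vopenP G0).1.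
have nb1 : \forall x \near vnb x0, vnorm (c x - K) < e1 by have /vcontP/(_ e1 e10) := cc.
have nb2 : \forall x \near vnb x0, vnorm (rho (c x) - K) < e1.
  by apply: (cc (fun y => vnorm (rho y - K) < e1)); have /vcontP/(_ e1 e10) := rc; rewrite rhoK.
pose dl x := c x - rho (c x).
have dl0 : dl x0 = 0 by rewrite /dl -/K rhoK subrr.
have : \forall x \near vnb x0, dl x = 0.
  apply: (@gronwall _ _ _ dl x0 (k' * C1 * (k * CT))) => //; first by rewrite !mulr_ge0.
  have [t t0 ht] := filterI (filterI (filterI nU1 nA') (filterI nG hT)) (filterI nb1 nb2).
  exists t => // x /ht[[[Ux A0'] [Gx Tx]] [b1 b2]].
  exists (dif c x + - (dif rho (c x) \o dif c x)%VF).
    have Ux' : U x by case: Ux.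
    have h2 := hasd_comp (cd x Ux') (Sm_hasd (rs 1%N) Gx).
    have h3 := hasd_comp h2 (hasd_lin (- \1 : 'End(E))%VF _).
    have h4 := hasdD (cd x Ux') h3.
    have -> : - (dif rho (c x) \o dif c x)%VF = (- \1 \o (dif rho (c x) \o dif c x))%VF.
      by apply/lfunP => v; rewrite !comp_lfunE !opp_lfunE comp_lfunE id_lfunE.
    by apply: hasd_ext h4; exists 1 => // y _ /=; rewrite opp_lfunE id_lfunE.
  move=> v; have -> : (dif c x + - (dif rho (c x) \o dif c x)%VF) v = Psi (c x) (T x v).
    by rewrite !add_lfunE !opp_lfunE comp_lfunE mulEE dT.
  apply: le_trans (hk' _ _) _.
  have dr := Gd _ Gx; have [Nr Gr rr] := sl_in s dr.
  have := hL _ _ b1 b2; rewrite [Psi (rho _)]P0 // subr0 -/(dl x) => h1.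
  have h2 : vnorm (T x v) <= k * CT * vnorm v.
    by apply: le_trans (hk _ _) _; rewrite ler_wpM2r ?vnorm_ge0 // ler_wpM2l.
  have -> : k' * C1 * (k * CT) * vnorm (dl x) * vnorm v =
    k' * (C1 * vnorm (dl x)) * (k * CT * vnorm v) by ring.
  by rewrite ler_pM ?mulr_ge0 ?vnorm_ge0 // ler_wpM2l.
move=> hz; have [t t0 ht] := filterI hz nG; exists t => // x /ht[/subr0_eq e2 Gx].
by have [h _ _] := sl_in s (Gd _ Gx); rewrite e2; exact: h.
Qed.
End Integral.

Section Leaf.
Context {R : realType} {V : vectType R} (g : {dot V for @idfun R}) (J : 'End(V)).
Hypotheses (JJ : J * J = -1) (Ja : adj g J = - J).
Local Notation E := 'End(V).
Local Notation stratum := (stratum_of g J).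

(** The points of N in the stratum of p, and those outside, are both open in N by
    [integral_local]; N is connected. *)
Lemma integral_in_stratum (M : vectType R) (N : set E) (Phi : set (parametrization (W := E) M)) p :
  connected_integral_submanifold (twistor g) (im_sigma g J) N Phi -> N p -> N `<=` stratum p.
Proof.
move=> [NX [hp hc _] [_ conn] hD] Np.
have loc c x : Phi c -> dom c x -> \forall y \near vnb x, dom c y /\ stratum (c x) (c y).
  move=> Pc dx; have [co cs _ ci cN] := hp c Pc.
  have cs' := (vsmoothP _ co).1 cs.
  have dn : vnb x (dom c) by apply: (vopenP (dom c)).1.
  apply: filterI dn _; apply: (integral_local JJ Ja co cs' dx) => [y dy|y v dy|y dy].
  - by apply: NX; apply: cN; exists y.
  - exact: ci.
  - exact: hD.
have cNE c x : Phi c -> dom c x -> N (c x).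
  by move=> Pc dx; have [_ _ _ _] := hp c Pc; apply; exists x.
have [||E0|E0] := conn (N `&` stratum p) (fun x => @proj1 _ _).
- move=> c Pc; apply/vopenP => x [dx [_ sx]]; have := loc c x Pc dx.
  apply: filterS => y [dy sy]; split=> //; split; first exact: cNE.
  by rewrite (stratum_eq sx) in sy.
- move=> c Pc; apply/vopenP => x [dx [_ sx]]; have := loc c x Pc dx.
  apply: filterS => y [dy sy]; split=> //; split; first exact: cNE.
  move=> [_ sy']; apply: sx; split; first exact: cNE.
  have h : stratum p = stratum (c x) by rewrite -(stratum_eq sy) (stratum_eq sy').
  rewrite h; split=> //; exact: NX (cNE _ _ Pc dx).
- have : (N `&` stratum p) p by split=> //; split=> //; exact: NX.
  by rewrite E0.
by move=> x; rewrite -{1}E0 => -[].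
Qed.

(** The atlas consists of all holomorphic charts with a retraction. A leaf through
    K lies in the stratum, which is itself integral, so both coincide. *)
Lemma stratum_leaf K : twistor g K -> exists (d : nat) (Phi : set (parametrization (cspace d))),
  is_the_leaf_through (twistor g) (im_sigma g J) K (stratum K) Phi /\
  complex_submanifold (twistor g) (@twistor_complex_structure R V) (stratum K) Phi.
Proof.
move=> hK; have /twistorP[KK Ka] := hK; have [e [f ks]] := kersplit_ex JJ Ja KK Ka.
have [d [p [hp lp]]] := coordinates_ex KK Ka ks.
pose Phi : set (parametrization (W := E) (cspace d)) := [set c | (exists r G, slice (stratum K) c r G) /\
  forall x v, dom c x -> vderive c x (imul v) = c x * vderive c x v].
have sK : stratum K K by [].
have sl : sliced (stratum K) Phi.
  split=> [c []|L hL] //.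
  have [c [r [G [s c0 cL _ ch]]]] := center_chart JJ Ja KK Ka ks hp lp hL.
  by exists c; [split=> //; exists r, G | exists 0].
have NX : stratum K `<=` twistor g by move=> L [].
have at_ := sliced_atlas sl.
have int : connected_integral_submanifold (twistor g) (im_sigma g J) (stratum K) Phi.
  split=> //.
    by apply: (path_connected_manifold sl sK) => L; exact: stratum_path.
  by move=> c x [[r [G s]] _] dx; have := chart_range JJ Ja KK Ka ks hp lp s dx.
exists d, Phi; split; last first.
  split=> //; first by move=> O; exact: sliced_topology.
  by move=> c x v [_ h]; exact: h.
have leaf : is_leaf (twistor g) (im_sigma g J) (stratum K) Phi.
  split=> // M' N' Phi' h NN'; apply/seteqP; split=> //.
  exact: integral_in_stratum h (NN' _ sK).
split=> // M' N' Phi' [h hmax] NK; apply/esym.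
exact: hmax int (integral_in_stratum h NK).
Qed.
End Leaf.

Theorem theorem3p14 (R : realType) (n : nat) (V : vectType R)
    (dimV : \dim (fullv : {vspace V}) = n.*2)
    (g : {dot V for @idfun R})
    (J : 'End(V)) (J_twistor : twistor g J)
    (K : 'End(V)) (K_twistor : twistor g K)
    (m1 m1' : nat)
    (dim_m1 : \dim (lker (J + K)) = m1.*2)
    (dim_m1' : \dim (lker (J - K)) = m1'.*2) :
  skew_algebroid (twistor_tangent g) (sigma_bracket (g := g) J)
    (fun p : twistor g => sigma g J (\val p)) /\
  exists (d : nat) (Phi : set (parametrization (cspace d))),
    is_the_leaf_through (twistor g) (im_sigma g J) K
      (twistor_stratum g J m1 m1') Phi /\
    complex_submanifold (twistor g) (@twistor_complex_structure R V)
      (twistor_stratum g J m1 m1') Phi.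
Proof.
have /twistorP[JJ Ja] := J_twistor; split; first exact: sigma_algebroid.
have -> : twistor_stratum g J m1 m1' = stratum_of g J K by rewrite /stratum_of dim_m1 dim_m1'.
exact: stratum_leaf.
Qed.
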